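(* Let $Y$ be a Seifert fibered rational homology sphere with base orbifold $S^2(3,3,3)$ and $|H_1(Y;\mathbb{Z})|$ even. Then $Y$ is $SU(2)$-cyclic, but $\pi_1(Y)$ is not cyclically finite.
   Context: A 3-manifold $Y$ is $SU(2)$-cyclic if every representation $\rho:\pi_1(Y)\to SU(2)$ has cyclic image. Seifert fibered manifolds are closed and orientable, and $S^2(3,3,3)$ is the orbifold with underlying surface $S^2$ and three cone points of order $3$. Following Boyer and Nicas, for a rational homology sphere $Y$ the group $\pi_1(Y)$ is cyclically finite if each regular cyclic cover of $Y$, other than those of maximal even degree, is a rational homology sphere. The covers in question are precisely those with fundamental group of the form $\ker(\mathrm{ad}(\rho))$, where $\rho:\pi_1(Y)\to SU(2)$ is a representation with cyclic image and $\mathrm{ad}(\rho)$ is its composition with the adjoint double cover $SU(2)\to SO(3)$. *)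

(* Defs.v *)
From HB Require Import structures.
From mathcomp Require Import all_boot all_order all_algebra.
From mathcomp Require Import spectral generic_quotient complex finmap.
From mathcomp Require Import ring lra.
From mathcomp Require Import all_classical all_reals all_analysis.
Set Implicit Arguments.
Unset Strict Implicit.
Unset Printing Implicit Defensive.
Import Order.TTheory GRing.Theory Num.Theory.
Import numFieldNormedType.Exports.
Local Open Scope classical_set_scope.
Local Open Scope ring_scope.

Section Loops.
Context {R : realType} {Y : topologicalType} (y0 : Y).

(* A map [0, 1] -> Y sending 0 and 1 to y0 is encoded by its extension to the
   real line by the constant y0; a homotopy rel endpoints is likewise extended
   from the unit square to the plane. *)
Record loop := Loop {
  loop_fun :> R -> Y;
  loop_continuous : continuous loop_fun;
  loop_out : forall t, (t <= 0) || (1 <= t) -> loop_fun t = y0 }.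

HB.instance Definition _ := gen_eqMixin loop.
HB.instance Definition _ := gen_choiceMixin loop.

Definition homotopic (a b : loop) : Prop :=
  exists H : R * R -> Y,
    [/\ continuous H,
        forall t, H (0, t) = a t,
        forall t, H (1, t) = b t &
        forall s t, (t <= 0) || (1 <= t) -> H (s, t) = y0].

Lemma continuous_paste (X : topologicalType) (phi : X -> R) (c : R)
    (f g : X -> Y) :
  continuous phi -> continuous f -> continuous g ->
  (forall x, phi x = c -> f x = g x) ->
  continuous (fun x => if phi x <= c then f x else g x).
Proof.
move=> cphi cf cg fg x; set h := fun x => _; rewrite /continuous_at.
have [xc|xc|xc] := ltgtP (phi x) c.
- have -> : h x = f x by rewrite /h ifT // ltW.
  have nx : \forall z \near x, phi z < c by exact: cvgr_lt (cphi x) _ xc.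
  refine (cvg_trans _ (cf x)); apply: near_eq_cvg.
  by near=> z; rewrite /h ifT //; apply: ltW; near: z.
- have -> : h x = g x by rewrite /h ifF // lt_geF.
  have nx : \forall z \near x, c < phi z by exact: cvgr_gt (cphi x) _ xc.
  refine (cvg_trans _ (cg x)); apply: near_eq_cvg.
  by near=> z; rewrite /h ifF //; apply: lt_geF; near: z.
- have -> : h x = f x by rewrite /h ifT // xc.
  move=> U Ux.
  have nf : \forall z \near x, U (f z) by exact: (cf x).
  have ng : \forall z \near x, U (g z) by apply: (cg x); rewrite -fg.
  by apply: filterS2 nf ng => z Uf Ug; rewrite /h /=; case: ifP.
Unshelve. all: by end_near. Qed.

Let half : R := 2^-1.

Lemma const_loop_subproof : continuous (fun _ : R => y0).
Proof. by move=> x; exact: cvg_cst. Qed.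

Definition const_loop : loop :=
  Loop const_loop_subproof (fun _ _ => erefl).

Lemma comp_loop_continuous (a : loop) (X : topologicalType) (phi : X -> R) :
  continuous phi -> continuous (fun x => a (phi x)).
Proof.
move=> cphi x; apply: continuous_comp; first exact: cphi.
exact: loop_continuous.
Qed.

Definition concat_fun (a b : R -> Y) (t : R) : Y :=
  if t <= half then a (2 * t) else b (2 * t - 1).

Let affine (p q : R) : continuous (fun t : R => p * t + q).
Proof. by move=> x; apply: cvgD; [apply: cvgMr; exact: cvg_id|exact: cvg_cst]. Qed.

Lemma concat_continuous (a b : loop) : continuous (concat_fun a b).
Proof.
apply: (continuous_paste (phi := id)).
- by move=> x; exact: cvg_id.
- apply: comp_loop_continuous => x.
  by apply: cvgMr; exact: cvg_id.
- exact/comp_loop_continuous/affine.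
- by move=> x ->; rewrite !loop_out //; apply/orP; rewrite /half; [left|right]; lra.
Qed.

Lemma concat_out (a b : loop) t :
  (t <= 0) || (1 <= t) -> concat_fun a b t = y0.
Proof.
rewrite /concat_fun /half => h; case: ifP => c; apply: loop_out; apply/orP.
  by case/orP: h => h; [left|right]; lra.
by case/orP: h => h; right; lra.
Qed.

Definition concat (a b : loop) : loop :=
  Loop (@concat_continuous a b) (@concat_out a b).

Lemma rev_continuous (a : loop) : continuous (fun t : R => a (1 - t)).
Proof.
apply: (@comp_loop_continuous a R (fun t => 1 - t)) => x.
by apply: cvgB; [exact: cvg_cst|exact: cvg_id].
Qed.

Lemma rev_out (a : loop) (t : R) : (t <= 0) || (1 <= t) -> a (1 - t) = y0.
Proof. by move=> h; apply: loop_out; case/orP: h => h; apply/orP; [right|left]; lra. Qed.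

Definition rev_loop (a : loop) : loop := Loop (@rev_continuous a) (@rev_out a).

Let fst_continuous : continuous (fun p : R * R => p.1).
Proof. by move=> p; exact: cvg_fst. Qed.

Let snd_continuous : continuous (fun p : R * R => p.2).
Proof. by move=> p; exact: cvg_snd. Qed.

Let comp2 (H : R * R -> Y) (X : topologicalType) (f g : X -> R) :
  continuous H -> continuous f -> continuous g ->
  continuous (fun x => H (f x, g x)).
Proof.
move=> cH cf cg x.
apply: (@continuous_comp _ _ _ (fun x => (f x, g x)) H); last exact: cH.
exact: (cvg_pair (cf x) (cg x)).
Qed.

Let affine_comp (X : topologicalType) (f : X -> R) (p q : R) :
  continuous f -> continuous (fun x => p * f x + q).
Proof.
by move=> cf x; apply: cvgD; [apply: cvgMr; exact: cf|exact: cvg_cst].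
Qed.

Let scale_comp (X : topologicalType) (f : X -> R) (p : R) :
  continuous f -> continuous (fun x => p * f x).
Proof. by move=> cf x; apply: cvgMr; exact: cf. Qed.

Lemma homotopic_refl a : homotopic a a.
Proof.
exists (fun p => a p.2); split=> //=; last by move=> s t; exact: loop_out.
exact: comp_loop_continuous.
Qed.

Lemma homotopic_eqfun (a b : loop) : a =1 b -> homotopic a b.
Proof.
move=> ab; have [H [cH H0 H1 Ho]] := homotopic_refl a.
by exists H; split=> // t; rewrite H1 ab.
Qed.

Lemma homotopic_sym a b : homotopic a b -> homotopic b a.
Proof.
move=> [H [cH H0 H1 Ho]]; exists (fun p => H (-1 * p.1 + 1, p.2)); split => /=.
- by apply: comp2 => //; exact: affine_comp.
- by move=> t; rewrite mulr0 add0r H1.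
- by move=> t; rewrite mulr1 addNr H0.
- by move=> s t; exact: Ho.
Qed.

Lemma homotopic_trans b a c : homotopic a b -> homotopic b c -> homotopic a c.
Proof.
move=> [H [cH H0 H1 Ho]] [K [cK K0 K1 Ko]].
exists (fun p => if p.1 <= half then H (2 * p.1, p.2) else K (2 * p.1 + -1, p.2)).
split=> /=.
- apply: continuous_paste => //.
  + by apply: comp2 => //; exact: scale_comp.
  + by apply: comp2 => //; exact: affine_comp.
  + by move=> [s t] /= ->; rewrite /half divff // H1 subrr K0.
- by move=> t; rewrite ifT ?mulr0 // /half; lra.
- move=> t; rewrite ifF; last by rewrite /half; lra.
  by rewrite mulr1 (_ : 2 + -1 = 1) ?K1 //; lra.
- by move=> s t h; case: ifP => _; [exact: Ho|exact: Ko].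
Qed.

Lemma homotopic_concat a a' b b' :
  homotopic a a' -> homotopic b b' -> homotopic (concat a b) (concat a' b').
Proof.
move=> [H [cH H0 H1 Ho]] [K [cK K0 K1 Ko]].
exists (fun p => if p.2 <= half then H (p.1, 2 * p.2) else K (p.1, 2 * p.2 + -1)).
split=> /=.
- apply: continuous_paste => //.
  + by apply: comp2 => //; exact: scale_comp.
  + by apply: comp2 => //; exact: affine_comp.
  + move=> [s t] /= ->; rewrite Ho ?Ko //; apply/orP; rewrite /half.
      by left; lra.
    by right; lra.
- by move=> t; rewrite /concat_fun H0 K0.
- by move=> t; rewrite /concat_fun H1 K1.
- move=> s t; rewrite /half => h; case: ifP => c; [apply: Ho|apply: Ko]; apply/orP.
    by case/orP: h => h; [left|right]; lra.
  by case/orP: h => h; right; lra.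
Qed.

Lemma homotopic_rev a a' : homotopic a a' -> homotopic (rev_loop a) (rev_loop a').
Proof.
move=> [H [cH H0 H1 Ho]]; exists (fun p => H (p.1, -1 * p.2 + 1)); split=> /=.
- by apply: comp2 => //; exact: affine_comp.
- by move=> t; rewrite H0; congr (a _); lra.
- by move=> t; rewrite H1; congr (a' _); lra.
- by move=> s t h; apply: Ho; apply/orP; case/orP: h => h; [right|left]; lra.
Qed.

Let id_continuous : continuous (fun t : R => t).
Proof. by move=> x; exact: cvg_id. Qed.

Let cst_continuous (c : R) : continuous (fun _ : R => c).
Proof. by move=> x; exact: cvg_cst. Qed.

Let min_continuous (f g : R -> R) : continuous f -> continuous g ->
  continuous (fun t => Num.min (f t) (g t)).
Proof. by move=> cf cg t; exact: (@continuous_min R R f g t (cf t) (cg t)). Qed.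

Let max_continuous (f g : R -> R) : continuous f -> continuous g ->
  continuous (fun t => Num.max (f t) (g t)).
Proof. by move=> cf cg t; exact: (@continuous_max R R f g t (cf t) (cg t)). Qed.

Lemma homotopic_reparam (a b c : loop) (f g : R -> R) :
  continuous f -> continuous g ->
  (forall t, (t <= 0) || (1 <= t) ->
     ((f t <= 0) && (g t <= 0)) || ((1 <= f t) && (1 <= g t))) ->
  (forall t, b t = a (f t)) -> (forall t, c t = a (g t)) -> homotopic b c.
Proof.
move=> cf cg fg bE cE.
pose clamp (s : R) := Num.max 0 (Num.min s 1).
have clampc : continuous clamp.
  by apply: max_continuous => //; exact: min_continuous.
exists (fun p => a (f p.2 + clamp p.1 * (g p.2 - f p.2))); split=> /=.
- apply: comp_loop_continuous => p.
  have cf2 : {for p, continuous (fun p : R * R => f p.2)}.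
    by apply: continuous_comp; [exact: snd_continuous|exact: cf].
  have cg2 : {for p, continuous (fun p : R * R => g p.2)}.
    by apply: continuous_comp; [exact: snd_continuous|exact: cg].
  have cc : {for p, continuous (fun p : R * R => clamp p.1)}.
    by apply: continuous_comp; [exact: fst_continuous|exact: clampc].
  by apply: cvgD; [exact: cf2|apply: cvgM; [exact: cc|exact: cvgB cg2 cf2]].
- by move=> t; rewrite bE /clamp min_l ?ler01 // maxxx mul0r addr0.
- by move=> t; rewrite cE /clamp minxx max_r ?ler01 // mul1r subrKC.
- move=> s t /fg; have : 0 <= clamp s <= 1.
    by rewrite /clamp le_max lexx ge_max ler01 ge_min lexx orbT.
  move: (clamp s) => u /andP[u0 u1] h; apply: loop_out; apply/orP.
  by case/orP: h => /andP[h1 h2]; [left|right]; nra.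
Qed.

Lemma homotopic_concat1l a : homotopic (concat const_loop a) a.
Proof.
apply: (@homotopic_reparam a _ _ (fun t => 2 * t + -1) id) => //.
- by move=> t h; apply/orP; case/orP: h => h; [left|right]; apply/andP; split; lra.
- move=> t /=; rewrite /concat_fun; case: ifP => // h.
  by rewrite loop_out //; apply/orP; left; move: h; rewrite /half; lra.
Qed.

Lemma homotopic_concat1r a : homotopic (concat a const_loop) a.
Proof.
apply: (@homotopic_reparam a _ _ (fun t => 2 * t + 0) id) => //.
- by move=> t h; apply/orP; case/orP: h => h; [left|right]; apply/andP; split; lra.
- move=> t /=; rewrite /concat_fun addr0; case: ifP => // h.
  by rewrite loop_out //; apply/orP; right; move: h; rewrite /half; lra.
Qed.

Lemma homotopic_concatV a : homotopic (concat a (rev_loop a)) const_loop.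
Proof.
apply: (@homotopic_reparam a _ _
  (fun t => Num.min (2 * t + 0) (-2 * t + 2)) (fun=> 0)) => //.
- by apply: min_continuous; exact: affine.
- move=> t h; apply/orP; left; rewrite lexx andbT ge_min.
  by apply/orP; case/orP: h => h; [left|right]; lra.
- move=> t /=; rewrite /concat_fun /half /Num.min.
  by case: ifP => h1; case: ifP => h2; congr (a _); lra.
- by move=> t /=; rewrite loop_out ?lexx.
Qed.

Lemma homotopic_concatA a b c :
  homotopic (concat a (concat b c)) (concat (concat a b) c).
Proof.
apply: homotopic_sym.
apply: (@homotopic_reparam (concat a (concat b c)) _ _
  (fun t => Num.min (2 * t + 0) (Num.min (1 * t + 4^-1) (half * t + half))) id) => //.
- by apply: min_continuous; [|apply: min_continuous]; exact: affine.
- move=> t; rewrite !ge_min !le_min /half => /orP[h|h]; apply/orP; [left|right].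
    by apply/andP; split=> //; apply/orP; left; lra.
  by apply/andP; split=> //; apply/and3P; split; lra.
- move=> t /=; rewrite /concat_fun /= /concat_fun /half.
  set m := Num.min _ _.
  have mE v : v <= 2 * t -> v <= t + 4^-1 -> v <= 2^-1 * t + 2^-1 ->
      (v == 2 * t) || (v == t + 4^-1) || (v == 2^-1 * t + 2^-1) -> m = v.
    by rewrite /m; case: (leP (1 * t + _)) => ?; case: (leP (2 * t + 0)) => ? ? ? ?;
      case/orP => [/orP[]|] /eqP ?; lra.
  have [h|h] := leP t 2^-1; last first.
    have -> : m = 2^-1 * t + 2^-1 by apply: mE; rewrite ?eqxx ?orbT //; lra.
    by do 3?[rewrite ifF; last lra]; congr (c _); lra.
  have [k|k] := leP (2 * t) 2^-1.
    have -> : m = 2 * t by apply: mE; rewrite ?eqxx ?orbT //; lra.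
    by rewrite ifT; last lra; congr (a _); lra.
  have -> : m = t + 4^-1 by apply: mE; rewrite ?eqxx ?orbT //; lra.
  by rewrite ifF; last lra; rewrite ifT; last lra; congr (b _); lra.
Qed.

Definition homotopicb : rel loop := fun a b => `[< homotopic a b >].

Lemma homotopicb_equiv : equiv_class_of homotopicb.
Proof.
split.
- by move=> a; apply/asboolP; exact: homotopic_refl.
- by move=> a b; apply/asboolP/asboolP; exact: homotopic_sym.
- move=> b a c /asboolP ab /asboolP bc; apply/asboolP.
  exact: homotopic_trans ab bc.
Qed.

Canonical homotopic_equivRel := EquivRelPack homotopicb_equiv.

End Loops.

Arguments loop R {Y} y0.

Local Open Scope quotient_scope.

Definition pi1 (R : realType) (Y : topologicalType) (y0 : Y) :=
  {eq_quot (@homotopic_equivRel R Y y0)}.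

Section Pi1.
Context {R : realType} {Y : topologicalType} (y0 : Y).
Local Notation G := (pi1 R y0).
Local Notation L := (loop R y0).

HB.instance Definition _ := Choice.on G.

Definition pi1_class (a : L) : G := \pi_G a.

Lemma pi1_classP (a b : L) : pi1_class a = pi1_class b <-> homotopic a b.
Proof. by split=> [/eqquotP/asboolP|h]; last exact/eqquotP/asboolP. Qed.

Lemma homotopic_repr (a : L) : homotopic (repr (pi1_class a)) a.
Proof. by apply/pi1_classP; rewrite /pi1_class reprK. Qed.

Definition pi1_mul (x y : G) : G := pi1_class (concat (repr x) (repr y)).
Definition pi1_inv (x : G) : G := pi1_class (rev_loop (repr x)).
Definition pi1_one : G := pi1_class (const_loop y0).

Lemma pi1_ind (P : G -> Prop) : (forall a, P (pi1_class a)) -> forall x, P x.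
Proof. by move=> h x; rewrite -[x]reprK; exact: h. Qed.

Lemma pi1_mulE a b :
  pi1_mul (pi1_class a) (pi1_class b) = pi1_class (concat a b).
Proof. by apply/pi1_classP; apply: homotopic_concat; exact: homotopic_repr. Qed.

Lemma pi1_invE a : pi1_inv (pi1_class a) = pi1_class (rev_loop a).
Proof. by apply/pi1_classP; apply: homotopic_rev; exact: homotopic_repr. Qed.

Lemma pi1_mulA : associative pi1_mul.
Proof.
elim/pi1_ind=> a; elim/pi1_ind=> b; elim/pi1_ind=> c.
by rewrite !pi1_mulE; apply/pi1_classP; exact: homotopic_concatA.
Qed.

Lemma pi1_mul1 : left_id pi1_one pi1_mul.
Proof.
by elim/pi1_ind=> a; rewrite pi1_mulE; apply/pi1_classP; exact: homotopic_concat1l.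
Qed.

Lemma pi1_mulr1 : right_id pi1_one pi1_mul.
Proof.
by elim/pi1_ind=> a; rewrite pi1_mulE; apply/pi1_classP; exact: homotopic_concat1r.
Qed.

Lemma pi1_mulV : right_inverse pi1_one pi1_inv pi1_mul.
Proof.
elim/pi1_ind=> a; rewrite pi1_invE pi1_mulE; apply/pi1_classP.
exact: homotopic_concatV.
Qed.

Lemma pi1_mulVl : left_inverse pi1_one pi1_inv pi1_mul.
Proof.
elim/pi1_ind=> a; rewrite pi1_invE pi1_mulE; apply/pi1_classP.
apply: homotopic_trans (homotopic_concatV (rev_loop a)).
apply: homotopic_eqfun => t /=; rewrite /concat_fun /=.
by case: ifP => // _; congr (a _); lra.
Qed.

HB.instance Definition _ := isGroup.Build G
  pi1_mulA pi1_mul1 pi1_mulr1 pi1_mulVl pi1_mulV.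
End Pi1.

Section Abelianization.
Local Open Scope group_scope.
Context {G : groupType}.

Definition is_subgroup (H : set G) : Prop :=
  [/\ H 1, forall x y, H x -> H y -> H (x * y) & forall x, H x -> H x^-1].

Definition derived (K : set G) : set G :=
  [set x | forall H, is_subgroup H ->
     (forall a b, K a -> K b -> H [~ a, b]) -> H x].

(* The set of cosets x [K, K] with x in K, for a subgroup K. *)
Definition abelianization (K : set G) : set (set G) :=
  [set [set x * c | c in derived K] | x in K].

End Abelianization.

Section Homology.
Context (R : realType) {Y : topologicalType} (y0 : Y).

(* H_1(Y; Z), for Y path connected, as the abelianization of pi_1(Y, y0). *)
Definition homology1 : set (set (pi1 R y0)) := abelianization setT.

(* For a closed orientable 3-manifold, H_*(Y; Q) = H_*(S^3; Q) amounts to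
   H_1(Y; Q) = 0, i.e., H_1(Y; Z) is finite. *)
Definition rational_homology_sphere : Prop := finite_set homology1.

End Homology.
Arguments homology1 R {Y} y0.
Arguments rational_homology_sphere R {Y} y0.

Section SU2.
Context {R : realType}.
Local Notation C := R[i].

Definition is_SU2 (M : 'M[C]_2) : bool := (M \is unitarymx) && (\det M == 1).

Record SU2 := MkSU2 { SU2val :> 'M[C]_2; SU2valP : is_SU2 SU2val }.

HB.instance Definition _ := [isSub for SU2val].
HB.instance Definition _ := [Choice of SU2 by <:].

Lemma is_SU2_1 : is_SU2 1%:M.
Proof.
by rewrite /is_SU2 det1 eqxx andbT; apply/unitarymxP; rewrite mul1mx trmx1 map_mx1.
Qed.

Lemma is_SU2_mul (M N : SU2) : is_SU2 (M *m N).
Proof.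
have /andP[uM /eqP dM] := SU2valP M; have /andP[uN /eqP dN] := SU2valP N.
by rewrite /is_SU2 mul_unitarymx //= det_mulmx dM dN mulr1.
Qed.

Lemma is_SU2_inv (M : SU2) : is_SU2 (invmx M).
Proof.
have /andP[uM /eqP dM] := SU2valP M; rewrite /is_SU2 /= det_inv dM invr1 eqxx andbT.
by rewrite invmx_unitary //; apply/unitarymxP; rewrite trmxCK -invmx_unitary // mulVmx // unitarymx_unit.
Qed.

Definition SU2_one := MkSU2 is_SU2_1.
Definition SU2_mul (M N : SU2) := MkSU2 (is_SU2_mul M N).
Definition SU2_inv (M : SU2) := MkSU2 (is_SU2_inv M).

Lemma SU2_unit (M : SU2) : SU2val M \in unitmx.
Proof. by have /andP[uM _] := SU2valP M; exact: unitarymx_unit. Qed.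

Lemma SU2_mulA : associative SU2_mul.
Proof. by move=> M N P; apply: val_inj; rewrite /= mulmxA. Qed.
Lemma SU2_mul1 : left_id SU2_one SU2_mul.
Proof. by move=> M; apply: val_inj; rewrite /= mul1mx. Qed.
Lemma SU2_mulr1 : right_id SU2_one SU2_mul.
Proof. by move=> M; apply: val_inj; rewrite /= mulmx1. Qed.
Lemma SU2_mulVl : left_inverse SU2_one SU2_inv SU2_mul.
Proof. by move=> M; apply: val_inj; rewrite /= mulVmx // SU2_unit. Qed.
Lemma SU2_mulV : right_inverse SU2_one SU2_inv SU2_mul.
Proof. by move=> M; apply: val_inj; rewrite /= mulmxV // SU2_unit. Qed.

HB.instance Definition _ := isGroup.Build SU2
  SU2_mulA SU2_mul1 SU2_mulr1 SU2_mulVl SU2_mulV.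

Definition su2 : set 'M[C]_2 := [set X | (X ^t*)%sesqui = - X /\ \tr X = 0].

(* The adjoint double cover SU(2) -> SO(su(2)) = SO(3). *)
Definition Ad (g : SU2) (X : 'M[C]_2) : 'M[C]_2 := g *m X *m invmx g.

End SU2.
Arguments SU2 R : clear implicits.

Definition cyclic_image (G H : groupType) (rho : {multiplicative G -> H}) : Prop :=
  exists g, forall x, exists n : nat,
    (rho x = rho g ^+ n)%g \/ (rho x = rho g ^- n)%g.

Definition SU2_cyclic (R : realType) (Y : topologicalType) (y0 : Y) : Prop :=
  forall rho : {multiplicative pi1 R y0 -> SU2 R}, cyclic_image rho.

Definition ker_ad (R : realType) (G : groupType)
    (rho : {multiplicative G -> SU2 R}) : set G :=
  [set x | forall X, su2 X -> Ad (rho x) X = X].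

(* The cover of Y with fundamental group ker (ad rho) is a closed orientable
   3-manifold whose first homology is the abelianization of ker (ad rho). *)
Definition cyclically_finite (R : realType) (Y : topologicalType) (y0 : Y) : Prop :=
  forall rho : {multiplicative pi1 R y0 -> SU2 R},
    cyclic_image rho -> finite_set (abelianization (ker_ad rho)).

Section Seifert.
Context (R : realType).
Local Notation plane := (R * R)%type.
Local Notation space := 'rV[R]_3.

Definition cis (t : R) : plane := (cos t, sin t).
Definition circle : set plane := [set w | w.1 ^+ 2 + w.2 ^+ 2 = 1].
Definition disk : set plane := [set z | z.1 ^+ 2 + z.2 ^+ 2 <= 1].

(* The unit sphere minus three disjoint open round disks, the i-th one being
   centered at the i-th vector of the standard basis. *)
Definition pants : set space :=
  [set u | \sum_i u 0 i ^+ 2 = 1 /\ forall i, u 0 i <= 4 / 5].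

(* The i-th boundary circle of pants; the three are permuted by the cyclic
   permutation of the coordinates, so their orientations are consistent. *)
Definition pants_boundary (i : 'I_3) (t : R) : space :=
  \row_j (if j == i then 4 / 5
          else if j == i + 1 then 3 / 5 * cos t else 3 / 5 * sin t).

(* A closed orientable Seifert fibered manifold with base orbifold
   S^2(alpha 0, alpha 1, alpha 2) is obtained from the product fibration
   pants x circle -> pants by gluing three fibered solid tori V_i = disk x circle along the
   boundary tori. On the boundary of V_i the gluing is the linear map
     (t, s) |-> (alpha_i t + gamma_i s, beta_i t + delta_i s),
   of determinant 1, in angular coordinates. A meridian of V_i thus goes to
   alpha_i times the boundary curve of pants plus beta_i times the fiber, so the
   fibers of V_i wind alpha_i times around its core, which is the exceptional
   fiber of multiplicity alpha_i. The Euler number is absorbed in the beta_i,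
   which are not normalized. *)
Record seifert_S2 (alpha : 'I_3 -> nat) (Y : topologicalType) := SeifertS2 {
  seifert_beta : 'I_3 -> int;
  seifert_gamma : 'I_3 -> int;
  seifert_delta : 'I_3 -> int;
  product_part : space * plane -> Y;
  solid_torus : 'I_3 -> plane * plane -> Y;
  seifert_gt0 : forall i, (0 < alpha i)%N;
  seifert_det : forall i,
    (alpha i)%:Z * seifert_delta i - seifert_gamma i * seifert_beta i = 1;
  seifert_hausdorff : hausdorff_space Y;
  product_part_continuous : {within pants `*` circle, continuous product_part};
  solid_torus_continuous :
    forall i, {within disk `*` circle, continuous (solid_torus i)};
  product_part_inj : {in pants `*` circle &, injective product_part};
  solid_torus_inj : forall i, {in disk `*` circle &, injective (solid_torus i)};
  seifert_cover :
    product_part @` (pants `*` circle) `|`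
      \bigcup_i (solid_torus i @` (disk `*` circle)) = setT;
  seifert_glue : forall i t s,
    solid_torus i (cis t, cis s) =
    product_part
      (pants_boundary i ((alpha i)%:R * t + (seifert_gamma i)%:~R * s),
       cis ((seifert_beta i)%:~R * t + (seifert_delta i)%:~R * s));
  seifert_meet : forall i v p,
    (disk `*` circle) v -> (pants `*` circle) p ->
    solid_torus i v = product_part p -> circle v.1;
  seifert_disjoint : forall i j v w,
    (disk `*` circle) v -> (disk `*` circle) w ->
    solid_torus i v = solid_torus j w -> i = j }.

End Seifert.

(* Main.v *)
(* Let L_i be the class of the core of the i-th solid torus, based at a hub by
   means of a deformation of a neighbourhood of that torus. As the gluing matrices
   have determinant 1, the L_i generate pi_1(Y), and they satisfy
   L_0^3 = L_1^3 = L_2^3 = h, where h is the fiber, and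
   L_0^(-beta_0) L_1^(-beta_1) L_2^(-beta_2) = 1.

   If the sum of the beta_i were odd, every element of H_1(Y) would be a double, so
   that H_1(Y) would have odd order. Hence the sum is even and, up to signs, a
   representation to SU(2) gives three elements of order 3 with product 1, which
   must commute; its image is then a finite abelian subgroup of a circle.

   Conversely pi_1(Y) maps onto a group of similarities of the complex plane
   generated by three rotations of order 3 with distinct centers. This map is the
   holonomy of an explicit flat cocycle on Y, so that no presentation of pi_1(Y) is
   needed. Its linear part gives a cyclic representation to SU(2), and on the kernel
   of the adjoint of the latter the translation part is an additive map with
   infinite image. *)
Require Import Defs.
From HB Require Import structures.
From mathcomp Require Import all_boot all_order all_algebra finmap cyclic.
From mathcomp Require Import spectral generic_quotient complex.
From mathcomp Require Import ring lra zify.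
From mathcomp Require Import all_classical all_reals all_analysis.
Set Implicit Arguments.
Unset Strict Implicit.
Unset Printing Implicit Defensive.
Import Order.TTheory GRing.Theory Num.Theory.
Import numFieldNormedType.Exports.
Local Open Scope classical_set_scope.
Local Open Scope ring_scope.

(** * Paths and holonomy *)

(** Behind the second half is the Euclidean triangle group of type (3,3,3): the fiber goes to 1 and
    [L_i ^ beta_i], up to a conjugation common to all i, to a rotation of order 3. This is
    consistent because the determinant condition makes [beta_i] invertible modulo 3, with inverse
    [- gamma_i]. The order 3 also tames the cocycle. Over the product piece the angle along the i-th
    core is three times the fiber angle minus [beta_i] times the boundary angle, so a full turn in
    the choice of the fiber angle amounts to three turns of the core, which a rotation of order 3
    does not see. Classes of paths are computed through maps from normed spaces into Y: convexity of
    the source makes the class depend on the endpoints in the source only, and the solid tori enter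
    through such maps, which play the part of their universal covers. Finiteness of H_1 acts twice
    in the first half. Doubling, when onto, becomes injective, which forces odd order; and an
    abelian image becomes finite, which for subgroups of a circle means cyclic. In the second half
    it is the commutation of translations that makes the translation part vanish on commutators. *)

Section Groupoid.
Context {R : realType} {Y : topologicalType}.

(* As for [loop], a path [0, 1] -> Y is extended by constants to the real line. *)
Record path (y z : Y) := Path {
  path_fun :> R -> Y;
  path_cont : continuous path_fun;
  path_le0 : forall t, t <= 0 -> path_fun t = y;
  path_ge1 : forall t, 1 <= t -> path_fun t = z }.

Definition phom y z (p q : path y z) : Prop :=
  exists H : R * R -> Y,
    [/\ continuous H, forall t, H (0, t) = p t, forall t, H (1, t) = q t,
        forall s t, t <= 0 -> H (s, t) = y & forall s t, 1 <= t -> H (s, t) = z].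

Definition clamp (s : R) : R := Num.max 0 (Num.min s 1).

Lemma clamp_le0 s : s <= 0 -> clamp s = 0.
Proof. by move=> s0; rewrite /clamp max_l // ge_min s0. Qed.

Lemma clamp_ge1 s : 1 <= s -> clamp s = 1.
Proof. by move=> s1; rewrite /clamp (min_r s1) max_r. Qed.

Lemma clamp_id s : 0 <= s <= 1 -> clamp s = s.
Proof. by case/andP=> s0 s1; rewrite /clamp (min_l s1) max_r. Qed.

Lemma clamp_itv s : 0 <= clamp s <= 1.
Proof. by rewrite /clamp le_max lexx ge_max ler01 ge_min lexx orbT. Qed.

Lemma clamp_cont : continuous clamp.
Proof.
move=> s; apply: (@continuous_max R R (cst 0) (fun s => Num.min s 1)).
  exact: cvg_cst.
by apply: (@continuous_min R R id (cst 1)); [exact: cvg_id|exact: cvg_cst].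
Qed.

Lemma continuous_compose (X1 X2 X3 : topologicalType) (g : X2 -> X3) (f : X1 -> X2) :
  continuous g -> continuous f -> continuous (fun x => g (f x)).
Proof. by move=> cg cf x; apply: continuous_comp; [exact: cf|exact: cg]. Qed.

Lemma continuous_tuple (X1 X2 X3 : topologicalType) (f : X1 -> X2) (g : X1 -> X3) :
  continuous f -> continuous g -> continuous (fun x => (f x, g x)).
Proof. by move=> cf cg x; exact: (cvg_pair (cf x) (cg x)). Qed.

Lemma continuous_affine (X : topologicalType) (f : X -> R) (p q : R) :
  continuous f -> continuous (fun x => p * f x + q).
Proof.
by move=> cf x; apply: cvgD; [apply: cvgMr; exact: cf|exact: cvg_cst].
Qed.

Lemma fst_cont (X1 X2 : topologicalType) : continuous (@fst X1 X2).
Proof. by move=> p; exact: cvg_fst. Qed.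

Lemma snd_cont (X1 X2 : topologicalType) : continuous (@snd X1 X2).
Proof. by move=> p; exact: cvg_snd. Qed.

Lemma id_cont (X : topologicalType) : continuous (fun x : X => x).
Proof. by move=> x; exact: cvg_id. Qed.

Lemma cst_cont (X1 X2 : topologicalType) (c : X2) : continuous (fun _ : X1 => c).
Proof. by move=> x; exact: cvg_cst. Qed.

Lemma phom_refl y z (p : path y z) : phom p p.
Proof.
exists (fun x => p x.2); split=> //=.
- by apply: continuous_compose; [exact: path_cont|exact: snd_cont].
- by move=> s t; exact: path_le0.
- by move=> s t; exact: path_ge1.
Qed.

Lemma phom_eqfun y z (p q : path y z) : p =1 q -> phom p q.
Proof.
move=> pq; have [H [? ? h ? ?]] := phom_refl p.
by exists H; split=> // t; rewrite h pq.
Qed.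

Lemma phom_sym y z (p q : path y z) : phom p q -> phom q p.
Proof.
move=> [H [cH H0 H1 Ha Hb]]; exists (fun x => H (-1 * x.1 + 1, x.2)); split => /=.
- apply: continuous_compose => //; apply: continuous_tuple; last exact: snd_cont.
  by apply: continuous_affine; exact: fst_cont.
- by move=> t; rewrite mulr0 add0r H1.
- by move=> t; rewrite mulr1 addNr H0.
- by move=> s t; exact: Ha.
- by move=> s t; exact: Hb.
Qed.

Lemma phom_trans y z (q p r : path y z) : phom p q -> phom q r -> phom p r.
Proof.
move=> [H [cH H0 H1 Ha Hb]] [K [cK K0 K1 Ka Kb]].
exists (fun x => if x.1 <= 2^-1 then H (2 * x.1 + 0, x.2) else K (2 * x.1 + -1, x.2)).
split=> /=.
- apply: continuous_paste; first exact: fst_cont.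
  + apply: continuous_compose => //; apply: continuous_tuple; last exact: snd_cont.
    by apply: continuous_affine; exact: fst_cont.
  + apply: continuous_compose => //; apply: continuous_tuple; last exact: snd_cont.
    by apply: continuous_affine; exact: fst_cont.
  + by move=> [s t] /= ->; rewrite divff // addr0 H1 subrr K0.
- by move=> t; rewrite ifT ?mulr0 ?addr0 //; lra.
- move=> t; rewrite ifF; last by lra.
  by rewrite mulr1 (_ : 2 + -1 = 1) ?K1 //; lra.
- by move=> s t h; case: ifP => _; [exact: Ha|exact: Ka].
- by move=> s t h; case: ifP => _; [exact: Hb|exact: Kb].
Qed.

Definition pconst y : path y y :=
  Path (@cst_cont R Y y) (fun _ _ => erefl) (fun _ _ => erefl).

Section Concat.
Variables (x y z : Y) (p : path x y) (q : path y z).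

Fact pconcat_cont : continuous (concat_fun p q).
Proof.
apply: (continuous_paste (phi := id)); first exact: id_cont.
- apply: continuous_compose; first exact: path_cont.
  by move=> t; apply: cvgMr; exact: cvg_id.
- apply: continuous_compose; first exact: path_cont.
  by apply: (@continuous_affine R id 2 (-1)); exact: id_cont.
- by move=> t ->; rewrite path_ge1 ?path_le0 //; lra.
Qed.

Fact pconcat_le0 t : t <= 0 -> concat_fun p q t = x.
Proof. by move=> t0; rewrite /concat_fun ifT ?path_le0 //; lra. Qed.

Fact pconcat_ge1 t : 1 <= t -> concat_fun p q t = z.
Proof. by move=> t1; rewrite /concat_fun ifF ?path_ge1 //; lra. Qed.

Definition pconcat : path x z := Path pconcat_cont pconcat_le0 pconcat_ge1.

Fact prev_cont : continuous (fun t : R => p (-1 * t + 1)).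
Proof.
apply: continuous_compose; first exact: path_cont.
by apply: (@continuous_affine R id); exact: id_cont.
Qed.

Fact prev_le0 t : t <= 0 -> p (-1 * t + 1) = y.
Proof. by move=> t0; rewrite path_ge1 //; lra. Qed.

Fact prev_ge1 t : 1 <= t -> p (-1 * t + 1) = x.
Proof. by move=> t0; rewrite path_le0 //; lra. Qed.

Definition prev : path y x := Path prev_cont prev_le0 prev_ge1.
End Concat.

Lemma phom_concat x y z (p p' : path x y) (q q' : path y z) :
  phom p p' -> phom q q' -> phom (pconcat p q) (pconcat p' q').
Proof.
move=> [H [cH H0 H1 Ha Hb]] [K [cK K0 K1 Ka Kb]].
exists (fun x => if x.2 <= 2^-1 then H (x.1, 2 * x.2 + 0) else K (x.1, 2 * x.2 + -1)).
split=> /=.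
- apply: continuous_paste; first exact: snd_cont.
  + apply: continuous_compose => //; apply: continuous_tuple; first exact: fst_cont.
    by apply: continuous_affine; exact: snd_cont.
  + apply: continuous_compose => //; apply: continuous_tuple; first exact: fst_cont.
    by apply: continuous_affine; exact: snd_cont.
  + by move=> [s t] /= ->; rewrite Hb ?Ka //; lra.
- by move=> t; rewrite /concat_fun H0 K0 addr0.
- by move=> t; rewrite /concat_fun H1 K1 addr0.
- by move=> s t h; rewrite ifT ?Ha //; lra.
- by move=> s t h; rewrite ifF ?Kb //; lra.
Qed.

(** Straight-line homotopy between [f] and [g] in [E], followed by [F]; it is constant at the ends
    because [f] and [g] agree there. Reparametrizations and the invariance of [hol] both come from
    it. *)
Lemma phom_convex (E : normedModType R) (F : E -> Y) (e0 e1 : E) (f g : R -> E)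
    y z (p q : path y z) :
  continuous F -> continuous f -> continuous g ->
  (forall t, t <= 0 -> f t = e0 /\ g t = e0) ->
  (forall t, 1 <= t -> f t = e1 /\ g t = e1) ->
  (forall t, p t = F (f t)) -> (forall t, q t = F (g t)) -> phom p q.
Proof.
move=> cF cf cg fg0 fg1 pE qE.
exists (fun x => F (f x.2 + x.1 *: (g x.2 - f x.2))); split=> /=.
- apply: continuous_compose => // x.
  have cfx : {for x, continuous (fun x : R * R => f x.2)}.
    exact: (continuous_compose cf (@snd_cont R R)).
  have cgx : {for x, continuous (fun x : R * R => g x.2)}.
    exact: (continuous_compose cg (@snd_cont R R)).
  by apply: cvgD => //; apply: cvgZ; [exact: cvg_fst|exact: cvgB].
- by move=> t; rewrite scale0r addr0.
- by move=> t; rewrite scale1r subrKC.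
- by move=> s t /[dup] t0 /fg0 [-> ->]; rewrite subrr scaler0 addr0
    -(path_le0 p (lexx 0)) pE; have [-> _] := fg0 0 (lexx 0).
- by move=> s t /[dup] t0 /fg1 [-> ->]; rewrite subrr scaler0 addr0
    -(path_ge1 p (lexx 1)) pE; have [-> _] := fg1 1 (lexx 1).
Qed.

(** A path is unchanged by precomposition with [clamp], so the two parameters have to agree at the
    ends only after clamping. *)
Lemma phom_reparam y z x x' (a : path y z) (p q : path x x') (f g : R -> R) :
  continuous f -> continuous g ->
  (forall t, t <= 0 -> clamp (f t) = clamp (g t) :> R /\ clamp (f t) = clamp (f 0)) ->
  (forall t, 1 <= t -> clamp (f t) = clamp (g t) :> R /\ clamp (f t) = clamp (f 1)) ->
  (forall t, p t = a (f t)) -> (forall t, q t = a (g t)) -> phom p q.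
Proof.
move=> cf cg f0 f1 pE qE.
have aE t : a (clamp t) = a t.
  have [t0|t0] := leP t 0; first by rewrite clamp_le0 // !path_le0.
  have [t1|t1] := leP 1 t; first by rewrite clamp_ge1 // !path_ge1.
  by rewrite clamp_id // !ltW.
apply: (@phom_convex R a (clamp (f 0)) (clamp (f 1))
  (fun t => clamp (f t)) (fun t => clamp (g t))).
- exact: path_cont.
- exact: (continuous_compose clamp_cont).
- exact: (continuous_compose clamp_cont).
- by move=> t /f0 [<- ->].
- by move=> t /f1 [<- ->].
- by move=> t; rewrite pE aE.
- by move=> t; rewrite qE aE.
Qed.

Lemma min_cont (f g : R -> R) : continuous f -> continuous g ->
  continuous (fun t => Num.min (f t) (g t)).
Proof. by move=> cf cg t; exact: (@continuous_min R R f g t (cf t) (cg t)). Qed.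

Lemma affine_cont (p q : R) : continuous (fun t : R => p * t + q).
Proof. by apply: (@continuous_affine R id); exact: id_cont. Qed.

Lemma phom_concat1l y z (p : path y z) : phom (pconcat (pconst y) p) p.
Proof.
apply: (@phom_reparam _ _ _ _ p _ _ (fun t => 2 * t + -1) (fun t => t)) => //.
- exact: affine_cont.
- exact: id_cont.
- by move=> t h; rewrite !clamp_le0 //; lra.
- by move=> t h; rewrite !clamp_ge1 //; lra.
- move=> t /=; rewrite /concat_fun; case: ifP => // h.
  by rewrite path_le0 //; lra.
Qed.

Lemma phom_concatVl y z (p : path y z) : phom (pconcat (prev p) p) (pconst z).
Proof.
apply: (@phom_reparam _ _ _ _ p _ _
  (fun t => 1 - Num.min (2 * t + 0) (-2 * t + 2)) (fun=> 1)) => //.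
- move=> t; apply: cvgB; first exact: cvg_cst.
  by apply: (@min_cont (fun t => 2 * t + 0) (fun t => -2 * t + 2)); exact: affine_cont.
- exact: cst_cont.
- move=> t h; rewrite !clamp_ge1 //; rewrite /Num.min; case: ifP; lra.
- move=> t h; rewrite !clamp_ge1 //; rewrite /Num.min; case: ifP; lra.
- move=> t /=; rewrite /concat_fun /= /Num.min.
  by case: ifP => h1; case: ifP => h2; congr (p _); lra.
- by move=> t /=; rewrite path_ge1 ?lexx.
Qed.

Lemma phom_concatA w x y z (a : path w x) (b : path x y) (c : path y z) :
  phom (pconcat (pconcat a b) c) (pconcat a (pconcat b c)).
Proof.
apply: (@phom_reparam _ _ _ _ (pconcat a (pconcat b c)) _ _
  (fun t => Num.min (2 * t + 0) (Num.min (1 * t + 4^-1) (2^-1 * t + 2^-1)))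
  (fun t => t)) => //.
- by apply: min_cont; [|apply: min_cont]; exact: affine_cont.
- exact: id_cont.
- by move=> t h; rewrite !clamp_le0 // ge_min; apply/orP; left; lra.
- by move=> t h; rewrite !clamp_ge1 // !le_min; apply/and3P; split; lra.
- move=> t /=; rewrite /concat_fun /= /concat_fun.
  set m := Num.min _ _.
  have mE v : v <= 2 * t -> v <= t + 4^-1 -> v <= 2^-1 * t + 2^-1 ->
      (v == 2 * t) || (v == t + 4^-1) || (v == 2^-1 * t + 2^-1) -> m = v.
    by rewrite /m; case: (leP (1 * t + _)) => ?; case: (leP (2 * t + 0)) => ? ? ? ?;
      case/orP => [/orP[]|] /eqP ?; lra.
  have [h|h] := leP t 2^-1; last first.
    have -> : m = 2^-1 * t + 2^-1 by apply: mE; rewrite ?eqxx ?orbT //; lra.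
    by do 3?[rewrite ifF; last lra]; congr (c _); lra.
  have [k|k] := leP (2 * t) 2^-1.
    have -> : m = 2 * t by apply: mE; rewrite ?eqxx ?orbT //; lra.
    by rewrite ifT; last lra; congr (a _); lra.
  have -> : m = t + 4^-1 by apply: mE; rewrite ?eqxx ?orbT //; lra.
  by rewrite ifF; last lra; rewrite ifT; last lra; congr (b _); lra.
Qed.

Section Segment.
Context {E : normedModType R}.
Variables (F : E -> Y) (cF : continuous F) (e e' : E).

Definition line (t : R) : E := e + clamp t *: (e' - e).

Lemma line_cont : continuous line.
Proof.
move=> t; apply: cvgD; first exact: cvg_cst.
by apply: cvgZr_tmp; exact: clamp_cont.
Qed.

Lemma line_le0 t : t <= 0 -> line t = e.
Proof. by move=> t0; rewrite /line clamp_le0 // scale0r addr0. Qed.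

Lemma line_ge1 t : 1 <= t -> line t = e'.
Proof. by move=> t0; rewrite /line clamp_ge1 // scale1r subrKC. Qed.

Fact seg_cont : continuous (fun t => F (line t)).
Proof. exact: (continuous_compose cF line_cont). Qed.

Fact seg_le0 t : t <= 0 -> F (line t) = F e.
Proof. by move=> t0; rewrite line_le0. Qed.

Fact seg_ge1 t : 1 <= t -> F (line t) = F e'.
Proof. by move=> t0; rewrite line_ge1. Qed.

Definition seg : path (F e) (F e') := Path seg_cont seg_le0 seg_ge1.
End Segment.

End Groupoid.
Arguments path R {Y} y z.

Section Holonomy.
Context {R : realType} {Y : topologicalType} {y0 : Y}.
Variable base : forall y, path R y0 y.
Local Notation G := (pi1 R y0).
Local Open Scope group_scope.

Fact path_loop_out (p : path R y0 y0) t : ((t <= 0) || (1 <= t))%R -> p t = y0.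
Proof. by case/orP=> h; [exact: path_le0|exact: path_ge1]. Qed.

Definition path_loop (p : path R y0 y0) : loop R y0 :=
  Loop (@path_cont _ _ _ _ p) (@path_loop_out p).

Fact loop_path_le0 (a : loop R y0) t : (t <= 0)%R -> a t = y0.
Proof. by move=> h; rewrite loop_out // h. Qed.

Fact loop_path_ge1 (a : loop R y0) t : (1 <= t)%R -> a t = y0.
Proof. by move=> h; rewrite loop_out // h orbT. Qed.

Definition loop_path (a : loop R y0) : path R y0 y0 :=
  Path (@loop_continuous _ _ _ a) (@loop_path_le0 a) (@loop_path_ge1 a).

Definition pclass (p : path R y0 y0) : G := pi1_class (path_loop p).

Lemma pclass_hom p q : phom p q -> pclass p = pclass q.
Proof.
move=> [H [cH H0 H1 Ha Hb]]; apply/pi1_classP; exists H; split=> //.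
by move=> s t /orP[h|h]; [exact: Ha|exact: Hb].
Qed.

Lemma pclass_concat p q : pclass (pconcat p q) = pclass p * pclass q.
Proof.
rewrite [RHS]pi1_mulE; apply/pi1_classP; exact: homotopic_eqfun.
Qed.

Lemma pclass_const : pclass (pconst y0) = 1.
Proof. by apply/pi1_classP; exact: homotopic_eqfun. Qed.

(** The chosen paths [base] close an arbitrary path up to a loop at [y0]; conjugating by them
    collapses the fundamental groupoid to the group. *)
Definition conn x y (p : path R x y) : G :=
  pclass (pconcat (base x) (pconcat p (prev (base y)))).

Lemma conn_hom x y (p q : path R x y) : phom p q -> conn p = conn q.
Proof.
move=> pq; apply: pclass_hom; apply: phom_concat; first exact: phom_refl.
by apply: phom_concat => //; exact: phom_refl.
Qed.

Lemma conn_concat x y z (p : path R x y) (q : path R y z) :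
  conn (pconcat p q) = conn p * conn q.
Proof.
rewrite /conn -pclass_concat; apply: pclass_hom; apply: phom_sym.
apply: phom_trans (phom_concatA _ _ _) _.
apply: phom_concat; first exact: phom_refl.
apply: phom_trans (phom_concatA _ _ _) _.
apply: phom_trans; last by apply: phom_sym; exact: phom_concatA.
apply: phom_concat; first exact: phom_refl.
apply: phom_trans (phom_sym (phom_concatA _ _ _)) _.
apply: phom_trans; last exact: phom_concat1l.
by apply: phom_concat; [exact: phom_concatVl|exact: phom_refl].
Qed.

Lemma conn_eqfun x y (p : path R x y) (q : path R y0 y0) :
  x = y0 -> y = y0 -> p =1 q -> conn p = conn q.
Proof. by move=> ex ey; subst x y => pq; apply: conn_hom; exact: phom_eqfun. Qed.

(** The segment is only a convenient representative: any path in [E] with the same ends gives the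
    same element, by [hol_pathE]. The value 1 for discontinuous [F] is a default that keeps
    continuity proofs out of the terms. *)
Definition hol (E : normedModType R) (F : E -> Y) (e e' : E) : G :=
  if pselect (continuous F) is left cF then conn (seg cF e e') else 1.

Lemma hol_pathE (E : normedModType R) (F : E -> Y) (f : R -> E) e e'
    (p : path R (F e) (F e')) : continuous F -> continuous f ->
  (forall t, (t <= 0)%R -> f t = e) -> (forall t, (1 <= t)%R -> f t = e') ->
  (forall t, p t = F (f t)) -> hol F e e' = conn p.
Proof.
rewrite /hol => cF cf f0 f1 pE; case: pselect => // cF'.
apply: conn_hom; apply: (@phom_convex _ _ E F e e' (line e e') f) => //.
- exact: line_cont.
- by move=> t t0; rewrite line_le0 ?f0.
- by move=> t t0; rewrite line_ge1 ?f1.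
Qed.

Lemma hol_trans (E : normedModType R) (F : E -> Y) e1 e2 e3 : continuous F ->
  hol F e1 e2 * hol F e2 e3 = hol F e1 e3.
Proof.
move=> cF; rewrite [hol F e1 e2]/hol [hol F e2 e3]/hol.
case: pselect => // cF'; rewrite -conn_concat; apply/esym.
have m1 : continuous (fun t : R => line e1 e2 (2 * t)%R).
  apply: continuous_compose; first exact: line_cont.
  by move=> t; apply: cvgMr; exact: cvg_id.
have m2 : continuous (fun t : R => line e2 e3 (2 * t + -1)%R).
  by apply: continuous_compose; [exact: line_cont|exact: affine_cont].
apply: (@hol_pathE E F (fun t => if (t <= 2^-1)%R then line e1 e2 (2 * t)%R
    else line e2 e3 (2 * t + -1)%R)) => //.
- apply: (continuous_paste (phi := id)) => //; first exact: id_cont.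
  by move=> t ->; rewrite line_ge1 ?line_le0 //; lra.
- by move=> t h; rewrite ifT ?line_le0 //; lra.
- by move=> t h; rewrite ifF ?line_ge1 //; lra.
- by move=> t /=; rewrite /concat_fun; case: ifP.
Qed.

Lemma hol_comp (E E' : normedModType R) (F : E' -> Y) (A : E -> E') e e' :
  continuous F -> continuous A -> hol (fun x => F (A x)) e e' = hol F (A e) (A e').
Proof.
move=> cF cA; rewrite {1}/hol; case: pselect => [c|[]]; last first.
  exact: continuous_compose.
apply/esym/(@hol_pathE E' F (fun t => A (line e e' t))) => //.
- by apply: continuous_compose => //; exact: line_cont.
- by move=> t t0; rewrite line_le0.
- by move=> t t0; rewrite line_ge1.
Qed.

Lemma hol_refl (E : normedModType R) (F : E -> Y) e : continuous F -> hol F e e = 1.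
Proof.
by move=> cF; apply: (mulgI (hol F e e)); rewrite hol_trans // mulg1.
Qed.

Lemma holV (E : normedModType R) (F : E -> Y) e e' : continuous F ->
  (hol F e e')^-1 = hol F e' e.
Proof.
by move=> cF; apply: (mulgI (hol F e e')); rewrite mulgV hol_trans // hol_refl.
Qed.

(** The two ways around a rectangle agree because the plane is convex: all four sides are holonomies
    of the single map [H]. *)
Lemma hol_square (H : R * R -> Y) a b c d : continuous H ->
  hol (fun t => H (a, t)) c d =
  hol (fun s => H (s, c)) a b * hol (fun t => H (b, t)) c d
    * (hol (fun s => H (s, d)) a b)^-1.
Proof.
move=> cH.
have cr (x : R) : continuous (fun t : R => (x, t)).
  exact: (continuous_tuple (@cst_cont R R x) (@id_cont R)).
have cl (x : R) : continuous (fun t : R => (t, x)).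
  exact: (continuous_tuple (@id_cont R) (@cst_cont R R x)).
rewrite !(hol_comp _ _ cH (cr _)) !(hol_comp _ _ cH (cl _)) holV //.
by rewrite !hol_trans.
Qed.

Lemma pi1_hol (x : G) : exists a : R -> Y,
  [/\ continuous a, a 0%R = y0, a 1%R = y0 & x = hol a 0%R 1%R].
Proof.
(* The path [base y0] is an arbitrary loop, so the holonomy of a loop is its class conjugated by
   [u]; the loop is therefore taken in the class [x']. *)
pose u := pclass (base y0); pose x' := u^-1 * x * u.
pose a := repr x'.
have cp : continuous a by exact: loop_continuous.
have a0 := @loop_path_le0 a; have a1 := @loop_path_ge1 a.
pose p := loop_path a.
have e0 : a 0%R = y0 by apply: (a0 0%R); exact: lexx.
have e1 : a 1%R = y0 by apply: (a1 1%R); exact: lexx.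
exists a; split => //.
have h0 t : (t <= 0)%R -> a t = a 0%R by move=> h; rewrite e0 a0.
have h1 t : (1 <= t)%R -> a t = a 1%R by move=> h; rewrite e1 a1.
pose p' := Path cp h0 h1.
have clc : continuous (fun t : R => clamp t) by exact: clamp_cont.
rewrite (@hol_pathE R a clamp _ _ p') //.
- have xE : x = u * x' * u^-1 by rewrite /x' !mulgA mulgV mul1g mulgK.
  rewrite (@conn_eqfun _ _ p' p) // /conn.
  have -> : pclass (pconcat (base y0) (pconcat p (prev (base y0))))
      = u * (pclass p * pclass (prev (base y0))) by rewrite !pclass_concat.
  have -> : pclass p = x'.
    by rewrite /pclass -[x']reprK; apply/pi1_classP; exact: homotopic_eqfun.
  have -> : pclass (prev (base y0)) = u^-1.
    apply: (mulIg u); rewrite mulVg -pclass_concat -pclass_const.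
    by apply: pclass_hom; exact: phom_concatVl.
  by rewrite mulgA.
- by move=> t; exact: clamp_le0.
- by move=> t; exact: clamp_ge1.
- move=> t /=; have [h|h] := leP t 0; first by rewrite clamp_le0 // !a0.
  have [h'|h'] := leP 1%R t; first by rewrite clamp_ge1 // !a1.
  by rewrite clamp_id // !ltW.
Qed.

End Holonomy.

(** * Homomorphisms defined by flat cocycles *)

Section Cousin.
Context {R : realType}.

(** Compactness of an interval as an induction principle. The supremum of the right ends reached
    from [x] is itself reached, and the local hypothesis there carries past it unless it equals [y].
    It serves every extension along a path below. *)
Lemma cousin (Q : R -> R -> Prop) :
  (forall t, exists2 e, 0 < e &
     forall x y, t - e < x -> x <= y -> y < t + e -> Q x y) ->
  (forall x y z, x <= y -> y <= z -> Q x y -> Q y z -> Q x z) ->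
  forall x y, x <= y -> Q x y.
Proof.
move=> Qloc Qtr x y xy.
pose S := [set z | x <= z <= y /\ Q x z].
have Sx : S x.
  split; first by rewrite lexx.
  by have [e e0 h] := Qloc x; apply: h; lra.
have Sub : ubound S y by move=> z [/andP[]].
have Ssup : has_sup S by split; [exists x|exists y].
have [e e0 h] := Qloc (sup S).
have [z [/andP[xz zy] Qxz] ze] := sup_adherent e0 Ssup.
have zS : z <= sup S by apply: ub_le_sup; [exists y|split => //; rewrite xz].
have Sy : sup S <= y by apply: ge_sup => //; exists x.
pose v := Num.min y (sup S + e / 2).
have vE : v <= y /\ v <= sup S + e / 2 by rewrite /v !ge_min !lexx orbT.
have vz : z <= v by rewrite /v le_min; apply/andP; split; lra.
have Qzv : Q z v by apply: h => //; lra.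
have Qxv : Q x v by exact: Qtr Qxz Qzv.
have vS : v <= sup S.
  apply: ub_le_sup; first by exists y.
  by split => //; apply/andP; split; lra.
suff <- : v = y by [].
by move: vS; rewrite /v; case: (leP y (sup S + e / 2)) => ?; lra.
Qed.

Lemma near_itv (t : R) (P : R -> Prop) : (\forall z \near t, P z) ->
  exists2 e, 0 < e & forall z, t - e < z -> z < t + e -> P z.
Proof.
move=> /nbhs_ballP[e /= e0 h]; exists e => // z tz zt; apply: h.
by rewrite /ball /= ltr_distlC tz zt.
Qed.

Lemma locally_constant T (g : R -> T) :
  (forall t, \forall z \near t, g z = g t) -> forall x y, g x = g y.
Proof.
move=> gl; suff gle x y : x <= y -> g x = g y.
  by move=> x y; case/orP: (le_total x y) => /gle.
apply: (@cousin (fun x y => g x = g y)) => [t|? ? ? _ _ -> //].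
have [e e0 h] := near_itv (gl t); exists e => // {}x {}y tx xy yt.
by rewrite !h //; lra.
Qed.

End Cousin.

Section Cocycle.
Context {R : realType} {Y : topologicalType} {J : Type} {Gam : groupType}.
Variables (O : J -> set Y) (c : J -> Y -> Gam).
Hypothesis Oopen : forall j, open (O j).
Hypothesis Ocover : forall y, exists j, O j y.
Local Open Scope group_scope.
Hypothesis cloc : forall j k y, O j y -> O k y ->
  \forall z \near y, c j z * (c k z)^-1 = c j y * (c k y)^-1.

(* The c j are, in chart j, the coordinates of an arbitrary frame of a local
   system of right Gam-torsors, and f is a flat section of its pullback by p. *)
Definition flat (X : topologicalType) (p : X -> Y) (A : set X) (f : X -> Gam) :=
  forall x, A x -> exists j, O j (p x) /\
    \forall z \near x, A z -> c j (p z) * f z = c j (p x) * f x.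

Lemma flat_chart (X : topologicalType) (p : X -> Y) (A : set X) (f : X -> Gam) x j :
  continuous p -> flat p A f -> A x -> O j (p x) ->
  \forall z \near x, A z -> c j (p z) * f z = c j (p x) * f x.
Proof.
move=> cp fl Ax Oj; have [k [Ok h]] := fl x Ax.
have := cp x _ (cloc Oj Ok); rewrite /= => h'.
near=> z => Az.
have e1 : c j (p z) * (c k (p z))^-1 = c j (p x) * (c k (p x))^-1.
  by near: z; exact: h'.
have e2 : c k (p z) * f z = c k (p x) * f x by move: Az; near: z.
by rewrite -(mulgVK (c k (p z)) (c j (p z))) -mulgA e2 e1 mulgA mulgVK.
Unshelve. all: by end_near. Qed.

Lemma flat_comp (X X' : topologicalType) (phi : X' -> X) (p : X -> Y) A A' f :
  continuous phi -> (forall x, A' x -> A (phi x)) -> flat p A f ->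
  flat (fun x => p (phi x)) A' (fun x => f (phi x)).
Proof.
move=> cphi AA fl x /AA /fl [j [Oj h]]; exists j; split=> //.
have h' : \forall z \near x, A (phi z) ->
    c j (p (phi z)) * f (phi z) = c j (p (phi x)) * f (phi x) := cphi x _ h.
by apply: filterS h' => z hz /AA.
Qed.

Lemma flat_eq (X : topologicalType) (p p' : X -> Y) A f :
  (forall x, A x -> p x = p' x) -> flat p A f -> flat p' A f.
Proof.
move=> pp fl x Ax; have [j [Oj h]] := fl x Ax; exists j; rewrite -pp //; split=> //.
by apply: filterS h => z hz Az; rewrite -pp // hz.
Qed.

Lemma flat_mulr (X : topologicalType) (p : X -> Y) A f g :
  flat p A f -> flat p A (fun x => f x * g).
Proof.
move=> fl x Ax; have [j [Oj h]] := fl x Ax; exists j; split=> //.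
by apply: filterS h => z hz Az; rewrite !mulgA hz.
Qed.

Lemma flat_ratio (X : topologicalType) (p : X -> Y) A f f' x :
  continuous p -> flat p A f -> flat p A f' -> A x ->
  \forall z \near x, A z -> (f z)^-1 * f' z = (f x)^-1 * f' x.
Proof.
move=> cp fl fl' Ax; have [j [Oj h]] := fl x Ax.
have h' := flat_chart cp fl' Ax Oj.
apply: filterS2 h h' => z e e' Az.
have -> : (f z)^-1 * f' z = (c j (p z) * f z)^-1 * (c j (p z) * f' z).
  by rewrite invgM !mulgA mulgVK.
by rewrite e // e' // invgM !mulgA mulgVK.
Qed.

Lemma near_box (a b : R) (P : R * R -> Prop) : (\forall z \near (a, b), P z) ->
  exists2 e, (0 < e)%R & forall s t, (a - e < s -> s < a + e ->
     b - e < t -> t < b + e -> P (s, t))%R.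
Proof.
move=> /nbhs_ballP[e /= e0 h]; exists e => // s t as_ sa bt tb; apply: h.
by split; rewrite /ball /= ltr_distlC; apply/andP.
Qed.

Definition strip (s0 e x y : R) : set (R * R) :=
  [set z | [/\ s0 - e < z.1, z.1 < s0 + e, x <= z.2 & z.2 <= y]%R].

(** Flat sections exist inside one chart, and [cousin] stacks them along the vertical segment. The
    width of the strip shrinks at each junction but stays positive, which is enough to compare
    neighbouring slices of a homotopy. *)
Lemma strip_flat (H : R * R -> Y) (s0 x y : R) : continuous H -> (x <= y)%R ->
  exists2 e : R, (0 < e)%R & exists f, flat H (strip s0 e x y) f.
Proof.
move=> cH; move: x y.
apply: (@cousin R (fun x y => exists2 e : R, (0 < e)%R &
  exists f, flat H (strip s0 e x y) f)) => [t|].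
  have [j Oj] := Ocover (H (s0, t)).
  have := cH (s0, t) _ (open_nbhs_nbhs (conj (Oopen j) Oj)); rewrite /= => h.
  have [e e0 he] := near_box h.
  exists e => // x y tx xy yt; exists e => //; exists (fun z => (c j (H z))^-1).
  move=> [s v] [] /= h1 h2 h3 h4; exists j; split; first by apply: he; lra.
  by near=> z => _; rewrite !mulgV.
move=> x y z xy yz [e e0 [f fl]] [e' e'0 [f' fl']].
have Ay : strip s0 e x y (s0, y) by split=> /=; lra.
have Ay' : strip s0 e' y z (s0, y) by split=> /=; lra.
pose A := [set w : R * R | strip s0 e x y w /\ strip s0 e' y z w].
have flA : flat H A f by apply: (flat_comp (@id_cont _) _ fl) => ? [].
have flA' : flat H A f' by apply: (flat_comp (@id_cont _) _ fl') => ? [].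
have /near_box[d d0 hd] := flat_ratio cH flA flA' (conj Ay Ay').
pose m := Num.min d (Num.min e e').
have m0 : (0 < m)%R by rewrite !lt_min d0 e0 e'0.
have [md me me'] : [/\ m <= d, m <= e & m <= e']%R.
  by rewrite !ge_min !lexx !orbT.
exists m => //.
(* The discrepancy of the two sections at the junction. On the thinned strip it is constant, so
   right multiplication by [g^-1] makes them match. *)
pose g := (f (s0, y))^-1 * f' (s0, y).
pose f'' := fun w : R * R => if (w.2 <= y)%R then f w else f' w * g^-1.
have fE s : (s0 - m < s)%R -> (s < s0 + m)%R -> f (s, y) = f' (s, y) * g^-1.
  move=> h1 h2; have : (f (s, y))^-1 * f' (s, y) = g.
    apply: hd; try lra.
    by split; split => /=; lra.
  by move=> <-; rewrite invgM invgK mulgA mulgV mul1g.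
have fl1 : flat H (strip s0 m x y) f.
  by apply: (flat_comp (@id_cont _) _ fl) => ? [? ? ? ?]; split; lra.
have fl2 : flat H (strip s0 m y z) (fun w => f' w * g^-1).
  apply: flat_mulr.
  by apply: (flat_comp (@id_cont _) _ fl') => ? [? ? ? ?]; split; lra.
exists f'' => -[s t] [/= h1 h2 h3 h4].
have [ty|ty|ty] := ltgtP t y.
- have A1 : strip s0 m x y (s, t) by split=> //=; lra.
  have [j [Oj h]] := fl1 _ A1; exists j; split=> //.
  have ny : \forall w \near (s, t), (w.2 < y)%R.
    exact: (cvgr_lt _ (@cvg_snd _ _ (nbhs s) (nbhs t) _) _ ty).
  apply: filterS2 h ny => w hw wy [? ? ? ?].
  by rewrite /f'' /= (ltW wy) (ltW ty) hw //; split=> //; lra.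
- have A1 : strip s0 m y z (s, t) by split=> //=; lra.
  have [j [Oj h]] := fl2 _ A1; exists j; split=> //.
  have ny : \forall w \near (s, t), (y < w.2)%R.
    exact: (cvgr_gt _ (@cvg_snd _ _ (nbhs s) (nbhs t) _) _ ty).
  apply: filterS2 h ny => w hw wy [? ? ? ?].
  by rewrite /f'' /= (lt_geF wy) (lt_geF ty) hw //; split=> //; lra.
- rewrite ty.
  have A1 : strip s0 m x y (s, y) by split=> //=; lra.
  have A2 : strip s0 m y z (s, y) by split=> //=; lra.
  have [j [Oj h]] := fl1 _ A1; exists j; split=> //.
  have h' := flat_chart cH fl2 A2 Oj.
  apply: filterS2 h h' => w hw hw' [? ? ? ?].
  rewrite /f'' /= lexx; case: ifP => wy.
    by apply: hw; split=> //; lra.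
  by rewrite hw' ?fE //; split=> //; lra.
Unshelve. all: by end_near. Qed.

Definition itv (x y : R) : set R := [set t | x <= t <= y]%R.

(** A right factor common to all values of [f] cancels in [g], so that transport along a continuous
    path does not depend on the section. *)
Definition transport (p : R -> Y) (x y : R) (g : Gam) :=
  exists2 f, flat p (itv x y) f & g = f x * (f y)^-1.

Lemma transport_exists p x y : continuous p -> (x <= y)%R ->
  exists g, transport p x y g.
Proof.
move=> cp xy.
have cH : continuous (fun z : R * R => p z.2).
  by apply: continuous_compose => //; exact: snd_cont.
have [e e0 [f fl]] := strip_flat 0%R cH xy.
exists (f (0%R, x) * (f (0%R, y))^-1); exists (fun t => f (0%R, t)) => //.
apply: (@flat_comp _ _ (fun t : R => (0%R : R, t)) _ _ _ f _ _ fl).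
  exact: (continuous_tuple (@cst_cont R R 0%R) (@id_cont R)).
by move=> t /andP[? ?]; split=> //=; lra.
Qed.

Lemma flat_unique p x y f f' : continuous p -> (x <= y)%R ->
  flat p (itv x y) f -> flat p (itv x y) f' ->
  (f x)^-1 * f' x = (f y)^-1 * f' y.
Proof.
move=> cp xy fl fl'.
pose k (t : R) := Num.max x (Num.min t y).
have ck : continuous k.
  move=> t; apply: (@continuous_max R R (cst x) (fun s => Num.min s y)).
    exact: cvg_cst.
  by apply: (@continuous_min R R id (cst y)); [exact: cvg_id|exact: cvg_cst].
have kI t : itv x y (k t).
  by rewrite /itv /k /= le_max lexx ge_max xy ge_min lexx orbT.
have -> : x = k x by rewrite /k (min_l xy) max_r.
have -> : y = k y by rewrite /k minxx max_r.
apply: (locally_constant (g := fun t => (f (k t))^-1 * f' (k t))) => t.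
have h : \forall z \near t, itv x y (k z) ->
    (f (k z))^-1 * f' (k z) = (f (k t))^-1 * f' (k t) :=
  ck t _ (flat_ratio cp fl fl' (kI t)).
by apply: filterS h => z; apply.
Qed.

Lemma transport_unique p x y g g' : continuous p -> (x <= y)%R ->
  transport p x y g -> transport p x y g' -> g = g'.
Proof.
move=> cp xy [f fl ->] [f' fl' ->].
have h := flat_unique cp xy fl fl'.
have e : f' x = f x * ((f y)^-1 * f' y) by rewrite -h mulVKg.
by rewrite e !mulgA mulgK.
Qed.

Lemma transport_concat p x y z g h : continuous p -> (x <= y)%R -> (y <= z)%R ->
  transport p x y g -> transport p y z h -> transport p x z (g * h).
Proof.
move=> cp xy yz tg th; have xz := le_trans xy yz.
have [k [f fl kE]] := transport_exists cp xz.
have t1 : transport p x y (f x * (f y)^-1).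
  exists f => //; apply: (flat_comp (@id_cont _) _ fl) => t /andP[? ?].
  by apply/andP; split; lra.
have t2 : transport p y z (f y * (f z)^-1).
  exists f => //; apply: (flat_comp (@id_cont _) _ fl) => t /andP[? ?].
  by apply/andP; split; lra.
rewrite (transport_unique cp xy tg t1) (transport_unique cp yz th t2).
by exists f => //; rewrite mulgA mulgVK.
Qed.

Lemma transport_comp p (phi : R -> R) x y x' y' g : continuous phi ->
  (forall t, x' <= t <= y' -> x <= phi t <= y)%R -> phi x' = x -> phi y' = y ->
  transport p x y g -> transport (fun t => p (phi t)) x' y' g.
Proof.
move=> cphi hphi e1 e2 [f fl ->]; exists (fun t => f (phi t)); rewrite ?e1 ?e2 //.
exact: (flat_comp cphi _ fl).
Qed.

Lemma transport_rev p x y g : transport p x y g ->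
  transport (fun t => p (-1 * t + (x + y))%R) x y g^-1.
Proof.
move=> [f fl ->]; exists (fun t => f (-1 * t + (x + y))%R).
  apply: (flat_comp _ _ fl); first exact: affine_cont.
  by move=> t /andP[? ?]; apply/andP; split; lra.
have -> : (-1 * x + (x + y) = y)%R by lra.
have -> : (-1 * y + (x + y) = x)%R by lra.
by rewrite invgM invgK.
Qed.

Lemma transport_eq p p' x y g : (forall t, x <= t <= y -> p t = p' t)%R ->
  transport p x y g -> transport p' x y g.
Proof. by move=> pp [f fl ->]; exists f => //; exact: flat_eq fl. Qed.

Lemma transport_pconcat x y z (p : path R x y) (q : path R y z) g h :
  transport p 0 1 g -> transport q 0 1 h -> transport (pconcat p q) 0 1 (g * h).
Proof.
move=> tg th; apply: (@transport_concat _ _ (2^-1)%R); try lra.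
- exact: path_cont.
- apply: (@transport_eq (fun t => p (2 * t + 0)%R)).
    by move=> t /andP[t0 t1]; rewrite /= /concat_fun t1 addr0.
  apply: transport_comp tg; [exact: affine_cont| |lra|lra].
  by move=> t /andP[? ?]; apply/andP; split; lra.
- apply: (@transport_eq (fun t => q (2 * t + -1)%R)).
    move=> t /andP[t0 t1]; rewrite /= /concat_fun; case: ifP => // h'.
    have -> : t = (2^-1)%R by lra.
    by rewrite mulfV // subrr path_le0 // path_ge1.
  apply: transport_comp th; [exact: affine_cont| |lra|lra].
  by move=> t /andP[? ?]; apply/andP; split; lra.
Qed.

(** The transport [k s] along the slice at [s] is locally constant in [s]: on the sides t = 0 and t
    = 1 the homotopy stays at [y0], where a flat section has no room to vary. *)
Lemma transport_homotopic (y0 : Y) (a b : loop R y0) g : homotopic a b ->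
  transport a 0 1 g -> transport b 0 1 g.
Proof.
move=> [H [cH H0 H1 Ho]] ta.
have cHs s : continuous (fun t : R => H (s, t)).
  apply: continuous_compose => //.
  exact: (continuous_tuple (@cst_cont R R s) (@id_cont R)).
have tex s := transport_exists (cHs s) ler01.
pose k s := xget 1 [set g | transport (fun t => H (s, t)) 0 1 g].
have kP s : transport (fun t => H (s, t)) 0 1 (k s).
  by have [g' g'P] := tex s; exact: (@xgetI _ 1 [set h | transport (fun t => H (s, t)) 0 1 h] g' g'P).
have kl s0 : \forall s \near s0, k s = k s0.
  have [e e0 [f fl]] := strip_flat s0 cH ler01.
  have fs s : (s0 - e < s)%R -> (s < s0 + e)%R -> k s = f (s, 0%R) * (f (s, 1%R))^-1.
    move=> h1 h2; apply: transport_unique (kP s) _ => //; try lra.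
    exists (fun t => f (s, t)) => //.
    apply: (@flat_comp _ _ (fun t : R => (s, t)) _ _ _ f _ _ fl).
      exact: (continuous_tuple (@cst_cont R R s) (@id_cont R)).
    by move=> t /andP[? ?]; split.
  have fc t : (t == 0%R) || (t == 1%R) -> \forall s \near s0, f (s, t) = f (s0, t).
    move=> t01.
    have /andP[t0 t1] : (0 <= t <= 1)%R by case/orP: t01 => /eqP ->; lra.
    have At : strip s0 e 0 1 (s0, t).
      by split=> /=; lra.
    have y0E s : H (s, t) = y0.
      by apply: Ho; case/orP: t01 => /eqP ->; rewrite lexx ?orbT.
    have [j [Oj /near_box[d d0 hd]]] := fl _ At.
    near=> s; have := hd s t; rewrite !y0E => h; apply: (mulgI (c j y0)); apply: h.
    - by near: s; apply: lt_nbhsr; lra.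
    - by near: s; apply: lt_nbhsl; lra.
    - by lra.
    - by lra.
    - split=> /=; try lra.
      + by near: s; apply: lt_nbhsr; lra.
      + by near: s; apply: lt_nbhsl; lra.
  near=> s; rewrite fs; last 2 first.
  - by near: s; apply: lt_nbhsr; lra.
  - by near: s; apply: lt_nbhsl; lra.
  have -> : k s0 = f (s0, 0%R) * (f (s0, 1%R))^-1 by apply: fs; lra.
  congr (_ * _^-1).
    by near: s; apply: fc; rewrite eqxx.
  by near: s; apply: fc; rewrite eqxx orbT.
have kc := locally_constant kl 0%R 1%R.
have ta' : transport (fun t => H (0%R, t)) 0 1 g by apply: transport_eq ta => t _; rewrite H0.
rewrite (transport_unique (cHs 0%R) ler01 ta' (kP 0%R)) kc.
by apply: transport_eq (kP 1%R) => t _.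
Unshelve. all: by end_near. Qed.

(** The second clause evaluates [F] on holonomies of paths that are not loops. The correction [nu],
    the transport along [base], depends on endpoints only and so cancels between consecutive
    paths. *)
Lemma flat_hom (y0 : Y) : exists2 F : pi1 R y0 -> Gam, {morph F : x y / x * y} &
  forall base : (forall y, path R y0 y), exists nu : Y -> Gam,
  forall a x y g, continuous a -> (x <= y)%R -> transport a x y g ->
    F (hol base a x y) = nu (a x) * g * (nu (a y))^-1.
Proof.
have tex (a : loop R y0) := transport_exists (@loop_continuous _ _ _ a) ler01.
pose F (x : pi1 R y0) := xget 1 [set g | transport (repr x) 0 1 g].
have FP (x : pi1 R y0) : transport (repr x) 0 1 (F x).
  by have [g gP] := tex (repr x);
  exact: (@xgetI _ 1 [set h | transport (repr x) 0 1 h] g gP).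
have FE (a : loop R y0) g : transport a 0 1 g -> F (pi1_class a) = g.
  move=> /(transport_homotopic (homotopic_sym (homotopic_repr a))) h.
  apply: (transport_unique (@loop_continuous _ _ _ _) ler01 (FP _) h).
exists F.
  move=> x y; apply: FE.
  have := @transport_pconcat _ _ _ (loop_path (repr x)) (loop_path (repr y)) _ _ (FP x) (FP y).
  by apply: transport_eq => t _.
move=> base.
pose nu y := xget 1 [set g | transport (base y) 0 1 g].
have nuP y : transport (base y) 0 1 (nu y).
  have [g gP] := transport_exists (@path_cont _ _ _ _ (base y)) ler01.
  exact: (@xgetI _ 1 [set h | transport (base y) 0 1 h] g gP).
exists nu => a x y g ca xy ta.
rewrite /hol; case: pselect => // ca'; apply: FE.
rewrite -mulgA; apply: transport_pconcat => //.
apply: transport_pconcat.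
  rewrite /=; apply: (@transport_comp a (fun t => line x y t) x y) => //.
  - exact: line_cont.
  - move=> t /andP[t0 t1]; rewrite /line clamp_id ?t0 //.
    by rewrite /GRing.scale /=; apply/andP; split; nra.
  - by rewrite line_le0.
  - by rewrite line_ge1.
by have := transport_rev (nuP (a y)); rewrite add0r.
Qed.

End Cocycle.

(** * Angles and points of the sphere *)

Section Within.

Lemma within_comp (T U V : topologicalType) (A : set T) (B : set U)
    (f : T -> U) (g : U -> V) :
  {within A, continuous f} -> {within B, continuous g} ->
  (forall x, A x -> B (f x)) -> {within A, continuous (fun x => g (f x))}.
Proof.
move=> /subspace_continuousP cf /subspace_continuousP cg AB.
apply/subspace_continuousP => x Ax W /(cg _ (AB _ Ax)) h.
have := cf _ Ax _ h; rewrite /within /nbhs /=; apply: filterS => z hz Az.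
by apply: hz => //; exact: AB.
Qed.

Lemma within_compl (T U V : topologicalType) (B : set U) (f : T -> U) (g : U -> V) :
  continuous f -> {within B, continuous g} -> (forall x, B (f x)) ->
  continuous (fun x => g (f x)).
Proof.
move=> cf /subspace_continuousP cg AB x W /(cg _ (AB x)) h.
have := cf x _ h; rewrite /within /nbhs /=; apply: filterS => z; apply.
exact: AB.
Qed.

Lemma within_eq (T U : topologicalType) (A : set T) (f g : T -> U) :
  (forall x, A x -> f x = g x) -> {within A, continuous f} -> {within A, continuous g}.
Proof.
move=> fg; apply: subspace_eq_continuous => x; rewrite inE; exact: fg.
Qed.

Lemma within_tuple (T U V : topologicalType) (A : set T) (f : T -> U) (g : T -> V) :
  {within A, continuous f} -> {within A, continuous g} ->
  {within A, continuous (fun x => (f x, g x))}.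
Proof. by move=> cf cg x; exact: (cvg_pair (cf x) (cg x)). Qed.

(** A continuous map from a compact set to a Hausdorff space is closed onto its image, so continuity
    of [k] may be tested after composition with [f]. With [k] inverse to [f] this makes the inverses
    of the parametrizations continuous. *)
Lemma image_within (T X Z : topologicalType) (K : set T) (f : T -> X) (k : X -> Z) :
  hausdorff_space X -> compact K -> {within K, continuous f} ->
  {within K, continuous (fun t => k (f t))} -> {within f @` K, continuous k}.
Proof.
move=> hX cK cf ckf; apply/subspace_continuousP => x [t0 Kt0 xE] W.
rewrite nbhsE => -[W' [oW' W'x] W'W].
pose C := K `&` (fun t => k (f t)) @^-1` (~` W').
have cC : compact C.
  have /closed_subspaceP[V cV VE] : closed ((fun t => k (f t)) @^-1` (~` W') : set (subspace K)).
    by move/continuous_closedP: ckf; apply; exact: open_closedC.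
  by rewrite /C setIC -VE setIC; exact: compact_closedI.
have clC : closed (f @` C).
  apply: compact_closed => //; apply: continuous_compact => //.
  by apply: continuous_subspaceW cf => ? [].
have nx : nbhs x (~` (f @` C)).
  apply: open_nbhs_nbhs; split; first exact: closed_openC.
  by move=> [t [Kt /= nW] fE]; apply: nW; rewrite fE.
rewrite /within /nbhs /=; apply: filterS nx => z nz [t Kt tE]; apply: W'W.
by apply: contrapT => nW; apply: nz; exists t => //; split => //=; rewrite tE.
Qed.

End Within.

Lemma at_comp (T U V : topologicalType) (f : T -> U) (g : U -> V) x :
  {for x, continuous f} -> {for f x, continuous g} ->
  {for x, continuous (fun y => g (f y))}.
Proof. by move=> cf cg; exact: (continuous_comp cf cg). Qed.

Lemma at_fst (T U V : topologicalType) (f : T -> U * V) x :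
  {for x, continuous f} -> {for x, continuous (fun y => (f y).1)}.
Proof. by move=> cf; apply: (at_comp cf); exact: fst_cont. Qed.

Lemma at_snd (T U V : topologicalType) (f : T -> U * V) x :
  {for x, continuous f} -> {for x, continuous (fun y => (f y).2)}.
Proof. by move=> cf; apply: (at_comp cf); exact: snd_cont. Qed.

Section ContinuityAt.
Context {R : realType} {T : topologicalType} (f g : T -> R) (x : T).
Hypotheses (cf : {for x, continuous f}) (cg : {for x, continuous g}).

Lemma at_add : {for x, continuous (fun y => f y + g y)}.
Proof. exact: cvgD. Qed.

Lemma at_sub : {for x, continuous (fun y => f y - g y)}.
Proof. exact: cvgB. Qed.

Lemma at_mul : {for x, continuous (fun y => f y * g y)}.
Proof. exact: cvgM. Qed.

Lemma at_inv : f x != 0 -> {for x, continuous (fun y => (f y)^-1)}.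
Proof. by move=> f0; exact: cvgV. Qed.

Lemma at_cst (a : R) : {for x, continuous (fun _ : T => a)}.
Proof. exact: cvg_cst. Qed.

End ContinuityAt.

Section Angles.
Context {R : realType}.
Implicit Types (x y : R) (w : R * R).

Lemma cis_circle x : circle (cis x).
Proof. by rewrite /circle /cis /=; exact: cos2Dsin2. Qed.

Lemma cis_cont : continuous (@cis R).
Proof. exact: (continuous_tuple (@continuous_cos R) (@continuous_sin R)). Qed.

Lemma cis2pi x (m : int) : cis (x + m%:~R * (pi *+ 2)) = cis x.
Proof.
have h n : cis (x + n%:R * (pi *+ 2)) = cis x.
  rewrite mulr_natl /cis; congr (_, _).
    exact: (periodicn (@cosD2pi R)).
  exact: (periodicn (@sinD2pi R)).
case: m => n; first exact: h.
rewrite NegzE; have h' (y : R) : cis (y + n.+1%:R * (pi *+ 2)) = cis y.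
  rewrite mulr_natl /cis; congr (_, _).
    exact: (periodicn (@cosD2pi R)).
  exact: (periodicn (@sinD2pi R)).
by rewrite -h' mulrNz mulNr subrK.
Qed.

Lemma cis_eq x y : cis x = cis y -> exists m : int, x = y + m%:~R * (pi *+ 2).
Proof.
move=> [cE sE]; have pi0 : 0 < pi :> R by exact: pi_gt0.
have d1 : cos (x - y) = 1 by rewrite cosB cE sE -!expr2 cos2Dsin2.
pose n := Num.floor ((x - y) / (pi *+ 2)).
pose r := x - y - n%:~R * (pi *+ 2).
have p2 : 0 < (pi *+ 2 : R) by rewrite mulrn_wgt0.
have r0 : 0 <= r.
  have := floor_le_tmp ((x - y) / (pi *+ 2)).
  by rewrite ler_pdivlMr // /r /n; lra.
have r1 : r < pi *+ 2.
  have := floorD1_gt ((x - y) / (pi *+ 2)).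
  by rewrite ltr_pdivrMr // intrD mulrDl mul1r /r /n; lra.
have cr : cos r = 1.
  have [e _] : cis r = cis (x - y).
    by rewrite -(cis2pi r n) /r subrK.
  by rewrite e d1.
exists n; suff r00 : r = 0 by move: r00; rewrite /r; lra.
have [rpi|rpi] := leP r pi.
  apply: cos_inj; rewrite ?cos0 // in_itv /=; apply/andP; split=> //.
  exact: ltW.
have : pi *+ 2 - r = 0; last by move=> h; lra.
apply: cos_inj.
- by rewrite in_itv /=; apply/andP; split; rewrite mulr2n; lra.
- by rewrite in_itv /= lexx ltW.
- by rewrite cos0 -cosN opprB (_ : r - pi *+ 2 = r + (-1)%:~R * (pi *+ 2));
    [case: (cis2pi r (-1)) => -> _|rewrite mulN1r].
Qed.

(* The principal argument on the unit circle; it takes the junk value 0 at the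
   point (-1, 0), where it is discontinuous. *)
Definition arg w : R := 2 * atan (w.2 / (1 + w.1)).

Lemma arg1 : arg (1, 0) = 0.
Proof. by rewrite /arg /= mul0r atan0 mulr0. Qed.

(** Half-angle formula: [w.2 / (1 + w.1)] is the tangent of half the angle of [w]. *)
Lemma cis_arg w : circle w -> -1 < w.1 -> cis (arg w) = w.
Proof.
case: w => a b /=; rewrite /circle /= => ab a1; rewrite /arg /=; set t := b / (1 + a).
have tE : 1 + t ^+ 2 = 2 / (1 + a).
  have -> : t ^+ 2 = (1 - a ^+ 2) / (1 + a) ^+ 2 by rewrite /t expr_div_n; congr (_ / _); lra.
  by field; lra.
have ct : 0 < cos (atan t).
  by apply: cos_gt0_pihalf; rewrite atan_gtNpi2 atan_ltpi2.
have c2 : cos (atan t) ^+ 2 = (1 + a) / 2.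
  have := cos2_tan2 (lt0r_neq0 ct); rewrite atanK tE => h.
  by rewrite -[LHS]invrK h invf_div.
have st : sin (atan t) = t * cos (atan t).
  by rewrite -{2}(atanK t) /tan divfK // lt0r_neq0.
rewrite /cis mulr_natl cos_mulr2n sin_mulr2n st; congr (_, _).
  by rewrite c2 mulr2n; lra.
by rewrite mulrCA -expr2 c2 mulr2n /t; field; lra.
Qed.

Lemma arg_cont w : -1 < w.1 -> {for w, continuous arg}.
Proof.
move=> w1; rewrite /arg; apply: cvgMr.
apply: continuous_comp; last exact: continuous_atan.
apply: cvgM; first exact: cvg_snd.
apply: cvgV; first by rewrite gt_eqF //; lra.
by apply: cvgD; [exact: cvg_cst|exact: cvg_fst].
Qed.

Lemma circle_cis w : circle w -> exists x, w = cis x.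
Proof.
move=> cw; have [h|h] := ltP (-1) w.1; first by exists (arg w); rewrite cis_arg.
exists pi; case: w cw h => a b; rewrite /circle /cis /= cospi sinpi => ab h.
have b0 : b = 0 by apply/eqP; rewrite -sqrf_eq0; apply/eqP; nra.
by rewrite b0; congr (_, _); move: ab; rewrite b0; nra.
Qed.

Lemma cisD x y : cis (x + y) =
  ((cis x).1 * (cis y).1 - (cis x).2 * (cis y).2,
   (cis x).2 * (cis y).1 + (cis x).1 * (cis y).2).
Proof. by rewrite /cis cosD sinD. Qed.

End Angles.

Section Coordinates.
Context {R : realType}.
Local Notation space := 'rV[R]_3.

(** Coordinates listed cyclically from the i-th one, so that an argument about one boundary circle
    serves all three. *)
Definition mkv (i : 'I_3) (a b d : R) : space :=
  \row_j (if j == i then a else if j == i + 1 then b else d).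

Lemma ord3_neq (i : 'I_3) :
  (i + 1 == i = false) * (i + 2 == i = false) * (i + 2 == i + 1 = false)
  * (i == i + 1 = false) * (i == i + 2 = false) * (i + 1 == i + 2 = false).
Proof. by case: i => -[|[|[|]]] // ?. Qed.

Lemma ord3E (i : 'I_3) :
  (i + 1 + 1 = i + 2) * (i + 1 + 2 = i) * (i + 2 + 1 = i) * (i + 2 + 2 = i + 1).
Proof. by case: i => -[|[|[|]]] // ?; do !split; exact: val_inj. Qed.

Lemma ord3P (i j : 'I_3) : [\/ j = i, j = i + 1 | j = i + 2].
Proof.
by case: i => -[|[|[|]]] // ?; case: j => -[|[|[|]]] // ?;
  [constructor 1|constructor 2|constructor 3|constructor 3|constructor 1
  |constructor 2|constructor 2|constructor 3|constructor 1]; exact: val_inj.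
Qed.

Lemma ord3_sum (i : 'I_3) (V : zmodType) (F : 'I_3 -> V) :
  \sum_j F j = F i + F (i + 1) + F (i + 2).
Proof.
rewrite (bigD1 i) //= (bigD1 (i + 1)) /= ?ord3_neq // (bigD1 (i + 2)) /= ?ord3_neq //.
rewrite big1 => [|j]; first by rewrite addr0 [LHS]addrA.
by case: (ord3P i j) => ->; rewrite eqxx ?andbF.
Qed.

Lemma mkvE i a b d : (mkv i a b d 0 i = a) * (mkv i a b d 0 (i + 1) = b)
  * (mkv i a b d 0 (i + 2) = d).
Proof. by rewrite !mxE eqxx !ord3_neq eqxx. Qed.

Lemma rowE3 i (u : space) : u = mkv i (u 0 i) (u 0 (i + 1)) (u 0 (i + 2)).
Proof.
by apply/rowP => j; case: (ord3P i j) => ->; rewrite mkvE.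
Qed.

Lemma mkv_cvg (T : Type) (F : set_system T) {FF : Filter F} i (f g h : T -> R) a b d :
  f @ F --> a -> g @ F --> b -> h @ F --> d ->
  (fun x => mkv i (f x) (g x) (h x)) @ F --> mkv i a b d.
Proof.
move=> cf cg ch.
have E (x y z : R) : mkv i x y z = x *: delta_mx 0 i + y *: delta_mx 0 (i + 1)
    + z *: delta_mx 0 (i + 2).
  by apply/rowP => j; case: (ord3P i j) => ->;
  rewrite mkvE !mxE !eqxx !ord3_neq /= ?mulr1 ?mulr0 ?addr0 ?add0r.
rewrite (_ : (fun x => _) = fun x => f x *: delta_mx 0 i + g x *: delta_mx 0 (i + 1)
    + h x *: delta_mx 0 (i + 2)); last by apply/funext => x; rewrite E.
rewrite E; apply: cvgD; [apply: cvgD|].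
- by apply: cvgZr_tmp.
- by apply: cvgZr_tmp.
- by apply: cvgZr_tmp.
Qed.

Lemma row_cont (j : 'I_3) : continuous (fun u : space => u 0 j).
Proof. exact: coord_continuous. Qed.

Lemma pants_mkv i a b d : pants (mkv i a b d) <->
  [/\ a ^+ 2 + b ^+ 2 + d ^+ 2 = 1, a <= 4 / 5, b <= 4 / 5 & d <= 4 / 5].
Proof.
rewrite /pants /= (ord3_sum i) !mkvE; split=> [[-> h]|[-> h1 h2 h3]].
  by split=> //; [have := h i|have := h (i + 1)|have := h (i + 2)]; rewrite mkvE.
by split=> // j; case: (ord3P i j) => ->; rewrite mkvE.
Qed.

Lemma pants_sum i (u : space) : pants u ->
  u 0 i ^+ 2 + u 0 (i + 1) ^+ 2 + u 0 (i + 2) ^+ 2 = 1.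
Proof. by rewrite {1}(rowE3 i u) => /pants_mkv[]. Qed.

Lemma sqr_cvg (T : Type) (F : set_system T) {FF : Filter F} (f : T -> R) (a : R) :
  f @ F --> a -> (fun x => f x ^+ 2) @ F --> a ^+ 2.
Proof. by move=> cf; rewrite expr2; apply: cvgM. Qed.

Lemma closed_le_fun (T : topologicalType) (f g : T -> R) :
  continuous f -> continuous g -> closed [set x | f x <= g x].
Proof.
move=> cf cg.
have -> : [set x | f x <= g x] = (fun x => f x - g x) @^-1` [set z | z <= 0].
  by apply/seteqP; split => x /=; rewrite subr_le0.
apply: closed_comp; last exact: closed_le.
by move=> x _; apply: cvgB; [exact: cf|exact: cg].
Qed.

Lemma closed_eq_fun (T : topologicalType) (f g : T -> R) :
  continuous f -> continuous g -> closed [set x | f x = g x].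
Proof.
move=> cf cg.
have -> : [set x | f x = g x] = [set x | f x <= g x] `&` [set x | g x <= f x].
  by apply/seteqP; split => x /= => [->|[? ?]]; [rewrite lexx|apply/eqP; rewrite eq_le; apply/andP].
by apply: closedI; exact: closed_le_fun.
Qed.

Lemma pants_compact : compact (@pants R).
Proof.
have cB : compact [set v : space | forall i, `[-1, 1]%classic (v 0 i)].
  exact: (@rV_compact R 3 (fun=> `[-1, 1]%classic) (fun=> @segment_compact R _ _)).
apply: (subclosed_compact _ cB).
  have -> : @pants R = [set u : space | u 0 0 ^+ 2 + u 0 (0 + 1) ^+ 2 + u 0 (0 + 2) ^+ 2 = 1]
      `&` \bigcap_(i in setT) [set u : space | u 0 i <= 4 / 5].
    apply/seteqP; split => u.
      move=> pu; split; first exact: (pants_sum 0 pu).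
      by case: pu => _ pu i _; exact: pu.
    by move=> [/= h1 h2]; split=> [|i]; [rewrite (ord3_sum 0)|exact: (h2 i)].
  apply: closedI.
    apply: closed_eq_fun; last exact: cst_cont.
    move=> u; exact: (cvgD (cvgD (sqr_cvg (@row_cont 0 u))
      (sqr_cvg (@row_cont (0 + 1) u))) (sqr_cvg (@row_cont (0 + 2) u))).
  apply: closed_bigI => i _; apply: closed_le_fun; first exact: row_cont.
  exact: cst_cont.
move=> u /pants_sum pu i; rewrite /= in_itv /=.
by have := pu i => h; apply/andP; split; nra.
Qed.

Lemma box_compact : compact [set w : R * R | `[-1, 1]%classic w.1 /\ `[-1, 1]%classic w.2].
Proof. by apply: compact_setX; exact: segment_compact. Qed.

Let sqsum_cont : continuous (fun w : R * R => w.1 ^+ 2 + w.2 ^+ 2).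
Proof. by move=> w; apply: cvgD; apply: sqr_cvg; [exact: cvg_fst|exact: cvg_snd]. Qed.

Lemma circle_compact : compact (@circle R).
Proof.
apply: (subclosed_compact _ box_compact).
  by apply: closed_eq_fun; [exact: sqsum_cont|exact: cst_cont].
by move=> w; rewrite /circle /= !in_itv /= => h; split; apply/andP; split; nra.
Qed.

Lemma disk_compact : compact (@disk R).
Proof.
apply: (subclosed_compact _ box_compact).
  by apply: closed_le_fun; [exact: sqsum_cont|exact: cst_cont].
by move=> w; rewrite /disk /= !in_itv /= => h; split; apply/andP; split; nra.
Qed.

End Coordinates.

(** * Charts of the Seifert manifold *)

Section Charts.
Context {R : realType} {Y : topologicalType}.
Variable S : seifert_S2 R (fun=> 3%N) Y.
Local Notation plane := (R * R)%type.
Local Notation space := 'rV[R]_3.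
Local Notation beta i := ((seifert_beta S i)%:~R : R).
Local Notation gamma i := ((seifert_gamma S i)%:~R : R).
Local Notation delta i := ((seifert_delta S i)%:~R : R).
Local Notation PC := (@pants R `*` @circle R).
Local Notation DC := (@disk R `*` @circle R).
Local Notation prod := (product_part S).
Local Notation torus := (solid_torus S).

Lemma glue_det i : 3 * delta i - gamma i * beta i = 1.
Proof.
have := seifert_det S i => /(congr1 (fun z : int => z%:~R : R)).
by rewrite intrB !intrM.
Qed.

Lemma pants_boundaryE i t :
  pants_boundary i t = mkv i (4 / 5) (3 / 5 * cos t) (3 / 5 * sin t) :> space.
Proof. by []. Qed.

(** Change of variables by the inverse of the gluing matrix, whose entries are again integers
    because the determinant is 1. *)
Lemma glue i th ph : prod (pants_boundary i th, cis ph) =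
  torus i (cis (delta i * th - gamma i * ph), cis (- beta i * th + 3 * ph)).
Proof.
have d := glue_det i; rewrite seifert_glue /=.
congr (prod (pants_boundary i _, cis _)).
  by rewrite -[LHS]mul1r -[X in X * _ = _]d; ring.
by rewrite -[LHS]mul1r -[X in X * _ = _]d; ring.
Qed.

Definition solid i : set Y := torus i @` DC.

Definition over (A : set space) : set Y := prod @` ((@pants R `&` A) `*` @circle R).

Lemma solid_compact i : compact (solid i).
Proof.
apply: continuous_compact; first exact: solid_torus_continuous.
by apply: compact_setX; [exact: disk_compact|exact: circle_compact].
Qed.

Lemma overX_compact A : closed A -> compact ((@pants R `&` A) `*` @circle R).
Proof.
move=> cA; apply: compact_setX; last exact: circle_compact.
by apply: compact_closedI => //; exact: pants_compact.
Qed.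

Lemma overX_sub A : (@pants R `&` A) `*` @circle R `<=` PC.
Proof. by move=> x [[? ?] ?]. Qed.

Lemma over_within A : {within (@pants R `&` A) `*` @circle R, continuous prod}.
Proof. exact: (continuous_subspaceW (@overX_sub A) (@product_part_continuous _ _ _ S)). Qed.

Lemma over_compact A : closed A -> compact (over A).
Proof.
by move=> cA; apply: continuous_compact; [exact: over_within|exact: overX_compact].
Qed.

Lemma solid_closed i : closed (solid i).
Proof. exact: compact_closed (@seifert_hausdorff _ _ _ S) (@solid_compact i). Qed.

Lemma over_closed A : closed A -> closed (over A).
Proof. by move=> cA; exact: compact_closed (@seifert_hausdorff _ _ _ S) (over_compact cA). Qed.

Definition pinv (y : Y) : space * plane :=
  xget (0, (0, 0)) [set x | PC x /\ prod x = y].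

Definition tinv i (y : Y) : plane * plane :=
  xget ((0, 0), (0, 0)) [set x | DC x /\ torus i x = y].

Lemma pinvK x : PC x -> pinv (prod x) = x.
Proof.
move=> px; rewrite /pinv.
have [px' e] := @xgetI _ (0, (0, 0)) [set x' | PC x' /\ prod x' = prod x] x (conj px erefl).
exact: (@product_part_inj _ _ _ S _ _ (mem_set px') (mem_set px) e).
Qed.

Lemma tinvK i x : DC x -> tinv i (torus i x) = x.
Proof.
move=> px; rewrite /tinv.
have [px' e] := @xgetI _ ((0, 0), (0, 0))
  [set x' | DC x' /\ torus i x' = torus i x] x (conj px erefl).
exact: (@solid_torus_inj _ _ _ S i _ _ (mem_set px') (mem_set px) e).
Qed.

Lemma pinv_within A : closed A -> {within over A, continuous pinv}.
Proof.
move=> cA; apply: image_within; first exact: (@seifert_hausdorff _ _ _ S).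
- exact: overX_compact.
- exact: over_within.
- apply: (@within_eq _ _ _ id) => [x px|]; first by rewrite pinvK //; exact: overX_sub px.
  by apply: continuous_subspaceT; exact: id_cont.
Qed.

Lemma tinv_within i : {within solid i, continuous (tinv i)}.
Proof.
apply: image_within; first exact: (@seifert_hausdorff _ _ _ S).
- by apply: compact_setX; [exact: disk_compact|exact: circle_compact].
- exact: solid_torus_continuous.
- apply: (@within_eq _ _ _ id) => [x px|]; first by rewrite tinvK.
  by apply: continuous_subspaceT; exact: id_cont.
Qed.

Lemma solid_prod i u w : PC (u, w) -> solid i (prod (u, w)) <-> u 0 i = 4 / 5.
Proof.
move=> pc; split=> [[[z w'] dc e]|ui].
  have cz := seifert_meet dc pc e.
  have [t /= zE] := circle_cis cz; have [s /= w'E] := circle_cis dc.2.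
  move: e; rewrite zE w'E /= seifert_glue => e.
  have pb : PC (pants_boundary i (3%:R * t + gamma i * s),
      cis (beta i * t + delta i * s)).
    split; last exact: cis_circle.
    rewrite /= pants_boundaryE; apply/pants_mkv; split.
    - rewrite !exprMn -!addrA -mulrDr cos2Dsin2; lra.
    - exact: lexx.
    - by have := cos_le1 (3%:R * t + gamma i * s); lra.
    - by have := sin_le1 (3%:R * t + gamma i * s); lra.
  have := @product_part_inj _ _ _ S _ _ (mem_set pb) (mem_set pc) e.
  by case=> <- _; rewrite pants_boundaryE mkvE.
have [ph /= ->] := circle_cis pc.2.
have := pants_sum i pc.1; rewrite /= ui => us.
have [th [e1 e2]] : exists th,
    (u 0 (i + 1) / (3 / 5), u 0 (i + 2) / (3 / 5)) = cis th.
  by apply: circle_cis; rewrite /circle /= !expr_div_n; lra.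
have -> : u = pants_boundary i th.
  rewrite pants_boundaryE (rowE3 i u) ui -e1 -e2.
  by congr (mkv _ _ _ _); field.
rewrite glue; exists (cis (delta i * th - gamma i * ph), cis (- beta i * th + 3 * ph)) => //.
by split; [have := cis_circle (delta i * th - gamma i * ph); rewrite /circle /disk /= => ->|exact: cis_circle].
Qed.

(** For [e > 0] two sectors overlap in a strip that runs from (1, 1, 1) to (-1, -1, -1) between two
    boundary circles. *)
Definition sector (e : R) (i : 'I_3) : set space :=
  [set u | forall j, u 0 j - e <= u 0 i].

Lemma sector_closed e i : closed (sector e i).
Proof.
have -> : sector e i = \bigcap_(j in setT) [set u : space | u 0 j - e <= u 0 i].
  by apply/seteqP; split => u h; [move=> j _; exact: h|move=> j; exact: (h j)].
apply: closed_bigI => j _; apply: closed_le_fun; last exact: row_cont.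
by move=> u; exact: (cvgB (@row_cont R j u) (cvg_cst e)).
Qed.

Local Notation eps := (10^-1 : R).

Definition radius (i : 'I_3) (u : space) : R := Num.sqrt (1 - u 0 i ^+ 2).

(** Motion along the meridian through the i-th basis vector: the height goes linearly to 4/5 and the
    other two coordinates are rescaled to stay on the sphere. The angle around the i-th boundary
    circle does not change. *)
Definition push (i : 'I_3) (u : space) (s : R) : space :=
  let h := (1 - s) * u 0 i + s * (4 / 5) in
  let k := Num.sqrt (1 - h ^+ 2) / radius i u in
  mkv i h (k * u 0 (i + 1)) (k * u 0 (i + 2)).

Lemma radius_gt0 i u : pants u -> sector eps i u -> 0 < radius i u.
Proof.
move=> pu su; rewrite sqrtr_gt0.
have := pants_sum i pu; have := su (i + 1); have := su (i + 2).
have : u 0 i <= 4 / 5 by case: pu.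
rewrite /=; move: (u 0 i) (u 0 (i + 1)) (u 0 (i + 2)) => a b d ha hd hb abd.
rewrite ltNge; apply/negP => h.
have b0 : b = 0 by apply/eqP; rewrite -sqrf_eq0; apply/eqP; nra.
have d0 : d = 0 by apply/eqP; rewrite -sqrf_eq0; apply/eqP; nra.
by move: abd; rewrite b0 d0; nra.
Qed.

Lemma radius_sqr i u : pants u ->
  radius i u ^+ 2 = u 0 (i + 1) ^+ 2 + u 0 (i + 2) ^+ 2.
Proof.
by move=> /(pants_sum i) h; rewrite sqr_sqrtr; [lra|have := sqr_ge0 (u 0 (i + 1)); have := sqr_ge0 (u 0 (i + 2)); lra].
Qed.

(** The danger is that another coordinate [x] grows past 4/5. If the height [a] is nonnegative, the
    scale factor [k] is at most 1. If it is negative, the sector condition gives [x < 1/10] and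
    [a > -1/10] when [x > 0], and [k] is close to 1. *)
Lemma push_pants i u s : pants u -> sector eps i u -> 0 <= s <= 1 -> pants (push i u s).
Proof.
move=> pu su /andP[s0 s1]; have r0 := radius_gt0 pu su.
have r2 := radius_sqr i pu; have us := pants_sum i pu.
have hb := su (i + 1); have hd := su (i + 2); have ha : u 0 i <= 4 / 5 by case: pu.
have hb' : u 0 (i + 1) <= 4 / 5 by case: pu.
have hd' : u 0 (i + 2) <= 4 / 5 by case: pu.
rewrite /push; move: (u 0 i) (u 0 (i + 1)) (u 0 (i + 2)) (radius i u) us hb hd ha hb' hd' r0 r2.
move=> a b d r us hb hd ha hb' hd' r0 r2.
set h := (1 - s) * a + s * (4 / 5).
have ah : a <= h by rewrite /h; nra.
have h1 : h <= 4 / 5 by rewrite /h; nra.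
have a1 : -1 <= a by nra.
have h2 : 0 <= 1 - h ^+ 2 by nra.
set q := Num.sqrt (1 - h ^+ 2); have q0 : 0 <= q by exact: sqrtr_ge0.
have q2 : q ^+ 2 = 1 - h ^+ 2 by rewrite sqr_sqrtr.
set k := q / r; have k0 : 0 <= k by rewrite divr_ge0 // ltW.
have kr : k * r = q by rewrite divfK // gt_eqF.
have kr2 : k ^+ 2 * r ^+ 2 = 1 - h ^+ 2 by rewrite -exprMn kr.
have bound x : x - eps <= a -> x <= 4 / 5 -> k * x <= 4 / 5.
  move=> xa x45; have [x0|x0] := leP x 0; first by nra.
  have [a0|a0] := leP 0 a.
    have k1 : k <= 1.
      rewrite -(@ler_pXn2r _ 2) ?nnegrE // expr1n.
      by rewrite -(ler_pM2r (exprn_gt0 2 r0)) mul1r kr2; nra.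
    by nra.
  have r9 : 99 / 100 <= r ^+ 2 by nra.
  have k9 : k ^+ 2 <= 100 / 99 by nra.
  have x1 : x < 1 / 10 by lra.
  suff : (k * x) ^+ 2 <= 16 / 25 by nra.
  have x2 : x ^+ 2 <= 1 / 100 by nra.
  by rewrite exprMn; have := sqr_ge0 x; have := sqr_ge0 k; nra.
apply/pants_mkv; split.
- have : k ^+ 2 * b ^+ 2 + k ^+ 2 * d ^+ 2 = 1 - h ^+ 2 by rewrite -mulrDr -r2.
  by rewrite !exprMn; lra.
- exact: h1.
- by apply: bound.
- by apply: bound.
Qed.

Lemma push0 i u : pants u -> sector eps i u -> push i u 0 = u.
Proof.
move=> pu su; rewrite /push subr0 mul1r mul0r addr0 divff; last first.
  by rewrite gt_eqF //; exact: radius_gt0.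
by rewrite !mul1r -rowE3.
Qed.

Lemma push_boundary i u s : pants u -> sector eps i u -> u 0 i = 4 / 5 -> push i u s = u.
Proof.
move=> pu su ui; rewrite -[RHS](push0 pu su) /push ui.
have e (t : R) : (1 - t) * (4 / 5) + t * (4 / 5) = 4 / 5 by ring.
by rewrite !e.
Qed.

Lemma sqrt_boundary : Num.sqrt (1 - (4 / 5) ^+ 2) = 3 / 5 :> R.
Proof.
have -> : 1 - (4 / 5) ^+ 2 = (3 / 5) ^+ 2 :> R by field.
by rewrite sqrtr_sqr ger0_norm //; lra.
Qed.

Lemma push1 i u : push i u 1 = mkv i (4 / 5)
  (3 / 5 * (u 0 (i + 1) / radius i u)) (3 / 5 * (u 0 (i + 2) / radius i u)).
Proof.
rewrite /push subrr mul0r add0r mul1r.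
by rewrite sqrt_boundary; congr (mkv _ _ _ _); rewrite mulrAC mulrA.
Qed.

Lemma push_within i : {within (@pants R `&` sector eps i) `*` [set: R],
  continuous (fun x : space * R => push i x.1 x.2)}.
Proof.
apply: continuous_in_subspaceT => -[u s]; rewrite inE => -[[/= pu su] _].
have c0 (j : 'I_3) : {for (u, s), continuous (fun x : space * R => x.1 0 j)}.
  exact: (continuous_compose (@row_cont R j) (@fst_cont space R)).
have ch : {for (u, s), continuous (fun x : space * R =>
    (1 - x.2) * x.1 0 i + x.2 * (4 / 5))}.
  apply: cvgD; last by apply: cvgM; [exact: cvg_snd|exact: cvg_cst].
  by apply: cvgM; [apply: cvgB; [exact: cvg_cst|exact: cvg_snd]|exact: c0].
have csq (f : space * R -> R) : {for (u, s), continuous f} ->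
    {for (u, s), continuous (fun x => Num.sqrt (1 - f x ^+ 2))}.
  move=> cf; apply: (@continuous_comp _ _ _ (fun x => 1 - f x ^+ 2) (@Num.sqrt R)).
    by apply: cvgB; [exact: cvg_cst|exact: sqr_cvg].
  exact: sqrt_continuous.
have ck : {for (u, s), continuous (fun x : space * R =>
    Num.sqrt (1 - ((1 - x.2) * x.1 0 i + x.2 * (4 / 5)) ^+ 2) / radius i x.1)}.
  apply: cvgM; first exact: csq.
  apply: cvgV; last by apply: (csq (fun x => x.1 0 i)); exact: c0.
  by rewrite gt_eqF //; exact: radius_gt0.
by apply: mkv_cvg; [exact: ch|apply: cvgM; [exact: ck|exact: c0]
  |apply: cvgM; [exact: ck|exact: c0]].
Qed.

End Charts.

(** * Deformation of a neighbourhood of a solid torus onto it *)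

Section Deformation.
Context {R : realType} {Y : topologicalType}.
Variable S : seifert_S2 R (fun=> 3%N) Y.
Local Notation space := 'rV[R]_3.
Local Notation PC := (@pants R `*` @circle R).
Local Notation prod := (product_part S).
Local Notation torus := (solid_torus S).
Local Notation solid := (solid S).
Local Notation over := (over S).
Local Notation pinv := (pinv S).
Local Notation tinv := (tinv S).
Local Notation eps := (10^-1 : R).

Definition chart (e : R) (i : 'I_3) : set Y := solid i `|` over (sector e i).

(* Pushes the part of the product piece close to the i-th solid torus radially
   onto the boundary of that torus. *)
Definition defm (i : 'I_3) (s : R) (y : Y) : Y :=
  if `[< solid i y >] then y else prod (push i (pinv y).1 s, (pinv y).2).

Lemma defm_solid i s y : solid i y -> defm i s y = y.
Proof. by move=> h; rewrite /defm ifT //; apply/asboolP. Qed.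

Lemma defm_prod i s u w : PC (u, w) -> sector eps i u ->
  defm i s (prod (u, w)) = prod (push i u s, w).
Proof.
move=> pc su; rewrite /defm; case: asboolP => [/(solid_prod S i pc) ui|_].
  by rewrite push_boundary //; case: pc.
by rewrite pinvK.
Qed.

Lemma defm0 i y : chart eps i y -> defm i 0 y = y.
Proof.
case=> [|[[u w] [[/= pu su] cw] <-]]; first exact: defm_solid.
by rewrite defm_prod ?push0.
Qed.

Lemma defm1_solid i y : chart eps i y -> solid i (defm i 1 y).
Proof.
case=> [h|[[u w] [[/= pu su] cw] <-]]; first by rewrite defm_solid.
rewrite defm_prod //; apply/(solid_prod S i).
  by split=> //=; apply: push_pants => //; rewrite ler01 lexx.
by rewrite push1 mkvE.
Qed.

Lemma defm_within i (X : topologicalType) (A : set X) (p : X -> Y) (s : X -> R) :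
  {within A, continuous p} -> {within A, continuous s} ->
  (forall x, A x -> chart eps i (p x)) -> (forall x, A x -> 0 <= s x <= 1) ->
  {within A, continuous (fun x => defm i (s x) (p x))}.
Proof.
move=> cp cs Ap As.
pose A2 := A `&` p @^-1` (over (sector eps i)).
have A2A : A2 `<=` A by move=> x [].
have cp2 := continuous_subspaceW A2A cp; have cs2 := continuous_subspaceW A2A cs.
have cov := @over_closed R Y S _ (@sector_closed R eps i).
have cpi : {within A2, continuous (fun x => pinv (p x))}.
  by apply: (within_comp cp2 (@pinv_within R Y S _ (@sector_closed R eps i))) => x [].
have pinvP x : A2 x -> (@pants R `&` sector eps i) (pinv (p x)).1
    /\ circle (pinv (p x)).2.
  by move=> [_ /= [[u w] puw <-]]; rewrite pinvK //; exact: overX_sub puw.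
have c1 : {within A2, continuous (fun x => (pinv (p x)).1)}.
  by apply: (within_comp cpi (continuous_subspaceT (A := setT) (@fst_cont _ _))).
have c2 : {within A2, continuous (fun x => (pinv (p x)).2)}.
  by apply: (within_comp cpi (continuous_subspaceT (A := setT) (@snd_cont _ _))).
have c3 : {within A2, continuous (fun x => push i (pinv (p x)).1 (s x))}.
  by apply: (within_comp (within_tuple c1 cs2) (@push_within R i)) => x /pinvP[].
have c4 : {within A2, continuous (fun x => prod (push i (pinv (p x)).1 (s x), (pinv (p x)).2))}.
  apply: (within_comp (within_tuple c3 c2) (@product_part_continuous _ _ _ S)).
  move=> x /[dup] -[Ax _] /pinvP[[pu su] cw]; split=> //=.
  by apply: push_pants => //; exact: As.
have c5 : {within A2, continuous (fun x => defm i (s x) (p x))}.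
  apply: within_eq c4 => x [_ /= [[u w] [[/= pu su] cw] <-]].
  by rewrite defm_prod // pinvK.
move/subspace_continuousP: c5 => c5; move/subspace_continuousP: cp => cp.
apply/subspace_continuousP => x Ax W nW.
have n1 : \forall z \near within A (nbhs x), solid i (p z) -> W (defm i (s z) (p z)).
  have [h|h] := pselect (solid i (p x)).
    have nW' : nbhs (p x) W by rewrite -(defm_solid (s x) h).
    have nz : \forall z \near within A (nbhs x), W (p z) := cp x Ax _ nW'.
    by apply: filterS nz => z Wz hz; rewrite defm_solid.
  have nh : nbhs (p x) (~` solid i).
    by apply: open_nbhs_nbhs; split=> //; apply: closed_openC; exact: solid_closed.
  have nz : \forall z \near within A (nbhs x), ~ solid i (p z) := cp x Ax _ nh.
  by apply: filterS nz.
have n2 : \forall z \near within A (nbhs x),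
    over (sector eps i) (p z) -> W (defm i (s z) (p z)).
  have [h|h] := pselect (over (sector eps i) (p x)).
    have nz : \forall z \near x, A2 z -> W (defm i (s z) (p z)) := c5 x (conj Ax h) _ nW.
    by apply: filterS nz => z hz Az hpz; exact: hz.
  have nh : nbhs (p x) (~` over (sector eps i)).
    by apply: open_nbhs_nbhs; split=> //; exact: closed_openC.
  have nz : \forall z \near within A (nbhs x), ~ over (sector eps i) (p z) :=
    cp x Ax _ nh.
  by apply: filterS nz.
have n3 : \forall z \near within A (nbhs x), A z by exact: withinT.
apply: filterS3 n1 n2 n3 => z h1 h2 /Ap [h|h]; [exact: h1|exact: h2].
Qed.

Lemma defm_cont i (X : topologicalType) (p : X -> Y) (s : X -> R) :
  continuous p -> continuous s ->
  (forall x, chart eps i (p x)) -> (forall x, 0 <= s x <= 1) ->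
  continuous (fun x => defm i (s x) (p x)).
Proof.
move=> cp cs Ap As; apply/continuous_subspace_setT.
by apply: defm_within => //; exact: continuous_subspaceT.
Qed.

Lemma sector_cover (e : R) (u : space) : 0 < e -> exists i : 'I_3, forall j, u 0 j - e < u 0 i.
Proof.
move=> e0; have [i hi] : exists i : 'I_3, forall j, u 0 j <= u 0 i.
  have [i _ hi] := @arg_maxP _ _ _ (0 : 'I_3) predT (fun i => u 0 i) isT.
  by exists i => j; exact: hi.
by exists i => j; have := hi j; lra.
Qed.

Lemma chart_mono (e e' : R) i : e <= e' -> chart e i `<=` chart e' i.
Proof.
move=> ee y [h|[[u w] [[pu su] cw] <-]]; [by left|right; exists (u, w) => //].
by split=> //; split=> // j; have := su j; lra.
Qed.

Lemma chart_total (e : R) y : 0 < e -> exists i, chart e i y.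
Proof.
move=> e0; have : [set: Y] y by [].
rewrite -(seifert_cover S) => -[[[u w] pc <-]|[i _ h]]; last by exists i; left.
have [i hi] := sector_cover u e0; exists i; right; exists (u, w) => //.
by case: pc => pu cw; split=> //; split=> // j; exact/ltW.
Qed.

(** The charts are closed, so a cover does not suffice for local arguments: each point must be
    interior to one of them. The sets to avoid, namely the other solid tori and the place where the
    i-th coordinate is too small, are closed. *)
Lemma chart_nbhs (e : R) (y : Y) : 0 < e -> exists i, \forall z \near y, chart e i z.
Proof.
move=> e0; have : [set: Y] y by [].
have opC (A : set space) : closed A -> ~ over A y -> nbhs y (~` over A).
  by move=> cA h; apply: open_nbhs_nbhs; split=> //; apply: closed_openC; exact: over_closed.
have opS i : ~ solid i y -> nbhs y (~` solid i).
  by move=> h; apply: open_nbhs_nbhs; split=> //; apply: closed_openC; exact: solid_closed.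
have disj i j : solid i y -> j != i -> nbhs y (~` solid j).
  move=> [v dv vE] ji; apply: opS => -[v' dv' v'E].
  move/eqP: ji; apply; apply: (@seifert_disjoint _ _ _ S j i v' v) => //.
  by rewrite vE.
pose far i : set space := \bigcup_(j in [set: 'I_3]) [set u : space | u 0 i <= u 0 j - e].
have cfar i : closed (far i).
  apply: closed_bigcup => [|j _]; first exact: finite_finset.
  apply: closed_le_fun; first exact: row_cont.
  by move=> u; exact: (cvgB (@row_cont R j u) (cvg_cst e)).
have key i : nbhs y (~` over (far i)) -> (forall j, j != i -> nbhs y (~` solid j)) ->
    \forall z \near y, chart e i z.
  move=> n0 n; near=> z.
  have h0 : ~ over (far i) z by near: z.
  have h1 : ~ solid (i + 1) z by near: z; apply: n; rewrite ord3_neq.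
  have h2 : ~ solid (i + 2) z by near: z; apply: n; rewrite ord3_neq.
  have : [set: Y] z by [].
  rewrite -(seifert_cover S) => -[[[u w] pc zE]|[j _]]; last first.
    by case: (ord3P i j) => -> // h; left.
  right; exists (u, w) => //; case: pc => pu cw; split=> //; split=> // j.
  rewrite leNgt; apply/negP => h; apply: h0; exists (u, w) => //; split=> //; split=> //.
  by exists j => //=; exact: ltW.
rewrite -(seifert_cover S) => -[[[u w] pc yE]|[i _ h]].
- have [[i h]|nh] := pselect (exists i, solid i y).
    exists i; apply: key => [|j ji]; last exact: disj h ji.
    apply: opC => // -[[u' w'] [[/= pu' [j _ /= fj]] cw'] y'E].
    move: h; rewrite -y'E => /(solid_prod S i (conj pu' cw')) ui.
    by have := fj; rewrite ui; have [_ h'] := pu'; have := h' j; lra.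
  have [i hi] := sector_cover u e0; exists i; apply: key => [|j _]; last first.
    by apply: opS => h; apply: nh; exists j.
  apply: opC => // -[[u' w'] [[/= pu' [j _ /= fj]] cw'] y'E].
  have := @product_part_inj _ _ _ S (u', w') (u, w); rewrite !inE => h.
  have [] := h (conj pu' cw') pc (etrans y'E (esym yE)).
  by move=> e1 _; have := hi j; rewrite -e1; lra.
- exists i; apply: key => [|j ji]; last exact: disj h ji.
  apply: opC => // -[[u' w'] [[/= pu' [j _ /= fj]] cw'] y'E].
  move: h; rewrite -y'E => /(solid_prod S i (conj pu' cw')) ui.
  by have := fj; rewrite ui; have [_ h'] := pu'; have := h' j; lra.
Unshelve. all: by end_near. Qed.

End Deformation.

(** * Integer powers in a group *)

Section IntegerPowers.
Context {G : groupType}.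
Local Open Scope group_scope.

Definition zexp (x : G) (m : int) : G :=
  match m with Posz n => x ^+ n | Negz n => x ^- n.+1 end.

Lemma zexpS x m : zexp x (m + 1)%R = zexp x m * x.
Proof.
case: m => n /=; first by rewrite /= addn1 expgSr.
case: n => [|n]; first by rewrite /= expg1 mulVg.
rewrite NegzE (_ : (- n.+2%:Z + 1)%R = Negz n); last by rewrite NegzE; lia.
by rewrite /= [x ^+ n.+2]expgS invgM mulgVK.
Qed.

Lemma zexpN x m : zexp x (- m)%R = (zexp x m)^-1.
Proof. by case: m => [[|n]|n] //=; rewrite ?invg1 ?invgK. Qed.

Lemma zexp_unique (f : int -> G) x :
  f 0%R = 1 -> (forall m, f (m + 1)%R = f m * x) -> forall m, f m = zexp x m.
Proof.
move=> f0 fS; elim/int_rect => [//|n IH|n IH].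
  by rewrite -addn1 PoszD fS IH zexpS.
apply: (mulIg x); rewrite -fS -zexpS.
by rewrite (_ : (- n.+1%:Z + 1)%R = (- n%:Z)%R) ?IH //; lia.
Qed.

Lemma zexpD x m n : zexp x (m + n)%R = zexp x m * zexp x n.
Proof.
apply: (mulgI (zexp x m)^-1); rewrite mulKg; move: n.
apply: (zexp_unique (f := fun n => (zexp x m)^-1 * zexp x (m + n)%R)).
  by rewrite addr0 mulVg.
by move=> n; rewrite addrA zexpS mulgA.
Qed.

Lemma zexpM3 x m : x ^+ 3 = 1 -> zexp x (3 * m)%R = 1.
Proof.
move=> x3; transitivity (zexp (1 : G) m).
  apply: (zexp_unique (f := fun m => zexp x (3 * m)%R)) => // n.
  by rewrite mulrDr mulr1 zexpD /= x3.
apply/esym; move: m; apply: (zexp_unique (f := fun=> 1)) => // m.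
by rewrite mulg1.
Qed.

Lemma zexp_conj (x y : G) m : zexp (x * y * x^-1) m = x * zexp y m * x^-1.
Proof.
apply/esym; move: m; apply: (zexp_unique (f := fun m => x * zexp y m * x^-1)).
  by rewrite mulg1 mulgV.
by move=> m; rewrite zexpS !mulgA mulgVK.
Qed.

Lemma zexp_subgroup (H : set G) x m : is_subgroup H -> H x -> H (zexp x m).
Proof.
move=> [H1 HM HV] Hx; have Hn n : H (x ^+ n).
  by elim: n => [|n IH]; rewrite ?expg0 // expgS; exact: HM.
by case: m => n /=; [exact: Hn|exact/HV/Hn].
Qed.

End IntegerPowers.

Lemma zexp_morph (G H : groupType) (f : G -> H) (fM : {morph f : x y / (x * y)%g})
  x m : f (zexp x m) = zexp (f x) m.
Proof.
have f1 : f 1%g = 1%g by apply: (mulgI (f 1%g)); rewrite -fM !mulg1.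
by move: m; apply: (zexp_unique (f := fun m => f (zexp x m))) => // m; rewrite zexpS fM.
Qed.

(** * Universal covers of the solid tori *)

Section TorusMap.
Context {R : realType} {Y : topologicalType}.
Variable S : seifert_S2 R (fun=> 3%N) Y.
Local Notation plane := (R * R)%type.
Local Notation DC := (@disk R `*` @circle R).
Local Notation torus := (solid_torus S).

(** Radial retraction of the plane onto the disk. It extends the parametrization of a solid torus to
    a whole normed space, as [hol] requires; together with the unrolled core circle this yields
    [torus_map]. *)
Definition retract (z : plane) : plane :=
  let m := Num.max 1 (Num.sqrt (z.1 ^+ 2 + z.2 ^+ 2)) in (z.1 / m, z.2 / m).

Lemma retract_id z : disk z -> retract z = z.
Proof.
rewrite /disk /retract /= => dz; rewrite max_l ?invr1 ?mulr1; first by case: z dz.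
by rewrite -[leRHS]sqrtr1 ler_sqrt.
Qed.

Lemma retract_disk z : disk (retract z).
Proof.
rewrite /disk /retract /=; set n := z.1 ^+ 2 + _; set m := Num.max _ _.
have n0 : 0 <= n by rewrite addr_ge0 // sqr_ge0.
have m1 : 1 <= m by rewrite le_max lexx.
have mn : Num.sqrt n <= m by rewrite le_max lexx orbT.
have nm : n <= m ^+ 2.
  by rewrite -[n]sqr_sqrtr //; have := sqrtr_ge0 n; nra.
by rewrite !expr_div_n -mulrDl ler_pdivrMr ?mul1r //; nra.
Qed.

Lemma retract_cont : continuous retract.
Proof.
have cm : continuous (fun z : plane => Num.max 1 (Num.sqrt (z.1 ^+ 2 + z.2 ^+ 2))).
  move=> z; apply: (@continuous_max R _ (cst 1)
    (fun z : plane => Num.sqrt (z.1 ^+ 2 + z.2 ^+ 2))); first exact: cvg_cst.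
  apply: (@continuous_comp _ _ _ (fun z : plane => z.1 ^+ 2 + z.2 ^+ 2) (@Num.sqrt R)).
    by apply: cvgD; apply: sqr_cvg; [exact: cvg_fst|exact: cvg_snd].
  exact: sqrt_continuous.
have ci (z : plane) : (fun z : plane => (Num.max 1 (Num.sqrt (z.1 ^+ 2 + z.2 ^+ 2)))^-1) @ z -->
    (Num.max 1 (Num.sqrt (z.1 ^+ 2 + z.2 ^+ 2)))^-1.
  by apply: cvgV; [rewrite gt_eqF // lt_max ltr01|exact: cm].
apply: continuous_tuple => z; apply: cvgM; try exact: ci.
  exact: cvg_fst.
exact: cvg_snd.
Qed.

Definition torus_map i (l : plane * R) : Y := torus i (retract l.1, cis l.2).

Lemma torus_map_cont i : continuous (torus_map i).
Proof.
apply: (within_compl (f := fun l : plane * R => (retract l.1, cis l.2))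
  _ (@solid_torus_continuous _ _ _ S i)).
  apply: continuous_tuple.
    exact: (continuous_compose retract_cont (@fst_cont _ _)).
  exact: (continuous_compose (@cis_cont R) (@snd_cont _ _)).
by move=> l; split; [exact: retract_disk|exact: cis_circle].
Qed.

(** The deck transformations of [torus_map]. *)
Definition shift (m : int) (l : plane * R) : plane * R :=
  (l.1, l.2 + m%:~R * (pi *+ 2)).

Lemma shift_cont m : continuous (shift m).
Proof.
apply: continuous_tuple; first exact: fst_cont.
by move=> l; apply: cvgD; [exact: cvg_snd|exact: cvg_cst].
Qed.

Lemma shift0 l : shift 0 l = l.
Proof. by case: l => z s; rewrite /shift /= mul0r addr0. Qed.

Lemma shiftD m n l : shift (m + n) l = shift m (shift n l).
Proof. by case: l => z s; rewrite /shift /= intrD; congr (_, _); ring. Qed.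

Lemma torus_map_shift i m l : torus_map i (shift m l) = torus_map i l.
Proof. by rewrite /torus_map /= cis2pi. Qed.

Lemma torus_map_inj i l l' : disk l.1 -> disk l'.1 ->
  torus_map i l = torus_map i l' -> exists m, l = shift m l'.
Proof.
case: l l' => [z s] [z' s'] /= dz dz' e.
have h (v : plane) (r : R) : disk v -> (retract v, cis r) \in DC.
  by move=> ?; rewrite inE; split; [exact: retract_disk|exact: cis_circle].
have := @solid_torus_inj _ _ _ S i _ _ (h _ s dz) (h _ s' dz') e.
rewrite !retract_id // => -[-> cE sE].
have [m ->] : exists m : int, s = s' + m%:~R * (pi *+ 2).
  by apply: cis_eq; rewrite /cis cE sE.
by exists m.
Qed.

Section Hol.
Variables (y0 : Y) (base : forall y, path R y0 y).
Local Notation hol := (hol base).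
Local Open Scope group_scope.

Lemma hol_shift i m l l' :
  hol (torus_map i) (shift m l) (shift m l') = hol (torus_map i) l l'.
Proof.
rewrite -hol_comp; [|exact: torus_map_cont|exact: shift_cont].
have -> // : (fun l => torus_map i (shift m l)) = torus_map i.
by apply/funext => z; rewrite torus_map_shift.
Qed.

Definition core i l := hol (torus_map i) l (shift 1 l).

Lemma hol_shiftr i m l l' : hol (torus_map i) l (shift m l') =
  zexp (core i l) m * hol (torus_map i) l l'.
Proof.
have ct := @torus_map_cont i.
rewrite -(hol_trans _ _ (shift m l)) // hol_shift; congr (_ * _).
move: m; apply: (zexp_unique (f := fun m => hol (torus_map i) l (shift m l))).
  by rewrite shift0 hol_refl.
move=> m; rewrite -(hol_trans _ _ (shift m l)) //; congr (_ * _).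
by rewrite shiftD hol_shift.
Qed.

End Hol.
End TorusMap.

(** * Generators of the fundamental group *)

Section Generation.
Context {R : realType} {Y : topologicalType}.
Variable S : seifert_S2 R (fun=> 3%N) Y.
Variables (y0 : Y) (base : forall y, path R y0 y).
Local Notation plane := (R * R)%type.
Local Notation space := 'rV[R]_3.
Local Notation beta i := ((seifert_beta S i)%:~R : R).
Local Notation gamma i := ((seifert_gamma S i)%:~R : R).
Local Notation delta i := ((seifert_delta S i)%:~R : R).
Local Notation DC := (@disk R `*` @circle R).
Local Notation prod := (product_part S).
Local Notation eps := (10^-1 : R).
Local Notation G := (pi1 R y0).
Local Notation hol := (hol base).
Local Notation chart := (chart S).
Local Notation defm := (defm S).
Local Notation tmap := (torus_map S).

(** For [s = 1] and [s = -1], the two points of the sphere equidistant from the three boundary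
    circles; they lie in every sector. *)
Definition pole (s : R) : space := mkv 0 (s / Num.sqrt 3) (s / Num.sqrt 3) (s / Num.sqrt 3).

Lemma sqrt3_gt0 : 0 < Num.sqrt 3 :> R.
Proof. by rewrite sqrtr_gt0. Qed.

Lemma sqrt3_sqr : Num.sqrt 3 ^+ 2 = 3 :> R.
Proof. by rewrite sqr_sqrtr. Qed.

Lemma poleE s i : pole s = mkv i (s / Num.sqrt 3) (s / Num.sqrt 3) (s / Num.sqrt 3).
Proof. by apply/rowP => j; rewrite !mxE !if_same. Qed.

Lemma pole_pants s : s ^+ 2 = 1 -> pants (pole s).
Proof.
move=> s1; apply/pants_mkv.
have h : (s / Num.sqrt 3) ^+ 2 = 3^-1 by rewrite expr_div_n sqrt3_sqr s1 mul1r.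
by split; nra.
Qed.

Lemma pole_sector e s i : 0 <= e -> sector e i (pole s).
Proof. by move=> e0 j; rewrite (poleE s i); case: (ord3P i j) => ->; rewrite !mkvE; lra. Qed.

Definition hub : Y := prod (pole 1, cis 0).

Lemma hub_chart i : chart eps i hub.
Proof.
right; exists (pole 1, cis 0) => //; split; last exact: cis_circle.
by split; [apply: pole_pants; rewrite expr1n|apply: pole_sector; lra].
Qed.

(** The boundary point with angles [th] and [ph], lifted to the cover of the solid torus by the
    inverse gluing matrix; only the angle along the core is kept as a real number. *)
Definition angle_lift i (th ph : R) : plane * R :=
  (cis (delta i * th - gamma i * ph), - beta i * th + 3 * ph).

Lemma disk_cis x : disk (cis x : plane).
Proof. by have := cis_circle x; rewrite /circle /disk /= => ->. Qed.

Lemma defm1_lift i u th ph : pants u -> sector eps i u ->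
  u 0 (i + 1) = radius i u * cos th -> u 0 (i + 2) = radius i u * sin th ->
  defm i 1 (prod (u, cis ph)) = tmap i (angle_lift i th ph).
Proof.
move=> pu su e1 e2; have r0 := radius_gt0 pu su.
rewrite defm_prod //; last by split=> //; exact: cis_circle.
rewrite push1 e1 e2 !(mulrC (radius i u)) !mulfK ?gt_eqF //.
by rewrite -pants_boundaryE glue /torus_map /= retract_id //; exact: disk_cis.
Qed.

Lemma cos_piquarter : 2 * cos (pi / 4) ^+ 2 = 1 :> R
  /\ sin (pi / 4) = cos (pi / 4) :> R.
Proof.
have c0 : 0 < cos (pi / 4) :> R.
  by apply: cos_gt0_pihalf; have := @pi_gt0 R => h; apply/andP; split; lra.
have sc : sin (pi / 4) = cos (pi / 4) :> R.
  have := @tan_piquarter R; rewrite /tan => /(congr1 (fun x => x * cos (pi / 4))).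
  by rewrite divfK ?gt_eqF // mul1r.
by split=> //; have := cos2Dsin2 (pi / 4 : R); rewrite sc; lra.
Qed.

Definition lhub i := angle_lift i (pi / 4) 0.

Lemma cos_piquarter_gt0 : 0 < cos (pi / 4) :> R.
Proof.
by apply: cos_gt0_pihalf; have := @pi_gt0 R => h; apply/andP; split; lra.
Qed.

Lemma pole_radius s i : s ^+ 2 = 1 ->
  radius i (pole s) = (Num.sqrt 3)^-1 / cos (pi / 4).
Proof.
move=> s1; have [c2 sc] := cos_piquarter; have c0 := cos_piquarter_gt0.
have s3 := sqrt3_gt0; have s32 := sqrt3_sqr.
rewrite /radius (poleE s i) mkvE.
rewrite (_ : 1 - _ = ((Num.sqrt 3)^-1 / cos (pi / 4)) ^+ 2).
  by rewrite sqrtr_sqr ger0_norm // divr_ge0 ?invr_ge0 // ltW.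
rewrite !expr_div_n !exprVn s32 s1 (_ : cos _ ^+ 2 = 2^-1); last by lra.
by field.
Qed.

Lemma pole_polar i : pole 1 0 (i + 1) = radius i (pole 1) * cos (pi / 4)
  /\ pole 1 0 (i + 2) = radius i (pole 1) * sin (pi / 4).
Proof.
have [c2 sc] := cos_piquarter; have c0 := cos_piquarter_gt0.
by rewrite pole_radius ?expr1n // sc divfK ?gt_eqF // (poleE 1 i) !mkvE mul1r.
Qed.

Lemma hub_lift i : tmap i (lhub i) = defm i 1 hub.
Proof.
have [e1 e2] := pole_polar i.
rewrite /lhub -(@defm1_lift i (pole 1)) //.
- by apply: pole_pants; rewrite expr1n.
- by apply: pole_sector; lra.
Qed.

Local Open Scope group_scope.

Definition track i y := hol (fun s => defm i (clamp s) y) 0%R 1%R.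

(** Deforming the path into the solid torus sweeps a rectangle. Two of its sides are tracks, and the
    far side lies in the solid torus, where its holonomy is read off the lift [l]. *)
Lemma chart_hol i (p : R -> Y) (l : R -> plane * R) x y :
  continuous p -> (forall t, chart eps i (p t)) -> continuous l ->
  (forall t, tmap i (l t) = defm i 1%R (p t)) ->
  hol p x y = track i (p x) * hol (tmap i) (l x) (l y) * (track i (p y))^-1.
Proof.
move=> cp ip cl lp.
have cH : continuous (fun z : R * R => defm i (clamp z.1) (p z.2)).
  apply: (defm_cont (p := fun z : R * R => p z.2) (s := fun z : R * R => clamp z.1)).
  - exact: (continuous_compose cp (@snd_cont R R)).
  - exact: (continuous_compose (@clamp_cont R) (@fst_cont R R)).
  - by move=> z; exact: ip.
  - by move=> z; exact: clamp_itv.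
have := hol_square base 0%R 1%R x y cH; rewrite /=.
have -> : (fun t => defm i (clamp 0%R) (p t)) = p.
  by apply/funext => t; rewrite clamp_le0 // defm0.
have -> : (fun t => defm i (clamp 1%R) (p t)) = (fun t => tmap i (l t)).
  by apply/funext => t; rewrite clamp_ge1 // lp.
by rewrite (hol_comp base x y (@torus_map_cont _ _ S i) cl).
Qed.

(** The element [L_i]: into the solid torus along the track of the hub, once around the core, and
    back. *)
Definition gen i : G := track i hub * core S base i (lhub i) * (track i hub)^-1.

Definition frame i (y : Y) (l : plane * R) : G :=
  track i hub * hol (tmap i) (lhub i) l * (track i y)^-1.

(** The classes, closed up by [base], of paths from the hub to [y] within the i-th chart: one for
    each lift of the deformed endpoint, so a torsor under the powers of [gen i]. *)
Definition frames i (y : Y) : set G :=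
  [set g | exists l, [/\ disk l.1, tmap i l = defm i 1%R y & g = frame i y l]].

Lemma frame_shift i y m l : frame i y (shift m l) = zexp (gen i) m * frame i y l.
Proof. by rewrite /frame hol_shiftr /gen zexp_conj !mulgA mulgVK. Qed.

Lemma frames_torsor i y g g' : frames i y g -> frames i y g' ->
  exists m, g' = zexp (gen i) m * g.
Proof.
move=> [l [dl le ->]] [l' [dl' le' ->]].
have [m ->] := torus_map_inj dl' dl (etrans le' (esym le)).
by exists m; exact: frame_shift.
Qed.

Lemma frames_hub i : frames i hub 1.
Proof.
exists (lhub i); split; [exact: disk_cis|exact: hub_lift|].
by rewrite /frame hol_refl ?mulg1 ?mulgV //; exact: torus_map_cont.
Qed.

Lemma frames_nonempty i y : chart eps i y -> exists g, frames i y g.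
Proof.
move=> /(defm1_solid (S := S)) [[z w] [/= dz cw] e]; have [s wE] := circle_cis cw.
exists (frame i y (z, s)); exists (z, s); split=> //.
by rewrite /torus_map /= retract_id // -wE.
Qed.

Definition clip (x y t : R) : R := Num.max x (Num.min t y).

Lemma clip_cont x y : continuous (clip x y).
Proof.
move=> t; apply: (@continuous_max R R (cst x) (fun s => Num.min s y)).
  exact: cvg_cst.
by apply: (@continuous_min R R id (cst y)); [exact: cvg_id|exact: cvg_cst].
Qed.

Lemma clip_itv x y t : (x <= y)%R -> (x <= clip x y t <= y)%R.
Proof. by move=> xy; rewrite /clip le_max lexx ge_max xy ge_min lexx orbT. Qed.

Lemma clip_l x y : (x <= y)%R -> clip x y x = x.
Proof. by move=> xy; rewrite /clip (min_l xy) maxxx. Qed.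

Lemma clip_r x y : (x <= y)%R -> clip x y y = y.
Proof. by move=> xy; rewrite /clip minxx max_r. Qed.

Lemma hol_clip (p : R -> Y) x y : continuous p -> (x <= y)%R ->
  hol (fun t => p (clip x y t)) x y = hol p x y.
Proof.
move=> cp xy; rewrite hol_comp // ?clip_l ?clip_r //; exact: clip_cont.
Qed.

(** By [cousin] it suffices to lift the deformed path on short intervals; the initial point of the
    lift then differs from the given one by a deck transformation. *)
Lemma frames_hol i (p : R -> Y) : continuous p -> (forall t, chart eps i (p t)) ->
  forall x y, (x <= y)%R ->
  forall g, frames i (p x) g -> frames i (p y) (g * hol p x y).
Proof.
move=> cp ip; apply: cousin => [t0|x y z xy yz hxy hyz g gx]; last first.
  by rewrite -(hol_trans _ x y z) // mulgA; apply/hyz/hxy.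
pose q t := tinv S i (defm i 1%R (p t)).
have cq : continuous q.
  apply: (within_compl _ (@tinv_within _ _ S i)).
    by apply: (defm_cont (s := fun=> 1%R)) => // [|x]; [exact: cst_cont|rewrite ler01 lexx].
  by move=> t; exact: defm1_solid.
have qP t : DC (q t) /\ solid_torus S i (q t) = defm i 1%R (p t).
  by have [v dv e] := defm1_solid (ip t); rewrite /q -e tinvK.
have cq1 : continuous (fun t => (q t).1) := continuous_compose (@fst_cont _ _) cq.
have cq2 : continuous (fun t => (q t).2) := continuous_compose (@snd_cont _ _) cq.
have [[_ /= /circle_cis[s0 q0]] _] := qP t0.
(* Rotation by [- s0], which takes the core coordinate at [t0] to (1, 0), away from the
   discontinuity of [arg]. On a short interval the first coordinate stays positive, and [s0 + arg]
   is a continuous angle. *)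
pose rot (w : plane) : plane :=
  (w.1 * cos s0 + w.2 * sin s0, w.2 * cos s0 - w.1 * sin s0)%R.
have crot : continuous rot.
  have cM (f : plane -> R) (a : R) : continuous f -> continuous (fun w => f w * a)%R.
    by move=> cf w; apply: cvgM; [exact: cf|exact: cvg_cst].
  apply: continuous_tuple => w.
    by apply: cvgD; apply: cM; [exact: fst_cont|exact: snd_cont].
  by apply: cvgB; apply: cM; [exact: snd_cont|exact: fst_cont].
have rotc w : circle w -> circle (rot w).
  rewrite /circle /rot /= => cw; have := cos2Dsin2 s0 => cs.
  by rewrite -[RHS]mulr1 -[X in _ = (X * _)%R]cw -cs; ring.
have crq : continuous (fun t => (rot (q t).2).1).
  exact: (continuous_compose (@fst_cont _ _) (continuous_compose crot cq2)).
have r0 : (0 < (rot (q t0).2).1)%R.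
  by rewrite q0 /rot /= -!expr2 cos2Dsin2.
have [e e0 he] := near_itv (cvgr_gt _ (crq t0) _ r0).
exists e => // x y tx xy yt g [l0 [dl0 l0e ->]].
have ck := @clip_cont x y.
have kI t : (0 < (rot (q (clip x y t)).2).1)%R.
  by have /andP[? ?] := clip_itv t xy; apply: he; lra.
pose l t : plane * R := ((q (clip x y t)).1, s0 + arg (rot (q (clip x y t)).2))%R.
have cl : continuous l.
  apply: continuous_tuple; first exact: (continuous_compose cq1 ck).
  move=> t; apply: cvgD; first exact: cvg_cst.
  apply: (@continuous_comp _ _ _ (fun t => rot (q (clip x y t)).2) (@arg R)).
    exact: (continuous_compose crot (continuous_compose cq2 ck)).
  by apply: arg_cont; have := kI t; lra.
have lP t : tmap i (l t) = defm i 1%R (p (clip x y t)).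
  have [[dq cq'] <-] := qP (clip x y t).
  rewrite /torus_map /l /= retract_id //; congr (solid_torus S i _).
  rewrite [RHS]surjective_pairing; congr (_, _).
  rewrite cisD cis_arg; [|exact: rotc|by have := kI t; lra].
  rewrite [RHS]surjective_pairing /rot /cis /=.
  have cs := cos2Dsin2 s0.
  congr (_, _); [rewrite -[RHS]mulr1 -[X in _ = (_ * X)%R]cs; ring|
    rewrite -[RHS]mulr1 -[X in _ = (_ * X)%R]cs; ring].
have := chart_hol x y (continuous_compose cp ck) (fun t => ip _) cl lP.
rewrite hol_clip // clip_l // clip_r // => ->.
have dl t : disk (l t).1 by have [[]] := qP (clip x y t).
have lx : tmap i (l x) = defm i 1%R (p x) by rewrite lP clip_l.
have ly : tmap i (l y) = defm i 1%R (p y) by rewrite lP clip_r.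
have [m ->] := torus_map_inj dl0 (dl x) (etrans l0e (esym lx)).
exists (shift m (l y)); split; [exact: dl|by rewrite torus_map_shift|].
rewrite !frame_shift -mulgA; congr (_ * _).
by rewrite /frame !mulgA mulgVK -[_ * hol _ _ _ * hol _ _ _]mulgA hol_trans //;
  exact: torus_map_cont.
Qed.

End Generation.

(** * Overlaps of charts and generation by the cores *)

Section Overlap.
Context {R : realType} {Y : topologicalType}.
Variable S : seifert_S2 R (fun=> 3%N) Y.
Variables (y0 : Y) (base : forall y, path R y0 y).
Local Notation plane := (R * R)%type.
Local Notation space := 'rV[R]_3.
Local Notation prod := (product_part S).
Local Notation eps := (10^-1 : R).
Local Notation G := (pi1 R y0).
Local Notation hol := (hol base).
Local Notation chart := (chart S).
Local Notation gen := (gen S base).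
Local Notation frames := (frames S base).
Local Notation hub := (hub S).

(** A coordinate above 4/5 would force another one above 7/10, and the vector would be longer than
    1. *)
Lemma strip_pants i (a b d : R) : a ^+ 2 + b ^+ 2 + d ^+ 2 = 1 ->
  a - b <= eps -> b - a <= eps -> d - a <= eps -> d - b <= eps ->
  [/\ pants (mkv i a b d), sector eps i (mkv i a b d) &
      sector eps (i + 1) (mkv i a b d)].
Proof.
move=> n ab ba da db; split.
- apply/pants_mkv; split=> //; rewrite leNgt; apply/negP => h.
  + have h7 : 7 / 10 < b by lra.
    by nra.
  + have h7 : 7 / 10 < a by lra.
    by nra.
  + have h7 : 7 / 10 < b by lra.
    by nra.
- by move=> j; case: (ord3P i j) => ->; rewrite !mkvE; lra.
- by move=> j; case: (ord3P i j) => ->; rewrite !mkvE; lra.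
Qed.

(* The spherical segment from u to the middle (1, 1, -2) / sqrt 6 of the
   strip between the i-th and (i + 1)-th boundary circles. *)
Definition strip_norm i (u : space) (t : R) : R := Num.sqrt
  (((1 - t) * u 0 i + t) ^+ 2 + ((1 - t) * u 0 (i + 1) + t) ^+ 2
    + ((1 - t) * u 0 (i + 2) - 2 * t) ^+ 2).

Definition strip_seg i (u : space) (t : R) : space :=
  mkv i (((1 - t) * u 0 i + t) / strip_norm i u t)
        (((1 - t) * u 0 (i + 1) + t) / strip_norm i u t)
        (((1 - t) * u 0 (i + 2) - 2 * t) / strip_norm i u t).

(** On the segment the differences of coordinates are scaled by [1 - t] before normalization, so
    dividing by a norm of at least [(1 - t) / 2] at most doubles them. This is why sectors of width
    [eps / 2] are joined inside sectors of width [eps]. *)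
Lemma strip_norm_ge i u t : pants u -> sector (eps / 2) i u ->
  sector (eps / 2) (i + 1) u -> 0 <= t <= 1 ->
  (1 - t) / 2 <= strip_norm i u t /\ 0 < strip_norm i u t.
Proof.
move=> /(pants_sum i) us h1 h2 /andP[t0 t1]; rewrite /strip_norm.
have := h1 (i + 1); have := h1 (i + 2); have := h2 i; have := h2 (i + 2).
move: (u 0 i) (u 0 (i + 1)) (u 0 (i + 2)) us => a b d us db ba da ab.
set N := ((1 - t) * a + t) ^+ 2 + _ + _.
have NE : N = (1 - t) ^+ 2 + 2 * (t * (1 - t)) * (a + b - 2 * d) + 6 * t ^+ 2.
  by rewrite -[X in _ = X + _ + _]mulr1 -[X in _ = _ * X + _ + _]us /N; ring.
have tt : 0 <= t * (1 - t) by nra.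
have Nge : (1 - t) ^+ 2 - 2 * (t * (1 - t)) / 10 + 6 * t ^+ 2 <= N by rewrite NE; nra.
have N0 : 0 < N by nra.
split; last by rewrite sqrtr_gt0.
have N4 : ((1 - t) / 2) ^+ 2 <= N by nra.
rewrite -(@ger0_norm _ ((1 - t) / 2)); last by lra.
by rewrite -sqrtr_sqr ler_sqrt // ltW.
Qed.

Lemma strip_segP i u t : pants u -> sector (eps / 2) i u ->
  sector (eps / 2) (i + 1) u -> 0 <= t <= 1 ->
  [/\ pants (strip_seg i u t), sector eps i (strip_seg i u t) &
      sector eps (i + 1) (strip_seg i u t)].
Proof.
move=> pu h1 h2 t01; have [N1 N0] := strip_norm_ge pu h1 h2 t01.
have t0 : 0 <= t by case/andP: t01. have t1 : t <= 1 by case/andP: t01.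
have sq : strip_norm i u t ^+ 2 = ((1 - t) * u 0 i + t) ^+ 2
    + ((1 - t) * u 0 (i + 1) + t) ^+ 2 + ((1 - t) * u 0 (i + 2) - 2 * t) ^+ 2.
  by rewrite sqr_sqrtr // !addr_ge0 // sqr_ge0.
have := h1 (i + 1); have := h1 (i + 2); have := h2 i; have := h2 (i + 2).
rewrite /strip_seg.
move: (u 0 i) (u 0 (i + 1)) (u 0 (i + 2)) (strip_norm i u t) sq N1 N0.
move=> a b d N sq N1 N0 db ba da ab.
have bound x y : x - y <= (1 - t) * (eps / 2) -> x / N - y / N <= eps.
  by move=> xy; rewrite -mulrBl ler_pdivrMr //; nra.
apply: strip_pants.
- by rewrite !expr_div_n -!mulrDl -sq divff // sqrf_eq0 gt_eqF.
- by apply: bound; nra.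
- by apply: bound; nra.
- by apply: bound; nra.
- by apply: bound; nra.
Qed.

Lemma strip_seg0 i u : pants u -> strip_seg i u 0 = u.
Proof.
move=> /(pants_sum i) us; rewrite /strip_seg /strip_norm.
by rewrite !(subr0, mulr0, addr0, mul1r) us sqrtr1 !divr1 -rowE3.
Qed.

Lemma strip_seg1 i u v : strip_seg i u 1 = strip_seg i v 1.
Proof. by rewrite /strip_seg /strip_norm subrr !mul0r. Qed.

Lemma strip_seg_cont i u (s : R -> R) : pants u -> sector (eps / 2) i u ->
  sector (eps / 2) (i + 1) u -> continuous s -> (forall t, 0 <= s t <= 1) ->
  continuous (fun t => strip_seg i u (s t)).
Proof.
move=> pu h1 h2 cs s01 t.
have ca (a b : R) : {for t, continuous (fun t => (1 - s t) * a + b * s t)}.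
  apply: cvgD; apply: cvgM; try exact: cvg_cst; last exact: cs.
  by apply: cvgB; [exact: cvg_cst|exact: cs].
have ca1 (a : R) : {for t, continuous (fun t => (1 - s t) * a + s t)}.
  have := ca a 1; rewrite (_ : (fun t => _ + 1 * _) = fun t => (1 - s t) * a + s t) //.
  by apply/funext => x; rewrite mul1r.
have ca2 (a : R) : {for t, continuous (fun t => (1 - s t) * a - 2 * s t)}.
  have := ca a (-2); rewrite (_ : (fun t => _ + -2 * _) = fun t => (1 - s t) * a - 2 * s t) //.
  by apply/funext => x; rewrite mulNr.
have cn : {for t, continuous (fun t => (strip_norm i u (s t))^-1)}.
  apply: cvgV; first by rewrite gt_eqF //; have [] := strip_norm_ge pu h1 h2 (s01 t).
  apply: (@continuous_comp _ _ _ (fun t => ((1 - s t) * u 0 i + s t) ^+ 2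
    + ((1 - s t) * u 0 (i + 1) + s t) ^+ 2
    + ((1 - s t) * u 0 (i + 2) - 2 * s t) ^+ 2) (@Num.sqrt R)).
    apply: cvgD; [apply: cvgD|]; apply: sqr_cvg; [exact: ca1|exact: ca1|exact: ca2].
  exact: sqrt_continuous.
apply: mkv_cvg.
- by apply: cvgM; [exact: ca1|exact: cn].
- by apply: cvgM; [exact: ca1|exact: cn].
- by apply: cvgM; [exact: ca2|exact: cn].
Qed.

Lemma prod_cont (u : R -> space) (w : R -> plane) :
  continuous u -> continuous w -> (forall t, pants (u t)) -> (forall t, circle (w t)) ->
  continuous (fun t => prod (u t, w t)).
Proof.
move=> cu cw pu cw'.
apply: (within_compl (f := fun t => (u t, w t)) _ (@product_part_continuous _ _ _ S)).
  exact: continuous_tuple.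
by move=> t; split; [exact: pu|exact: cw'].
Qed.

Definition common i j y := exists2 g, frames i y g & frames j y g.

Lemma common_path i j (p : R -> Y) : continuous p ->
  (forall t, chart eps i (p t)) -> (forall t, chart eps j (p t)) ->
  common i j (p 0) -> common i j (p 1).
Proof.
move=> cp ip jp [g gi gj]; exists (g * hol p 0%R 1%R)%g.
  exact: (frames_hol cp ip ler01 gi).
exact: (frames_hol cp jp ler01 gj).
Qed.

Lemma prod_chart i u w : pants u -> circle w -> sector eps i u -> chart eps i (prod (u, w)).
Proof. by move=> pu cw su; right; exists (u, w). Qed.

(** At the hub both charts have the frame 1. It is carried within both charts along three pieces:
    from the hub to the middle of the strip, along the fiber to [w], and back across the strip to
    [u]. *)
Lemma overlap_succ i u w : pants u -> circle w -> sector (eps / 2) i u ->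
  sector (eps / 2) (i + 1) u -> common i (i + 1) (prod (u, w)).
Proof.
move=> pu cw h1 h2; have [ph wE] := circle_cis cw.
have p1 : pants (pole 1 : space) by apply: pole_pants; rewrite expr1n.
have s1 j : sector (eps / 2) j (pole 1 : space) by apply: pole_sector; lra.
have c01 (t : R) : 0 <= 1 - clamp t <= 1.
  by have /andP[? ?] := clamp_itv t; apply/andP; split; lra.
have cc : continuous (fun t : R => 1 - clamp t).
  by move=> t; apply: cvgB; [exact: cvg_cst|exact: clamp_cont].
have k1 : common i (i + 1) (prod (strip_seg i (pole 1) 1, cis 0)).
  pose p t := prod (strip_seg i (pole 1) (clamp t), cis 0).
  have pP t := strip_segP p1 (s1 i) (s1 (i + 1)) (clamp_itv t).
  have := @common_path i (i + 1) p; rewrite /p clamp_le0 // clamp_ge1 // strip_seg0 //.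
  apply.
  - apply: prod_cont => [||t|t]; last exact: cis_circle.
    + exact: (strip_seg_cont p1 (s1 i) (s1 (i + 1)) (@clamp_cont R) (@clamp_itv R)).
    + exact: cst_cont.
    + by have [] := pP t.
  - by move=> t; have [? ? ?] := pP t; apply: prod_chart => //; exact: cis_circle.
  - by move=> t; have [? ? ?] := pP t; apply: prod_chart => //; exact: cis_circle.
  - by exists 1%g; exact: frames_hub.
have [pm si si1] : [/\ pants (strip_seg i (pole 1) 1 : space),
    sector eps i (strip_seg i (pole 1) 1 : space) &
    sector eps (i + 1) (strip_seg i (pole 1) 1 : space)].
  by apply: strip_segP => //; rewrite ler01 lexx.
have k2 : common i (i + 1) (prod (strip_seg i (pole 1) 1, w)).
  pose p (t : R) := prod (strip_seg i (pole 1) 1, cis (t * ph)).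
  have := @common_path i (i + 1) p; rewrite /p mul0r mul1r -wE; apply => //.
  - apply: prod_cont => [||t|t]; [exact: cst_cont| |exact: pm|exact: cis_circle].
    apply: (continuous_compose (@cis_cont R)) => t.
    by apply: cvgM; [exact: cvg_id|exact: cvg_cst].
  - by move=> t; apply: prod_chart => //; exact: cis_circle.
  - by move=> t; apply: prod_chart => //; exact: cis_circle.
pose p t := prod (strip_seg i u (1 - clamp t), w).
have pP t := strip_segP pu h1 h2 (c01 t).
have := @common_path i (i + 1) p; rewrite /p clamp_le0 // clamp_ge1 // subr0 subrr.
rewrite strip_seg0 // (strip_seg1 i u (pole 1)); apply => //.
- apply: prod_cont => [||t|t]; [exact: strip_seg_cont|exact: cst_cont| |exact: cw].
  by have [] := pP t.
- by move=> t; have [? ? ?] := pP t; exact: prod_chart.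
- by move=> t; have [? ? ?] := pP t; exact: prod_chart.
Qed.

Lemma overlap i j y : chart (eps / 2) i y -> chart (eps / 2) j y -> common i j y.
Proof.
have sol k l u w : l != k -> pants u -> circle w -> sector (eps / 2) k u ->
    solid S l (prod (u, w)) -> False.
  move=> lk pu cw su /(solid_prod S l (conj pu cw)) ul.
  move: ul (su l) (pants_sum k pu) lk.
  by case: (ord3P k l) => -> ul; rewrite ?eqxx // ul; nra.
move=> hi hj; have [ij|ij] := eqVneq j i.
  have [g gi] : exists g, frames i y g.
    apply: frames_nonempty; apply: chart_mono hi; lra.
  by exists g; rewrite // ij.
have [u [w [pu cw yE si sj]]] : exists u, exists w,
    [/\ pants u, circle w, y = prod (u, w), sector (eps / 2) i u & sector (eps / 2) j u].
  case: hi => [hi|[[u w] [[/= pu si] cw] yE]].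
    case: hj => [hj|[[u w] [[/= pu sj] cw] yE]].
      case: hi hj => v dv vE [v' dv' v'E].
      have e : j = i.
        by apply: (@seifert_disjoint _ _ _ S j i v' v) => //; rewrite vE.
      by move: ij; rewrite e eqxx.
    by case: (@sol j i u w) => //; [rewrite eq_sym|rewrite yE].
  case: hj => [hj|[[u' w'] [[/= pu' sj] cw'] y'E]].
    by case: (@sol i j u w) => //; rewrite yE.
  have h := @product_part_inj _ _ _ S (u', w') (u, w).
  rewrite !inE in h; have [e1 e2] := h (conj pu' cw') (conj pu cw) (etrans y'E (esym yE)).
  by exists u, w; split=> //; rewrite -e1.
rewrite yE; case: (ord3P i j) ij => jE; rewrite jE ?eqxx // => _.
  by apply: overlap_succ => //; rewrite -jE.
have iE : i = j + 1 by rewrite jE ord3E.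
have [g gi gj] : common j i (prod (u, w)) by rewrite iE; apply: overlap_succ => //; rewrite -iE.
by exists g => //; rewrite -jE.
Qed.

Local Open Scope group_scope.

(** The generation half of van Kampen's theorem. Along a path a frame continues inside one chart,
    and passing to another chart costs a power of a generator, by [overlap] and [frames_torsor].
    Comparing the frames at both ends of a loop puts a conjugate of its class in [H], by a
    conjugating element independent of the loop. *)
Lemma gen_generate (H : set G) : is_subgroup H -> (forall i, H (gen i)) ->
  forall x, H x.
Proof.
move=> sH Hg; have [H1 HM HV] := sH.
have e2 : (0 < eps / 2)%R by lra.
have e2' : (eps / 2 <= eps)%R by lra.
(* Frames at [y] up to left multiplication by [H]. The chart is allowed to vary, since by [frE] the
   notion is the same for all charts that contain [y]. *)
pose fr y g := exists i h g0, [/\ chart (eps / 2) i y, frames i y g0, H h & g = h * g0].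
have frE y g j : fr y g -> chart (eps / 2) j y ->
    exists h g0, [/\ frames j y g0, H h & g = h * g0].
  move=> [i [h [g0 [iy fg0 Hh ->]]]] jy.
  have [g1 g1i g1j] := overlap iy jy.
  have [m ->] := frames_torsor g1i fg0.
  exists (h * zexp (gen i) m), g1; split=> //; last by rewrite mulgA.
  by apply: HM => //; exact: zexp_subgroup.
have frP (a : R -> Y) : continuous a -> forall x y, (x <= y)%R ->
    forall g, fr (a x) g -> fr (a y) (g * hol a x y).
  move=> ca; apply: cousin => [t|x y z xy yz hxy hyz g gx]; last first.
    by rewrite -(hol_trans base x y z ca) mulgA; apply/hyz/hxy.
  have [j nj] := chart_nbhs S (a t) e2.
  have nj' : \forall z \near t, chart (eps / 2) j (a z) := ca t _ nj.
  have [e e0 he] := near_itv nj'; exists e => // x y tx xy yt g gx.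
  have ck := @clip_cont R x y.
  have pj s : chart (eps / 2) j (a (clip x y s)).
    by have /andP[? ?] := clip_itv s xy; apply: he; lra.
  have xj : chart (eps / 2) j (a x) by have := pj x; rewrite clip_l.
  have yj : chart (eps / 2) j (a y) by have := pj y; rewrite clip_r.
  have [h [g0 [g0j Hh ->]]] := frE _ _ _ gx xj.
  exists j, h, (g0 * hol a x y); split=> //; last by rewrite mulgA.
  have := frames_hol (base := base) (i := j) (continuous_compose ca ck)
    (fun s => chart_mono e2' (pj s)) xy.
  by rewrite clip_l // clip_r // hol_clip //; apply.
have [i iy] := chart_total S y0 e2.
have [g gP] : exists g, frames i y0 g.
  by apply: frames_nonempty; exact: chart_mono iy.
have key x : H (g * x * g^-1).
  have [a [ca a0 a1 ->]] := pi1_hol base x.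
  have : fr (a 1%R) (g * hol a 0%R 1%R).
    apply: (frP _ ca _ _ ler01).
    by rewrite a0; exists i, 1, g; split=> //; rewrite mul1g.
  rewrite a1 => /frE/(_ iy) [h [g0 [fg0 Hh e]]].
  have [m g0E] := frames_torsor gP fg0.
  by rewrite e g0E !mulgA mulgK; apply: HM => //; exact: zexp_subgroup.
move=> x; have := key (g^-1 * x * g).
by rewrite !mulgA mulgV mul1g mulgK.
Qed.

End Overlap.

(** * Relations between the generators *)

Section Relations.
Context {R : realType} {Y : topologicalType}.
Variable S : seifert_S2 R (fun=> 3%N) Y.
Variables (y0 : Y) (base : forall y, path R y0 y).
Local Notation plane := (R * R)%type.
Local Notation space := 'rV[R]_3.
Local Notation prod := (product_part S).
Local Notation eps := (10^-1 : R).
Local Notation hol := (hol base).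
Local Notation gen := (gen S base).
Local Notation frame := (frame S base).
Local Notation hub := (hub S).
Local Notation angle_lift := (angle_lift S).
Local Notation lhub := (lhub S).

Lemma lift_cont i (th ph : R -> R) : continuous th -> continuous ph ->
  continuous (fun t => angle_lift i (th t) (ph t)).
Proof.
move=> cth cph; apply: continuous_tuple.
  apply: (continuous_compose (@cis_cont R)) => t.
  by apply: cvgB; apply: cvgMr; [exact: cth|exact: cph].
by move=> t; apply: cvgD; apply: cvgMr; [exact: cth|exact: cph].
Qed.

(** Turns around the boundary circle count [- beta] times along the core, turns of the fiber three
    times. Both kinds of relations between the generators are read off here. *)
Lemma lift_shift i th ph (m n : int) :
  angle_lift i (th + m%:~R * (pi *+ 2)) (ph + n%:~R * (pi *+ 2)) =
  shift (- seifert_beta S i * m + 3 * n) (angle_lift i th ph).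
Proof.
rewrite /angle_lift /shift /=; congr (_, _).
  rewrite -[RHS](cis2pi _ (seifert_delta S i * m - seifert_gamma S i * n)).
  by rewrite intrB !intrM; congr cis; ring.
by rewrite intrD !intrM mulrNz; ring.
Qed.

Local Open Scope group_scope.

Lemma frame_lhub i m : frame i hub (shift m (lhub i)) = zexp (gen i) m.
Proof.
by rewrite frame_shift /frame hol_refl ?mulg1 ?mulgV ?mulg1 //; exact: torus_map_cont.
Qed.

(** The fiber over [pole 1] lies in all three charts, and one turn of it is three turns of each
    core. *)
Lemma gen_cube i j : gen i ^+ 3 = gen j ^+ 3.
Proof.
suff h k : gen k ^+ 3 = hol (fun ph => prod (pole 1%R, cis ph)) 0%R (pi *+ 2)%R.
  by rewrite !h.
have p1 : pants (pole 1%R : space) by apply: pole_pants; rewrite expr1n.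
have cp : continuous (fun ph => prod (pole 1%R, cis ph)).
  by apply: prod_cont => [||t|t]; [exact: cst_cont|exact: cis_cont|exact: p1|exact: cis_circle].
have cl : continuous (fun ph => angle_lift k (pi / 4)%R ph).
  by apply: (lift_cont (th := fun=> (pi / 4)%R)); [exact: cst_cont|exact: id_cont].
have [e1 e2] := @pole_polar R k.
rewrite (@chart_hol _ _ S _ base k _ _ _ _ cp _ cl); first last.
- move=> t; rewrite -(@defm1_lift _ _ S k (pole 1%R)) //.
  by apply: pole_sector; lra.
- move=> t; apply: prod_chart => //; first exact: cis_circle.
  by apply: pole_sector; lra.
have -> : angle_lift k (pi / 4)%R (pi *+ 2)%R = shift 3 (lhub k).
  have := @lift_shift k (pi / 4)%R 0%R 0 1; rewrite mulr0 mulr1 !add0r.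
  by rewrite mul0r addr0 mul1r.
have -> : cis (pi *+ 2)%R = cis (0 : R).
  by rewrite -(cis2pi 0%R 1) add0r mul1r.
by rewrite -[RHS]/(frame k hub (shift 3 (lhub k))) frame_lhub.
Qed.

Local Close Scope group_scope.

(* The direction of the point u of the sphere seen from the i-th vector of the
   basis, in a frame rotated by psi, and the corresponding branch of its angle. *)
Definition rotv (psi : R) i (u : space) : plane :=
  ((u 0 (i + 1) * cos psi + u 0 (i + 2) * sin psi) / radius i u,
   (u 0 (i + 2) * cos psi - u 0 (i + 1) * sin psi) / radius i u).

Definition ang psi i u : R := psi + arg (rotv psi i u).

Lemma rotv_circle psi i u : pants u -> sector eps i u -> circle (rotv psi i u).
Proof.
move=> pu su; have r0 := radius_gt0 pu su; have r2 := radius_sqr i pu.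
have cs := cos2Dsin2 psi.
rewrite /circle /rotv /= !expr_div_n -mulrDl; apply: canLR (mulfK _) _.
  by rewrite sqrf_eq0 gt_eqF.
rewrite mul1r r2 -[RHS]mulr1 -[X in _ = _ * X]cs; ring.
Qed.

Lemma ang_polar psi i u : pants u -> sector eps i u -> -1 < (rotv psi i u).1 ->
  u 0 (i + 1) = radius i u * cos (ang psi i u)
  /\ u 0 (i + 2) = radius i u * sin (ang psi i u).
Proof.
move=> pu su gt1; have r0 := radius_gt0 pu su; have cs := cos2Dsin2 psi.
have [wc ws] : cis (arg (rotv psi i u)) = rotv psi i u.
  by apply: cis_arg => //; exact: rotv_circle.
rewrite /ang cosD sinD wc ws /=; move: r0 => /gt_eqF r00.
split.
  transitivity (u 0 (i + 1) * (cos psi ^+ 2 + sin psi ^+ 2)); first by rewrite cs mulr1.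
  by field; rewrite r00.
transitivity (u 0 (i + 2) * (cos psi ^+ 2 + sin psi ^+ 2)); first by rewrite cs mulr1.
by field; rewrite r00.
Qed.

Lemma ang_cont psi i u : pants u -> sector eps i u -> -1 < (rotv psi i u).1 ->
  {for u, continuous (ang psi i)}.
Proof.
move=> pu su gt1; have r0 := radius_gt0 pu su.
have cj (j : 'I_3) : {for u, continuous (fun u : space => u 0 j)} by exact: row_cont.
have cr : {for u, continuous (fun u : space => radius i u)}.
  apply: (@continuous_comp _ _ _ (fun u : space => 1 - u 0 i ^+ 2) (@Num.sqrt R)).
    by apply: at_sub; [exact: at_cst|exact: (at_mul (cj i) (cj i))].
  exact: sqrt_continuous.
have crV := at_inv cr (lt0r_neq0 r0).
have cM (j : 'I_3) (a : R) : {for u, continuous (fun u : space => u 0 j * a)}.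
  exact: (at_mul (cj j) (@at_cst _ _ u a)).
apply: at_add; first exact: at_cst.
apply: (@continuous_comp _ _ _ (rotv psi i) (@arg R)); last exact: arg_cont.
have c1 : {for u, continuous (fun u => (rotv psi i u).1)}.
  by apply: at_mul crV; apply: at_add; exact: cM.
have c2 : {for u, continuous (fun u => (rotv psi i u).2)}.
  by apply: at_mul crV; apply: at_sub; exact: cM.
exact: (cvg_pair c1 c2).
Qed.

(* The great half circle from (1, 1, 1) to (-1, -1, -1) through the middle of
   the strip between the i-th and (i + 1)-th boundary circles. *)
Definition arc i (t : R) : space :=
  let a := cos (pi * clamp t) / Num.sqrt 3 in
  let b := sin (pi * clamp t) / Num.sqrt 6 in
  mkv i (a + b) (a + b) (a - 2 * b).

Lemma arc_sin_ge0 t : 0 <= sin (pi * clamp t) / Num.sqrt 6 :> R.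
Proof.
rewrite divr_ge0 ?sqrtr_ge0 // sin_ge0_pi //.
have /andP[t0 t1] := clamp_itv t; have p0 := @pi_gt0 R.
by apply/andP; split; nra.
Qed.

Lemma arcP i t : [/\ pants (arc i t), sector eps i (arc i t) & sector eps (i + 1) (arc i t)].
Proof.
have b0 := arc_sin_ge0 t; apply: strip_pants; try lra.
set a := cos _ / _; set b := sin _ / _.
have e : 3 * a ^+ 2 + 6 * b ^+ 2 = 1.
  by rewrite !expr_div_n !sqr_sqrtr // -[RHS](cos2Dsin2 (pi * clamp t)); field.
by rewrite -[RHS]e; ring.
Qed.

Lemma arc0 i t : t <= 0 -> arc i t = pole 1.
Proof.
by move=> t0; rewrite /arc clamp_le0 // mulr0 cos0 sin0 mul0r addr0 mulr0 subr0 -poleE.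
Qed.

Lemma arc1 i t : 1 <= t -> arc i t = pole (-1).
Proof.
by move=> t1; rewrite /arc clamp_ge1 // mulr1 cospi sinpi mul0r addr0 mulr0 subr0 -poleE.
Qed.

Lemma arc_cont i : continuous (arc i).
Proof.
move=> t.
have cf (f : R -> R) (a : R) : continuous f ->
    {for t, continuous (fun t => f (pi * clamp t) / a)}.
  move=> cf; apply: cvgM; last exact: cvg_cst.
  apply: (@continuous_comp _ _ _ (fun t => pi * clamp t) f); last exact: cf.
  by apply: cvgMr; exact: clamp_cont.
have ca := cf _ (Num.sqrt 3) (@continuous_cos R).
have cb := cf _ (Num.sqrt 6) (@continuous_sin R).
apply: mkv_cvg; [exact: cvgD ca cb|exact: cvgD ca cb|].
by apply: cvgB; [exact: ca|apply: cvgMr; exact: cb].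
Qed.

Lemma mkv_rot i (a b d : R) : mkv (i + 2) a b d = mkv i b d a.
Proof.
by apply/rowP => j; rewrite !mxE; case: i => -[|[|[|]]] // ?; case: j => -[|[|[|]]].
Qed.

Definition cross i := hol (fun t => prod (arc i t, cis 0)) 0 1.

(** Seen from the i-th basis vector, the half circle stays within a quarter turn of the direction
    [psi], so its angle has a continuous branch. The last hypothesis puts the two poles at right
    angles to [psi], which reduces the end values to [arg (0, _)]. *)
Lemma cross_frame i k (psi th : R) :
  (forall t, sector eps i (arc k t)) ->
  (forall t, 0 <= arc k t 0 (i + 1) * cos psi + arc k t 0 (i + 2) * sin psi) ->
  psi + arg (0, sin (pi / 4 - psi)) = pi / 4 ->
  psi + arg (0, - sin (pi / 4 - psi)) = th ->
  cos (pi / 4 - psi) = 0 ->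
  cross k = frame i (prod (pole (-1), cis 0)) (angle_lift i th 0).
Proof.
move=> sk hk e0 e1 c0; have pk t : pants (arc k t) by have [] := arcP k t.
pose th' t := ang psi i (arc k t).
have gt1 t : -1 < (rotv psi i (arc k t)).1.
  have : 0 <= (rotv psi i (arc k t)).1.
    by rewrite divr_ge0 // ltW //; apply: radius_gt0.
  by lra.
have cth : continuous th'.
  by move=> t; apply: (@continuous_comp _ _ _ (arc k) (ang psi i));
    [exact: arc_cont|exact: ang_cont].
have thE t := ang_polar (pk t) (sk t) (gt1 t).
have cp : continuous (fun t => prod (arc k t, cis 0)).
  by apply: prod_cont => [||t|t]; [exact: arc_cont|exact: cst_cont|exact: pk|exact: cis_circle].
have cl := @lift_cont i _ _ cth (@cst_cont R R 0).
rewrite /cross (@chart_hol _ _ S _ base i _ _ _ _ cp _ cl); first last.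
- by move=> t; have [? ?] := thE t; rewrite -(@defm1_lift _ _ S i (arc k t)).
- by move=> t; apply: prod_chart => //; exact: cis_circle.
have polar s : s ^+ 2 = 1 -> ang psi i (pole s) = psi + arg (0, s * sin (pi / 4 - psi)).
  rewrite /ang /rotv => s1; have [c2 sc] := @cos_piquarter R; have c4 := @cos_piquarter_gt0 R.
  have s3 := @sqrt3_gt0 R; rewrite pole_radius // (poleE s i) !mkvE.
  move: c0; rewrite cosB sinB sc => c0.
  congr (_ + arg (_, _)).
    have -> : s / Num.sqrt 3 * cos psi + s / Num.sqrt 3 * sin psi =
      s / Num.sqrt 3 / cos (pi / 4) * (cos (pi / 4) * cos psi + cos (pi / 4) * sin psi).
      by field; rewrite !gt_eqF.
    by rewrite c0 mulr0 mul0r.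
  rewrite -mulrBr invf_div invrK.
  by field; rewrite !gt_eqF.
have t0 : th' 0 = pi / 4 by rewrite /th' arc0 // polar ?expr1n // mul1r.
have t1 : th' 1 = th by rewrite /th' arc1 // polar ?sqrrN ?expr1n // mulN1r.
by rewrite /= t0 t1 arc0 // arc1.
Qed.

Local Open Scope group_scope.

(** The two half circles on either side of the i-th boundary circle start at the angle pi / 4 of
    [pole 1] and reach [pole (-1)] at -3 pi / 4 along [arc i] and at 5 pi / 4 along [arc (i + 2)].
    The end lifts differ by one boundary turn, that is, by [- beta] turns of the core. *)
Lemma cross_gen i : cross (i + 2) * (cross i)^-1 = zexp (gen i) (- seifert_beta S i)%R.
Proof.
have [c2 sc] := @cos_piquarter R; have c4 := @cos_piquarter_gt0 R.
have arg01 : (arg (0, 1) = pi / 2 :> R)%R.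
  by rewrite /arg /= addr0 divr1 atan1; field.
have arg0N1 : (arg (0, -1) = - (pi / 2) :> R)%R.
  by rewrite /arg /= addr0 divr1 atanN atan1; field.
have q34 : (3 * pi / 4 = pi / 4 + pi / 2 :> R)%R by field.
have q2 : (pi / 4 - - (pi / 4) = pi / 2 :> R)%R by field.
have q2' : (pi / 4 - 3 * pi / 4 = - (pi / 2) :> R)%R by field.
rewrite (@cross_frame i i (- (pi / 4))%R (- (3 * pi / 4))%R); first last.
- by rewrite q2 cos_pihalf.
- by rewrite q2 sin_pihalf arg0N1; field.
- by rewrite q2 sin_pihalf arg01; field.
- move=> t; rewrite /arc !mkvE cosN sinN sc; have := arc_sin_ge0 t.
  by set a := (cos _ / _)%R; set b := (sin _ / _)%R; nra.
- by move=> t; have [] := arcP i t.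
rewrite (@cross_frame i (i + 2)%R (3 * pi / 4)%R (5 * pi / 4)%R); first last.
- by rewrite q2' cosN cos_pihalf.
- by rewrite q2' sinN sin_pihalf opprK arg01; field.
- by rewrite q2' sinN sin_pihalf arg0N1; field.
- move=> t; rewrite /arc mkv_rot !mkvE q34 cosDpihalf sinDpihalf sc.
  have := arc_sin_ge0 t.
  by set a := (cos (_ * _) / _)%R; set b := (sin (_ * _) / _)%R; nra.
- by move=> t; have [] := arcP (i + 2) t; rewrite ord3E.
have -> : angle_lift i (5 * pi / 4)%R 0%R =
    shift (- seifert_beta S i)%R (angle_lift i (- (3 * pi / 4))%R 0%R).
  have := @lift_shift i (- (3 * pi / 4))%R 0%R 1 0.
  rewrite mul0r addr0 mulr1 mulr0 addr0 mul1r => <-.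
  by congr (angle_lift i _ _); field.
by rewrite frame_shift mulgK.
Qed.

(** The product telescopes: each half circle borders two boundary circles and is crossed once in
    each direction. *)
Lemma gen_product : zexp (gen 0%R) (- seifert_beta S 0%R)%R
  * zexp (gen 1%R) (- seifert_beta S 1%R)%R
  * zexp (gen 2%R) (- seifert_beta S 2%R)%R = 1.
Proof.
have e1 : (1 + 2 = 0 :> 'I_3)%R by apply: val_inj.
have e2 : (2 + 2 = 1 :> 'I_3)%R by apply: val_inj.
by rewrite -!cross_gen e1 e2 add0r !mulgA mulgVK mulgVK mulgV.
Qed.

End Relations.

(** * A flat cocycle on the Seifert manifold *)

Section Branches.
Context {R : realType}.
Local Notation plane := (R * R)%type.
Local Notation space := 'rV[R]_3.
Local Notation eps := (10^-1 : R).

Lemma arg_pos (w : plane) : circle w -> 0 < w.2 -> 0 < arg w < pi.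
Proof.
case: w => a b; rewrite /circle /= => ab b0.
have a1 : 0 < 1 + a by nra.
rewrite /arg /=; have t0 : 0 < b / (1 + a) by rewrite divr_gt0.
have := lt_atan t0; rewrite atan0 => h.
by have h' := atan_ltpi2 (b / (1 + a)); apply/andP; split; lra.
Qed.

Lemma argN (w : plane) : -1 < w.1 -> arg (w.1, - w.2) = - arg w.
Proof. by move=> _; rewrite /arg /= mulNr atanN mulrN. Qed.

Lemma arg_opp (w : plane) : circle w -> 0 < w.2 -> arg (- w.1, - w.2) = arg w - pi.
Proof.
move=> cw w0; have /andP[a0 a1] := arg_pos cw w0.
have w1 : -1 < w.1 < 1 by move: cw; rewrite /circle /= => cw; apply/andP; split; nra.
case/andP: w1 => w1 w1'.
have cw' : circle (- w.1, w.2) by move: cw; rewrite /circle /= sqrrN.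
have /andP[a0' a1'] := arg_pos cw' w0.
have e : cis (arg (- w.1, - w.2)) = cis (arg w - pi).
  rewrite cis_arg; first last.
  - by rewrite /=; lra.
  - by move: cw; rewrite /circle /= !sqrrN.
  rewrite cisD cis_arg // /cis cosN sinN cospi sinpi /=.
  by congr (_, _); ring.
have [m] := cis_eq e; rewrite -[- w.2]/(- (- w.1, w.2).2) -[- w.1]/((- w.1, w.2).1).
rewrite argN /=; last by lra.
move=> h; have p0 := @pi_gt0 R.
have m0 : m = 0.
  have h1 : `|m%:~R : R| < 1.
    by rewrite ltr_norml; apply/andP; split; nra.
  by move: h1; rewrite -intr_norm ltrz1; lia.
by rewrite h m0 mul0r addr0.
Qed.

(** Two branches of the angle, discontinuous on the circle at (-1, 0) and at (1, 0) respectively;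
    every point is good for one of them. *)
Definition branch (b : bool) (w : plane) : R :=
  if b then arg w else pi + arg (- w.1, - w.2).

Definition cut_free (b : bool) (w : plane) : bool := if b then -1 < w.1 else w.1 < 1.

Lemma cis_branch b w : circle w -> cut_free b w -> cis (branch b w) = w.
Proof.
case: b => /= cw w1; first exact: cis_arg.
rewrite cisD cis_arg /=; first last.
- by lra.
- by move: cw; rewrite /circle /= !sqrrN.
by rewrite /cis cospi sinpi /=; case: w {cw w1} => a b /=; congr (_, _); ring.
Qed.

Lemma branch_cont b w : cut_free b w -> {for w, continuous (branch b)}.
Proof.
case: b => /= w1; first exact: arg_cont.
apply: (@at_add R _ (fun=> pi) (fun w : plane => arg (- w.1, - w.2))).
  exact: at_cst.
apply: (@continuous_comp _ _ _ (fun w : plane => (- w.1, - w.2)) (@arg R)).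
  have c1 : continuous (fun w : plane => - w.1) by move=> z; apply: cvgN; exact: cvg_fst.
  have c2 : continuous (fun w : plane => - w.2) by move=> z; apply: cvgN; exact: cvg_snd.
  exact: (continuous_tuple c1 c2).
by apply: arg_cont => /=; lra.
Qed.

Lemma cut_free_exists w : exists b, cut_free b w.
Proof. by have [h|h] := ltP (-1) w.1; [exists true|exists false => /=; lra]. Qed.

Lemma locally_constant_int (T : topologicalType) (f : T -> R) (n : T -> int) x :
  {for x, continuous f} -> (\forall z \near x, f z = (n z)%:~R * (pi *+ 2)) ->
  \forall z \near x, n z = n x.
Proof.
move=> cf fn; have fx := nbhs_singleton fn; have p0 := @pi_gt0 R.
have h1 : \forall z \near x, f x - pi < f z by apply: (cvgr_gt _ cf); lra.
have h2 : \forall z \near x, f z < f x + pi by apply: (cvgr_lt _ cf); lra.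
near=> z; have e1 : f x - pi < f z by near: z.
have e2 : f z < f x + pi by near: z.
have e3 : f z = (n z)%:~R * (pi *+ 2) by near: z.
apply/eqP; rewrite -subr_eq0.
have : `|(n z - n x)%:~R : R| < 1.
  rewrite intrB ltr_norml; move: e1 e2; rewrite e3 fx mulr2n => e1 e2.
  by apply/andP; split; nra.
by rewrite -intr_norm ltrz1; lia.
Unshelve. all: by end_near. Qed.

(** The other multiples of a third of a turn have cosine -1/2. Divisibility by 3 thus follows from
    an open condition, suited to continuity arguments. *)
Lemma cos_third n : 0 < cos (n%:~R * (pi *+ 2) / 3 : R) -> exists q : int, n = 3 * q.
Proof.
have p0 := @pi_gt0 R; move=> h; exists (n %/ 3)%Z.
have nE := divz_eq n 3; have r0 := modz_ge0 n (isT : (3 : int) != 0).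
have r3 := ltz_pmod n (isT : 0 < 3 :> int).
move: nE r0 r3 h; move: (n %% 3)%Z (n %/ 3)%Z => r q -> r0 r3.
have -> : ((q * 3 + r)%:~R * (pi *+ 2) / 3 = r%:~R * (pi *+ 2) / 3 + q%:~R * (pi *+ 2) :> R).
  by rewrite intrD intrM; field.
have [-> _] := cis2pi (r%:~R * (pi *+ 2) / 3 : R) q.
have : r = 0 \/ r = 1 \/ r = 2 by lia.
case=> [->|[->|->]]; first by move=> _; rewrite addr0 mulrC.
  rewrite (_ : _ / 3 = pi / 6 + pi / 2); last by rewrite mulr2n; field.
  rewrite cosDpihalf oppr_gt0 ltNge; case/negP; apply: sin_ge0_pi.
  by apply/andP; split; lra.
rewrite (_ : _ / 3 = pi / 3 + pi); last by rewrite mulr2n; field.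
rewrite cosDpi oppr_gt0 ltNge; case/negP; apply: cos_ge0_pihalf.
by apply/andP; split; lra.
Qed.

Lemma rotv_opp psi i (u : space) :
  rotv (psi + pi) i u = (- (rotv psi i u).1, - (rotv psi i u).2).
Proof. by rewrite /rotv cosDpi sinDpi /=; congr (_, _); ring. Qed.

(** The branches of the angle centered at [psi] and at [psi + pi] agree on one side of the line
    through these directions and differ by a full turn on the other, as in [ang_opp_neg]. That jump
    accounts for the monodromy around a boundary circle. *)
Lemma ang_opp_pos psi i (u : space) : pants u -> sector eps i u ->
  0 < (rotv psi i u).2 -> ang (psi + pi) i u = ang psi i u.
Proof.
move=> pu su h; rewrite /ang rotv_opp arg_opp //; last exact: rotv_circle.
by ring.
Qed.

Lemma ang_opp_neg psi i (u : space) : pants u -> sector eps i u ->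
  (rotv psi i u).2 < 0 -> ang (psi + pi) i u = ang psi i u + pi *+ 2.
Proof.
move=> pu su h; have cw := rotv_circle psi pu su.
have := @arg_opp (- (rotv psi i u).1, - (rotv psi i u).2); rewrite /= !opprK => e.
rewrite /ang rotv_opp [rotv psi i u]surjective_pairing e; first by rewrite mulr2n; ring.
  by move: cw; rewrite /circle /= !sqrrN.
by rewrite oppr_gt0.
Qed.

Lemma rotv_piquarter i (u : space) : rotv (pi / 4) i u =
  ((u 0 (i + 1) + u 0 (i + 2)) * (cos (pi / 4) / radius i u),
   (u 0 (i + 2) - u 0 (i + 1)) * (cos (pi / 4) / radius i u)).
Proof.
by have [_ sc] := @cos_piquarter R; rewrite /rotv sc; congr (_, _); ring.
Qed.

End Branches.

(** * Open sets carrying the cocycle *)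

Section Atlas.
Context {R : realType} {Y : topologicalType}.
Variable S : seifert_S2 R (fun=> 3%N) Y.
Local Notation plane := (R * R)%type.
Local Notation space := 'rV[R]_3.
Local Notation beta i := ((seifert_beta S i)%:~R : R).
Local Notation PC := (@pants R `*` @circle R).
Local Notation prod := (product_part S).
Local Notation solid := (solid S).
Local Notation over := (over S).
Local Notation pinv := (pinv S).
Local Notation eps := (10^-1 : R).

Definition weak i : set space :=
  [set u | u 0 i <= u 0 (i + 1)] `|` [set u | u 0 i <= u 0 (i + 2)].

(** Written as a complement of closed sets, which makes it open at once. Unlike the sets [chart],
    these neighbourhoods of the solid tori are pairwise disjoint. *)
Definition nbh i : set Y := ~` (solid (i + 1) `|` solid (i + 2) `|` over (weak i)).

Lemma nbh_open i : open (nbh i).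
Proof.
apply: closed_openC; apply: closedU; first by apply: closedU; exact: solid_closed.
by apply: over_closed; apply: closedU; apply: closed_le_fun; exact: row_cont.
Qed.

Lemma over_prod A u w : PC (u, w) -> over A (prod (u, w)) <-> A u.
Proof.
move=> pc; split=> [[[u' w'] [[/= pu' Au'] cw'] e]|Au].
  have h := @product_part_inj _ _ _ S (u', w') (u, w); rewrite !inE in h.
  by have [<- _] := h (conj pu' cw') pc e.
by exists (u, w) => //; case: pc.
Qed.

Lemma nbh_prod i u w : PC (u, w) ->
  nbh i (prod (u, w)) <-> u 0 (i + 1) < u 0 i /\ u 0 (i + 2) < u 0 i.
Proof.
move=> pc; split=> [h|[h1 h2]].
  by split; rewrite ltNge; apply/negP => k; apply: h; right; apply/(over_prod _ pc);
    [left|right].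
have u5 : u 0 i <= 4 / 5 by case: pc => -[].
move=> [[/(solid_prod S _ pc)|/(solid_prod S _ pc)]|/(over_prod _ pc)[]] /=; lra.
Qed.

Lemma solid_nbh i y : solid i y -> nbh i y.
Proof.
move=> [v dv vE].
have dis k : k != i -> ~ solid k y.
  move=> ki [v' dv' v'E]; move/eqP: ki; apply.
  by apply: (@seifert_disjoint _ _ _ S k i v' v) => //; rewrite vE.
move=> [[|]|[[u w] [[/= pu wu] cw] yE]].
- by apply: dis; rewrite ord3_neq.
- by apply: dis; rewrite ord3_neq.
have ui : u 0 i = 4 / 5.
  by apply/(solid_prod S i (conj pu cw)); rewrite yE; exists v.
by have := pants_sum i pu; case: wu => /=; rewrite ui; nra.
Qed.

Lemma nbh_cases i y : nbh i y -> solid i y \/ exists u w,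
  [/\ PC (u, w), y = prod (u, w), u 0 (i + 1) < u 0 i & u 0 (i + 2) < u 0 i].
Proof.
move=> ny; have : [set: Y] y by [].
rewrite -(seifert_cover S) => -[[[u w] pc yE]|[j _]].
  right; exists u, w; have := ny; rewrite -yE => /(nbh_prod _ pc)[? ?].
  by split.
case: (ord3P i j) => -> h; first by left.
  by case: ny; left; left.
by case: ny; left; right.
Qed.

Lemma nbh_sector i (u : space) : u 0 (i + 1) < u 0 i -> u 0 (i + 2) < u 0 i ->
  sector eps i u.
Proof. by move=> h1 h2 j; case: (ord3P i j) => ->; lra. Qed.

Lemma nbh_chart i y : nbh i y -> chart S eps i y.
Proof.
move=> /nbh_cases[h|[u [w [[pu cw] -> h1 h2]]]]; first by left.
by right; exists (u, w) => //; split=> //; split=> //; exact: nbh_sector.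
Qed.

Lemma nbh_disjoint i j y : nbh i y -> nbh j y -> i = j.
Proof.
move=> ni nj; case: (ord3P i j) => ji; rewrite ji // in nj *; exfalso.
- case: (nbh_cases ni) => [h|[u [w [pc yE h1 h2]]]]; last first.
    move: nj; rewrite yE => /(nbh_prod _ pc)[_].
    by rewrite ord3E; lra.
  apply: nj; left; right.
  by rewrite ord3E.
- case: (nbh_cases ni) => [h|[u [w [pc yE h1 h2]]]]; last first.
    by move: nj; rewrite yE => /(nbh_prod _ pc)[]; rewrite ord3E; lra.
  by apply: nj; left; left; rewrite ord3E.
Qed.

Definition core_coord i (y : Y) : plane := (tinv S i (defm S i 1 y)).2.

Lemma core_coord_circle i y : nbh i y -> circle (core_coord i y).
Proof.
move=> /nbh_chart/defm1_solid [v dv e].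
by rewrite /core_coord -e tinvK //; case: dv.
Qed.

Lemma within_at (T U : topologicalType) (A : set T) (f : T -> U) x :
  {within A, continuous f} -> nbhs x A -> {for x, continuous f}.
Proof.
move=> /subspace_continuousP cf nA W nW.
have := cf x (nbhs_singleton nA) _ nW => h.
have h' : \forall z \near x, A z -> W (f z) by [].
by apply: filterS2 h' nA => z hz /hz.
Qed.

Lemma core_coord_cont i y : nbh i y -> {for y, continuous (core_coord i)}.
Proof.
move=> ny.
have nc : nbhs y (chart S eps i).
  apply: filterS (open_nbhs_nbhs (conj (nbh_open i) ny)) => z; exact: nbh_chart.
apply: (within_at _ nc).
have c1 : {within chart S eps i, continuous (fun y => defm S i 1 y)}.
  apply: (defm_within (p := fun y => y) (s := fun=> 1)) => //.
  - by apply: continuous_subspaceT; exact: id_cont.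
  - by apply: continuous_subspaceT; exact: cst_cont.
  - by rewrite ler01 lexx.
have c2 := within_comp c1 (@tinv_within _ _ S i) (fun y => @defm1_solid _ _ S i y).
exact: (within_comp c2 (continuous_subspaceT (A := setT) (@snd_cont plane plane))).
Qed.

Lemma core_coord_polar i u th ph : pants u -> sector eps i u ->
  u 0 (i + 1) = radius i u * cos th -> u 0 (i + 2) = radius i u * sin th ->
  core_coord i (prod (u, cis ph)) = cis (- beta i * th + 3 * ph).
Proof.
move=> pu su e1 e2; rewrite /core_coord (@defm1_lift _ _ S i u th) //.
rewrite /torus_map tinvK //=; split; first exact: retract_disk.
exact: cis_circle.
Qed.

Definition circle_angle (w : plane) : R := xget 0 [set x | cis x = w].

Lemma cis_circle_angle w : circle w -> cis (circle_angle w) = w.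
Proof.
move=> /circle_cis[x xE].
exact: (@xgetI _ 0 [set x | cis x = w] x (esym xE)).
Qed.

(** A lift of the core coordinate over the product piece, from the inverse gluing matrix.
    [circle_angle] is an arbitrary choice; replacing it by another changes the result by a multiple
    of three turns. *)
Definition ref_angle psi i (y : Y) : R :=
  3 * circle_angle (pinv y).2 - beta i * ang psi i (pinv y).1.

Lemma core_coord_ref psi i u w : PC (u, w) -> nbh i (prod (u, w)) ->
  -1 < (rotv psi i u).1 ->
  cis (ref_angle psi i (prod (u, w))) = core_coord i (prod (u, w)).
Proof.
move=> pc /(nbh_prod _ pc)[h1 h2] h; have [pu cw] := pc.
have su := nbh_sector h1 h2; have [e1 e2] := ang_polar pu su h.
have cw' : circle w := cw.
rewrite /ref_angle pinvK //= -[in RHS](cis_circle_angle cw') (core_coord_polar _ pu su e1 e2).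
by congr cis; ring.
Qed.

(* cut 1 is the union of the three meridians joining (-1, -1, -1) to the
   boundary circles, cut (-1) the union of those starting from (1, 1, 1). *)
Definition cut (s : R) : set space := \bigcup_(i in [set: 'I_3])
  ([set u | u 0 (i + 1) = u 0 (i + 2)] `&` [set u | u 0 (i + 1) <= u 0 i]
    `&` [set u | s * u 0 (i + 1) <= 0]).

Lemma cut_closed s : closed (cut s).
Proof.
apply: closed_bigcup => [|i _]; first exact: finite_finset.
apply: closedI; first apply: closedI.
- by apply: closed_eq_fun; exact: row_cont.
- by apply: closed_le_fun; exact: row_cont.
- apply: closed_le_fun; last exact: cst_cont.
  by move=> u; exact: (at_mul (@at_cst R _ u s) (@row_cont R (i + 1) u)).
Qed.

Lemma cut_disjoint u : pants u -> cut 1 u -> cut (-1) u -> False.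
Proof.
move=> pu [i _ [[/= e1 l1] s1]] [j _ [[/= e2 l2] s2]].
have ui : u 0 i <= 4 / 5 by case: pu.
have := pants_sum i pu.
case: (ord3P i j) => jE; rewrite jE in e2 l2 s2.
- by nra.
- by move: e2 l2 s2; rewrite !ord3E; nra.
- by move: e2 l2 s2; rewrite !ord3E; nra.
Qed.

(** A branch of the angle breaks down only in the direction opposite to its center. For the centers
    pi / 4 and pi / 4 + pi these directions lie on the meridian u_(i+1) = u_(i+2), where the sign of
    these coordinates tells the two cuts apart. *)
Lemma rotv_free i u : pants u -> u 0 (i + 1) < u 0 i -> u 0 (i + 2) < u 0 i ->
  (~ cut 1 u -> -1 < (rotv (pi / 4) i u).1) /\
  (~ cut (-1) u -> -1 < (rotv (pi / 4 + pi) i u).1).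
Proof.
move=> pu h1 h2; have su := nbh_sector h1 h2.
have := rotv_circle (pi / 4) pu su; have r0 := radius_gt0 pu su.
have c0 := @cos_piquarter_gt0 R.
rewrite rotv_opp rotv_piquarter /circle /=.
have k0 : 0 < cos (pi / 4) / radius i u by rewrite divr_gt0.
move: (_ / _) k0 => k k0 cw.
have tie s : (u 0 (i + 1) + u 0 (i + 2)) * k * s <= -1 -> s ^+ 2 = 1 -> cut s u.
  move=> hs s1.
  have sq : ((u 0 (i + 1) + u 0 (i + 2)) * k) ^+ 2 = ((u 0 (i + 1) + u 0 (i + 2)) * k * s) ^+ 2.
    by rewrite [RHS]exprMn s1 mulr1.
  have z0 : ((u 0 (i + 2) - u 0 (i + 1)) * k) ^+ 2 = 0.
    by apply/eqP; rewrite eq_le sqr_ge0 andbT; rewrite sq in cw; nra.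
  have e : u 0 (i + 1) = u 0 (i + 2).
    move/eqP: z0; rewrite sqrf_eq0 mulf_eq0 (gt_eqF k0) orbF subr_eq0 => /eqP ->.
    by [].
  exists i => //; split; first by split=> //; exact: ltW.
  rewrite /=; move: hs; rewrite -e => hs.
  by nra.
split=> nc; rewrite ltNge; apply/negP => h; apply: nc; apply: tie; rewrite ?expr1n ?sqrrN ?expr1n //; lra.
Qed.

(** The part over the interior of the pants slit along a tripod joining the three boundary circles,
    which is an open disk: the base has no monodromy there. *)
Definition outer s : set Y :=
  ~` (solid 0 `|` solid (0 + 1) `|` solid (0 + 2) `|` over (cut s)).

Lemma outer_open s : open (outer s).
Proof.
apply: closed_openC; apply: closedU; last by apply: over_closed; exact: cut_closed.
by apply: closedU; [apply: closedU|]; exact: solid_closed.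
Qed.

Lemma outer_solid s y i : outer s y -> ~ solid i y.
Proof.
by move=> h si; apply: h; left; case: (ord3P 0 i) si => -> ?; [left; left|left; right|right].
Qed.

Lemma outer_cases s y : outer s y -> exists u w,
  [/\ PC (u, w), y = prod (u, w) & ~ cut s u].
Proof.
move=> oy; have : [set: Y] y by [].
rewrite -(seifert_cover S) => -[[[u w] pc yE]|[j _ sj]].
  exists u, w; split=> // cu; apply: oy; right; rewrite -yE.
  by apply/(over_prod _ pc).
by have := outer_solid oy sj.
Qed.

Lemma outer_intro s u w : PC (u, w) -> (forall i, ~ solid i (prod (u, w))) ->
  ~ cut s u -> outer s (prod (u, w)).
Proof.
move=> pc ns nc [[[|]|]|/(over_prod _ pc)]; [exact: ns|exact: ns|exact: ns|exact: nc].
Qed.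

Lemma pinv_cont s y : outer s y -> {for y, continuous pinv}.
Proof.
move=> oy; apply: (within_at (A := over setT)).
  by apply: pinv_within; exact: closedT.
apply: filterS (open_nbhs_nbhs (conj (outer_open s) oy)) => z /outer_cases.
by move=> [u [w [pc -> _]]]; apply/(over_prod _ pc).
Qed.

(** Off both tripods the smallest coordinate is unique, and its index labels the three strips
    between boundary circles. The value 0 at ties is a default. *)
Definition argmin3 (u : space) : 'I_3 :=
  xget 0 [set k | u 0 k < u 0 (k + 1) /\ u 0 k < u 0 (k + 2)].

Lemma argmin3E (u : space) (k : 'I_3) : u 0 k < u 0 (k + 1) -> u 0 k < u 0 (k + 2) -> argmin3 u = k.
Proof.
move=> h1 h2; rewrite /argmin3.
have [] := @xgetI _ 0 [set k | u 0 k < u 0 (k + 1) /\ u 0 k < u 0 (k + 2)] k (conj h1 h2).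
move: (xget _ _) => l; case: (ord3P k l) => -> //.
  by rewrite !ord3E => _ h3; exfalso; lra.
by rewrite !ord3E => h3; exfalso; lra.
Qed.

Lemma argmin3_exists (u : space) : ~ cut 1 u -> ~ cut (-1) u ->
  exists k : 'I_3, u 0 k < u 0 (k + 1) /\ u 0 k < u 0 (k + 2).
Proof.
move=> n1 n2.
have tie i : u 0 (i + 1) = u 0 (i + 2) -> u 0 (i + 1) <= u 0 i -> False.
  move=> e l; have [h|h] := leP (u 0 (i + 1)) 0.
    by apply: n1; exists i => //; split; [split|rewrite /=; lra].
  by apply: n2; exists i => //; split; [split|rewrite /=; lra].
have [k _ hk] := @arg_minP _ _ _ (0 : 'I_3) predT (fun i => u 0 i) isT.
exists k; split; rewrite lt_neqAle hk // andbT; apply/eqP => e.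
  by apply: (tie (k + 2)); rewrite !ord3E //; exact: hk.
by apply: (tie (k + 1)); rewrite !ord3E -?e //; exact: hk.
Qed.

End Atlas.

(** * The cocycle attached to three rotations of order 3 *)

Section OrbifoldCocycle.
Context {R : realType} {Y : topologicalType}.
Variable S : seifert_S2 R (fun=> 3%N) Y.
Local Notation space := 'rV[R]_3.
Local Notation beta i := ((seifert_beta S i)%:~R : R).
Local Notation PC := (@pants R `*` @circle R).
Local Notation prod := (product_part S).
Local Notation over := (over S).
Local Notation pinv := (pinv S).
Local Notation nbh := (nbh S).
Local Notation core_coord := (core_coord S).
Local Notation ref_angle := (ref_angle S).
Local Notation outer := (outer S).

Variables (Gam : groupType) (g : 'I_3 -> Gam) (e : 'I_3 -> int).

(** Monodromy around the i-th boundary circle: the transition between the two outer charts over the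
    strip where the k-th coordinate is smallest is given by [g k], and the strips for k = i + 1 and
    k = i + 2 border that circle. *)
Definition rotation i : Gam := ((g (i + 2))^-1 * g (i + 1)%R)%g.

Hypothesis rotation_cube : forall i, (rotation i ^+ 3 = 1)%g.
Hypothesis e_beta : forall i, exists q, e i * seifert_beta S i = 1 + 3 * q.

Definition psi (s : bool) : R := if s then pi / 4 else pi / 4 + pi.

(** A pointwise reference lift of the core coordinate, by a branch of the boundary angle that is
    valid at the point: over [cut 1] it is the one centered opposite to pi / 4. [base_shift] records
    the corresponding change of outer chart. *)
Definition base_angle i y : R :=
  if `[< over setT y >] then ref_angle (psi (~~ `[< over (cut 1) y >])) i y
  else circle_angle (core_coord i y).

Definition base_shift i y : Gam := if `[< over (cut 1) y >] then (g (i + 1)%R)^-1%g else 1%g.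

(** The turns from the reference angle to [s] count with weight [e i], since one turn of the core is
    to have monodromy [rotation i] to the power [e i]. *)
Definition coord i y (s : R) : Gam :=
  (zexp (rotation i) (e i * xget 0 [set m : int | s = base_angle i y + m%:~R * (pi *+ 2)])
    * base_shift i y)%g.

Lemma coordE i y s m : s = base_angle i y + m%:~R * (pi *+ 2) ->
  coord i y s = (zexp (rotation i) (e i * m) * base_shift i y)%g.
Proof.
move=> sE; rewrite /coord; congr (zexp _ (_ * _) * _)%g.
have := @xgetI _ 0 [set m : int | s = base_angle i y + m%:~R * (pi *+ 2)] m sE.
rewrite {1}sE /= => /addrI/mulIf h; apply/eqP; rewrite eq_sym -(eqr_int R); apply/eqP/h.
by have := @pi_gt0 R; rewrite mulrn_eq0 /= => /gt_eqF ->.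
Qed.

Lemma psi_free i s u : pants u -> u 0 (i + 1) < u 0 i -> u 0 (i + 2) < u 0 i ->
  ~ cut (if s then 1 else -1) u -> -1 < (rotv (psi s) i u).1.
Proof.
by move=> pu h1 h2; have [a b] := rotv_free pu h1 h2; case: s => h; [exact: a|exact: b].
Qed.

Lemma cis_base_angle i y : nbh i y -> cis (base_angle i y) = core_coord i y.
Proof.
move=> ny; rewrite /base_angle; case: asboolP => [[[u w] [[/= pu _] cw] yE]|_].
  have pc : PC (u, w) by [].
  have := ny; rewrite -yE => /(nbh_prod _ _ pc)[h1 h2].
  apply: core_coord_ref => //; first by rewrite yE.
  apply: psi_free => //; case: asboolP => /(over_prod _ _ pc) //= h.
  by move=> h'; exact: cut_disjoint h h'.
by rewrite cis_circle_angle //; exact: core_coord_circle.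
Qed.

Lemma coord_add i y s n : nbh i y -> cis s = core_coord i y ->
  coord i y (s + n%:~R * (pi *+ 2)) = (zexp (rotation i) (e i * n) * coord i y s)%g.
Proof.
move=> ny; rewrite -(cis_base_angle ny) => /cis_eq[m sE].
rewrite (coordE sE) (@coordE _ _ _ (m + n)) 1?mulrDr 1?addrC ?zexpD ?mulgA //.
by rewrite sE intrD; ring.
Qed.

Definition orbi_chart (j : 'I_3 * bool + bool) : set Y :=
  match j with
  | inl (i, b) => nbh i `&` [set y | cut_free b (core_coord i y)]
  | inr s => outer (if s then 1 else -1)
  end.

(** On the second outer chart the coordinate is written in the frame of the first; over [cut 1],
    where the first one is missing, the chart uses a frame of its own. Such jumps of the frame
    cancel in the ratios. *)
Definition orbi_coord (j : 'I_3 * bool + bool) (y : Y) : Gam :=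
  match j with
  | inl (i, b) => coord i y (branch b (core_coord i y))
  | inr s => if s || `[< over (cut 1) y >] then 1%g else g (argmin3 (pinv y).1)
  end.

Lemma orbi_chart_open j : open (orbi_chart j).
Proof.
case: j => [[i b]|s] /=; last exact: outer_open.
rewrite openE => y [ny cy].
have n1 : nbhs y (nbh i) by apply: open_nbhs_nbhs; split=> //; exact: nbh_open.
have cc : {for y, continuous (fun y => (core_coord i y).1)}.
  exact: (at_fst (core_coord_cont ny)).
have n2 : \forall z \near y, cut_free b (core_coord i z).
  by case: b cy => /= cy; [exact: (cvgr_gt _ cc)|exact: (cvgr_lt _ cc)].
by apply: filterS2 n1 n2.
Qed.

Lemma orbi_chart_cover y : exists j, orbi_chart j y.
Proof.
have [[i si]|ns] := pselect (exists i, solid S i y).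
  have [b bP] := cut_free_exists (core_coord i y).
  by exists (inl (i, b)); split=> //; exact: solid_nbh.
have : [set: Y] y by [].
rewrite -(seifert_cover S) => -[[[u w] pc yE]|[j _ sj]]; last by case: ns; exists j.
have ns' i : ~ solid S i (prod (u, w)) by rewrite yE => h; apply: ns; exists i.
have [h|h] := pselect (cut 1 u); rewrite -yE.
  exists (inr false); apply: outer_intro => // h'.
  by apply: cut_disjoint h h'; case: pc.
by exists (inr true); apply: outer_intro.
Qed.

Lemma rotation_period i m n : (exists q, m = n + 3 * q) ->
  zexp (rotation i) m = zexp (rotation i) n.
Proof. by move=> [q ->]; rewrite zexpD zexpM3 ?mulg1. Qed.

(** The integer [m] jumps with [circle_angle], but only by multiples of 3. To see this, [C] and [D]
    express the cosine and sine of m thirds of a turn through the fiber coordinates in place of the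
    fiber angle, which makes them continuous; then [cos_third] applies. *)
Lemma ref_locally_constant i b s y (m : Y -> int) :
  nbh i y -> cut_free b (core_coord i y) -> outer (if s then 1 else -1) y ->
  (\forall z \near y, branch b (core_coord i z) = ref_angle (psi s) i z
     + (m z)%:~R * (pi *+ 2)) ->
  \forall z \near y, zexp (rotation i) (e i * m z) = zexp (rotation i) (e i * m y).
Proof.
move=> ny cy oy nm.
have [u [w [pc yE ncu]]] := outer_cases oy.
have nyE := ny; rewrite yE in nyE; have [h1 h2] := (nbh_prod _ _ pc).1 nyE.
have [pu cw] := pc; have su := nbh_sector h1 h2.
have gt1 := psi_free pu h1 h2 ncu.
pose A z := (branch b (core_coord i z) + beta i * ang (psi s) i (pinv z).1) / 3.
have cpi := pinv_cont oy.
have cang : {for y, continuous (fun z => ang (psi s) i (pinv z).1)}.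
  by apply: (at_comp (at_fst cpi)); rewrite yE pinvK //; exact: ang_cont.
have cbr : {for y, continuous (fun z => branch b (core_coord i z))}.
  exact: (at_comp (core_coord_cont ny) (branch_cont cy)).
have cA : {for y, continuous A}.
  exact: (at_mul (at_add cbr (at_mul (@at_cst R _ y (beta i)) cang)) (@at_cst R _ y 3^-1)).
have ccos : {for y, continuous (fun z => cos (A z))}.
  by apply: (at_comp cA); exact: continuous_cos.
have csin : {for y, continuous (fun z => sin (A z))}.
  by apply: (at_comp cA); exact: continuous_sin.
have cw1 := at_fst (at_snd cpi); have cw2 := at_snd (at_snd cpi).
pose C z := cos (A z) * (pinv z).2.1 + sin (A z) * (pinv z).2.2.
pose D z := sin (A z) * (pinv z).2.1 - cos (A z) * (pinv z).2.2.
have cC : {for y, continuous C} by exact: (at_add (at_mul ccos cw1) (at_mul csin cw2)).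
have cD : {for y, continuous D} by exact: (at_sub (at_mul csin cw1) (at_mul ccos cw2)).
have cCD : {for y, continuous (fun z => C z * C y + D z * D y)}.
  exact: (at_add (at_mul cC (@at_cst R _ y (C y))) (at_mul cD (@at_cst R _ y (D y)))).
pose good z := branch b (core_coord i z) = ref_angle (psi s) i z + (m z)%:~R * (pi *+ 2)
  /\ circle (pinv z).2.
have goodE z : good z -> C z = cos ((m z)%:~R * (pi *+ 2) / 3)
    /\ D z = sin ((m z)%:~R * (pi *+ 2) / 3).
  move=> [bE cz].
  have -> : (m z)%:~R * (pi *+ 2) / 3 = A z - circle_angle (pinv z).2.
    by rewrite /A bE /ref_angle; field.
  have cE := cis_circle_angle cz.
  have c1 : cos (circle_angle (pinv z).2) = (pinv z).2.1 := congr1 fst cE.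
  have c2 : sin (circle_angle (pinv z).2) = (pinv z).2.2 := congr1 snd cE.
  by rewrite cosB sinB c1 c2.
have ngood : \forall z \near y, good z.
  have no := open_nbhs_nbhs (conj (outer_open S _) oy).
  apply: filterS2 nm no => z hz /outer_cases[u' [w' [pc' zE _]]]; split=> //.
  by rewrite zE pinvK //; case: pc'.
have [gC gD] := goodE y (nbhs_singleton ngood).
have E0 : 0 < C y * C y + D y * D y by rewrite gC gD -!expr2 cos2Dsin2.
have nE : \forall z \near y, 0 < C z * C y + D z * D y by exact: (cvgr_gt _ cCD).
near=> z.
have gz : good z by near: z.
have [zC zD] := goodE z gz.
have : 0 < C z * C y + D z * D y by near: z.
rewrite zC zD gC gD -cosB -mulrBl -mulrBl -intrB => /cos_third[q qE].
by apply: rotation_period; exists (e i * q); rewrite mulrCA -qE; ring.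
Unshelve. all: by end_near. Qed.

(** Off [cut 1], in the second outer chart, crossing the meridian moves the smallest coordinate from
    index i + 1 to i + 2 and shifts the angle by a full turn. The turn changes the core angle by
    [beta] turns, hence contributes one factor [rotation i] as [e i * beta] is 1 modulo 3, and this
    is just the ratio of the two values of [g]. *)
Lemma orbi_coord_outer i b s z : orbi_chart (inl (i, b)) z -> orbi_chart (inr s) z ->
  forall m, branch b (core_coord i z) = ref_angle (psi s) i z + m%:~R * (pi *+ 2) ->
  (orbi_coord (inl (i, b)) z * (orbi_coord (inr s) z)^-1 =
   zexp (rotation i) (e i * m) * (if s then 1 else (g (i + 1)%R)^-1))%g.
Proof.
move=> [/= nz cz] oz m mE.
have [u [w [pc zE ncu]]] := outer_cases oz; have [pu cw] := pc.
have nzE := nz; rewrite zE in nzE; have [h1 h2] := (nbh_prod _ _ pc).1 nzE.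
have oT : over setT z by rewrite zE; apply/(over_prod _ _ pc).
have bE : base_angle i z = ref_angle (psi (~~ `[< over (cut 1) z >])) i z.
  by rewrite /base_angle ifT //; apply/asboolP.
have cutE : over (cut 1) z <-> cut 1 u by rewrite zE; exact: over_prod.
move: bE; rewrite /base_shift; case: asboolP => [/cutE cu|/cutE ncu1] bE.
  case: s oz mE ncu => //= oz mE ncu.
  rewrite (coordE (m := m)); last by rewrite bE.
  by rewrite /base_shift; case: asboolP => [_|/cutE//]; rewrite invg1 mulg1.
case: s oz mE ncu => /= oz mE ncu.
  rewrite (coordE (m := m)); last by rewrite bE.
  by rewrite /base_shift; case: asboolP => [/cutE//|_]; rewrite invg1 !mulg1.
have su := nbh_sector h1 h2.
have zu : (pinv z).1 = u by rewrite zE pinvK.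
have r0 := radius_gt0 pu su; have k0 := @cos_piquarter_gt0 R.
have kr : 0 < cos (pi / 4) / radius i u by rewrite divr_gt0.
have rE := rotv_piquarter i u.
have [lt|gt|eq] := ltgtP (u 0 (i + 1)) (u 0 (i + 2)).
- have pos : 0 < (rotv (pi / 4) i u).2 by rewrite rE /= mulr_gt0 // subr_gt0.
  rewrite (coordE (m := m)); last first.
    by rewrite bE mE /ref_angle zu /= ang_opp_pos.
  rewrite /base_shift; case: asboolP => [/cutE//|_]; rewrite mulg1 zu.
  by rewrite (@argmin3E _ u (i + 1)) // ord3E.
- have neg : (rotv (pi / 4) i u).2 < 0 by rewrite rE /= pmulr_llt0 // subr_lt0.
  rewrite (coordE (m := m - seifert_beta S i)); last first.
    by rewrite bE mE /ref_angle zu /= ang_opp_neg // intrB; ring.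
  rewrite /base_shift; case: asboolP => [/cutE//|_]; rewrite mulg1 zu.
  rewrite (@argmin3E _ u (i + 2)) ?ord3E //.
  have -> : zexp (rotation i) (e i * m)
      = (zexp (rotation i) (e i * (m - seifert_beta S i)) * rotation i)%g.
    rewrite -zexpS; apply: rotation_period; have [q qE] := e_beta i.
    by exists q; rewrite mulrBr qE; ring.
  by rewrite -mulgA /rotation mulgK.
- exfalso; case: (@argmin3_exists _ u) => // k [k1 k2].
  have := h1; have := h2; case: (ord3P i k) => kE; rewrite kE ?ord3E in k1 k2; lra.
Qed.

Lemma orbi_cocycle j k y : orbi_chart j y -> orbi_chart k y ->
  \forall z \near y, (orbi_coord j z * (orbi_coord k z)^-1
                      = orbi_coord j y * (orbi_coord k y)^-1)%g.
Proof.
have nO l : orbi_chart l y -> nbhs y (orbi_chart l).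
  by move=> ly; apply: open_nbhs_nbhs; split=> //; exact: orbi_chart_open.
have mixed i b s : orbi_chart (inl (i, b)) y -> orbi_chart (inr s) y ->
    \forall z \near y,
      (orbi_coord (inl (i, b)) z * (orbi_coord (inr s) z)^-1
       = orbi_coord (inl (i, b)) y * (orbi_coord (inr s) y)^-1)%g.
  move=> jy ky.
  pose m z := xget 0 [set m : int |
    branch b (core_coord i z) = ref_angle (psi s) i z + m%:~R * (pi *+ 2)].
  have mP z : orbi_chart (inl (i, b)) z -> orbi_chart (inr s) z ->
      branch b (core_coord i z) = ref_angle (psi s) i z + (m z)%:~R * (pi *+ 2).
    move=> [/= nz cz] oz; have [u [w [pc zE ncu]]] := outer_cases oz; have [pu cw] := pc.
    have nzE := nz; rewrite zE in nzE; have [h1 h2] := (nbh_prod _ _ pc).1 nzE.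
    have : cis (branch b (core_coord i z)) = cis (ref_angle (psi s) i z).
      rewrite cis_branch //; last exact: core_coord_circle.
      by rewrite zE core_coord_ref // -?zE //; exact: psi_free.
    move=> /cis_eq[n nE].
    exact: (@xgetI _ 0 [set m : int | branch b (core_coord i z)
      = ref_angle (psi s) i z + m%:~R * (pi *+ 2)] n nE).
  have nm : \forall z \near y, branch b (core_coord i z)
      = ref_angle (psi s) i z + (m z)%:~R * (pi *+ 2).
    by apply: filterS2 (nO _ jy) (nO _ ky) => z; exact: mP.
  have [ny cy] := jy.
  have lc := ref_locally_constant ny cy ky nm.
  near=> z.
  have zj : orbi_chart (inl (i, b)) z by near: z; exact: nO.
  have zk : orbi_chart (inr s) z by near: z; exact: nO.
  rewrite (orbi_coord_outer zj zk (mP z zj zk)) (orbi_coord_outer jy ky (mP y jy ky)).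
  by congr (_ * _)%g; near: z.
have poles : orbi_chart (inr true) y -> orbi_chart (inr false) y ->
    \forall z \near y,
      (orbi_coord (inr true) z * (orbi_coord (inr false) z)^-1
       = orbi_coord (inr true) y * (orbi_coord (inr false) y)^-1)%g.
  move=> jy ky.
  have [u [w [pc yE ncu]]] := outer_cases jy; have [u' [w' [pc' yE' ncu']]] := outer_cases ky.
  have pE := pinvK S pc; have pE' := pinvK S pc'; rewrite -yE in pE; rewrite -yE' pE in pE'.
  case: pE' => uu _; rewrite -uu in ncu'.
  have [l [l1 l2]] := argmin3_exists ncu ncu'.
  have cpi := pinv_cont jy.
  have cj (h : 'I_3) : {for y, continuous (fun z => (pinv z).1 0 h)}.
    by apply: (at_comp (g := fun u : space => u 0 h) (at_fst cpi)); exact: row_cont.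
  have lt h : u 0 l < u 0 h -> \forall z \near y, (pinv z).1 0 l < (pinv z).1 0 h.
    move=> lh; have cd := at_sub (cj h) (cj l).
    have : \forall z \near y, 0 < (pinv z).1 0 h - (pinv z).1 0 l.
      by apply: (cvgr_gt _ cd); rewrite pE /= subr_gt0.
    by apply: filterS => z; rewrite subr_gt0.
  have lE z : orbi_chart (inr true) z -> (pinv z).1 0 l < (pinv z).1 0 (l + 1) ->
      (pinv z).1 0 l < (pinv z).1 0 (l + 2) -> orbi_coord (inr false) z = g l.
    move=> /outer_cases[v [w0 [pcv zE ncv]]] h1 h2 /=.
    case: asboolP => [|_]; last by rewrite (argmin3E h1 h2).
    by rewrite zE => /(over_prod _ _ pcv).
  near=> z; rewrite (lE z) ?(lE y) //; first by rewrite pE.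
  - by rewrite pE.
  - by near: z; exact: (nO (inr true)).
  - by near: z; exact: lt.
  - by near: z; exact: lt.
move: j k => [[i b]|s] [[i' b']|s'] jy ky.
- have ii : i = i' by case: jy => ni _; case: ky => ni' _; exact: nbh_disjoint ni ni'.
  move: ky; rewrite -{i'}ii => ky.
  pose f z := branch b (core_coord i z) - branch b' (core_coord i z).
  pose n z := xget 0 [set m : int | f z = m%:~R * (pi *+ 2)].
  have nP z : orbi_chart (inl (i, b)) z -> orbi_chart (inl (i, b')) z ->
      f z = (n z)%:~R * (pi *+ 2).
    move=> [nz bz] [_ bz'].
    have : cis (branch b (core_coord i z)) = cis (branch b' (core_coord i z)).
      by rewrite !cis_branch //; exact: core_coord_circle.
    move=> /cis_eq[q qE]; apply: (@xgetI _ 0 [set m : int | f z = m%:~R * (pi *+ 2)] q).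
    by rewrite /= /f qE; ring.
  have [ny cy] := jy; have [_ cy'] := ky.
  have cf : {for y, continuous f}.
    have cW := core_coord_cont ny.
    exact: (at_sub (at_comp cW (branch_cont cy)) (at_comp cW (branch_cont cy'))).
  have nf : \forall z \near y, f z = (n z)%:~R * (pi *+ 2).
    by apply: filterS2 (nO _ jy) (nO _ ky) => z; exact: nP.
  have nn := locally_constant_int cf nf.
  have E z : orbi_chart (inl (i, b)) z -> orbi_chart (inl (i, b')) z ->
      (orbi_coord (inl (i, b)) z * (orbi_coord (inl (i, b')) z)^-1
       = zexp (rotation i) (e i * n z))%g.
    move=> jz kz; have [nz bz] := jz; have [_ bz'] := kz; rewrite /=.
    have -> : branch b (core_coord i z)
        = branch b' (core_coord i z) + (n z)%:~R * (pi *+ 2) by rewrite -nP // /f; ring.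
    rewrite coord_add ?mulgK //; rewrite cis_branch //; exact: core_coord_circle.
  near=> z; rewrite !E //; last 2 first.
  + by near: z; exact: nO.
  + by near: z; exact: nO.
  by congr (zexp _ (_ * _)); near: z.
- exact: mixed.
- have := mixed _ _ _ ky jy; apply: filterS => z h.
  by apply: invg_inj; rewrite !invgM !invgK.
- have [<-|] := eqVneq s s'; first by near=> z; rewrite !mulgV.
  case: s s' jy ky => -[] // jy ky _; first exact: poles.
  have := poles ky jy; apply: filterS => z h.
  by apply: invg_inj; rewrite !invgM !invgK.
Unshelve. all: by end_near. Qed.

End OrbifoldCocycle.

(** * Values of the holonomy on the generators *)

Section OrbifoldHolonomy.
Context {R : realType} {Y : topologicalType}.
Variable S : seifert_S2 R (fun=> 3%N) Y.
Local Notation plane := (R * R)%type.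
Local Notation space := 'rV[R]_3.
Local Notation PC := (@pants R `*` @circle R).
Local Notation prod := (product_part S).
Local Notation eps := (10^-1 : R).
Local Notation hub := (hub S).
Local Notation lhub := (lhub S).
Local Notation defm := (defm S).
Local Notation tmap := (torus_map S).

Variables (Gam : groupType) (g : 'I_3 -> Gam) (e : 'I_3 -> int).
Local Notation rotation := (rotation g).
Local Notation coord := (coord S g e).
Local Notation orbi_chart := (orbi_chart S).
Local Notation orbi_coord := (orbi_coord S g e).
Hypothesis rotation_cube : forall i, (rotation i ^+ 3 = 1)%g.
Hypothesis e_beta : forall i, exists q, e i * seifert_beta S i = 1 + 3 * q.

(** The way of the hub under the deformation. It avoids [cut 1] and, before its endpoint, all solid
    tori, so it stays in a single outer chart until then; this is why the track of the hub has
    trivial transport. *)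
Let spoke i (s : R) : space := push i (pole 1) s.

Let spokeP i s : 0 <= s <= 1 ->
  [/\ pants (spoke i s), sector eps i (spoke i s),
      spoke i s 0 (i + 1) = radius i (spoke i s) * cos (pi / 4),
      spoke i s 0 (i + 2) = radius i (spoke i s) * sin (pi / 4) &
      [/\ 0 < spoke i s 0 i, 0 < spoke i s 0 (i + 1), spoke i s 0 (i + 1) < 4 / 5
        & s < 1 -> spoke i s 0 i < 4 / 5]].
Proof.
move=> /andP[s0 s1]; have p1 : pants (pole 1 : space) by apply: pole_pants; rewrite expr1n.
have ps : sector eps i (pole 1 : space) by apply: pole_sector; lra.
have pp : pants (spoke i s) by apply: push_pants => //; apply/andP.
have [e1 e2] := @pole_polar R i; have r0 := radius_gt0 p1 ps.
have c0 := @cos_piquarter_gt0 R; have [c2 sc] := @cos_piquarter R.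
have q3 : 0 < (Num.sqrt 3)^-1 :> R by rewrite invr_gt0 sqrt3_gt0.
have q32 : (Num.sqrt 3)^-1 ^+ 2 = 3^-1 :> R by rewrite exprVn sqrt3_sqr.
set h := (1 - s) * pole 1 0 i + s * (4 / 5).
have ui : spoke i s 0 i = h by rewrite /spoke /push mkvE.
have h0 : 0 < h by rewrite /h (poleE 1 i) mkvE mul1r; nra.
have hi : s < 1 -> h < 4 / 5 by move=> s1'; rewrite /h (poleE 1 i) mkvE mul1r; nra.
have rs : radius i (spoke i s) = Num.sqrt (1 - h ^+ 2) by rewrite /radius ui.
have u1 : spoke i s 0 (i + 1) = radius i (spoke i s) * cos (pi / 4).
  by rewrite rs /spoke /push mkvE -/h e1; field; rewrite gt_eqF.
have u2 : spoke i s 0 (i + 2) = radius i (spoke i s) * sin (pi / 4).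
  by rewrite rs /spoke /push mkvE -/h e2; field; rewrite gt_eqF.
have h1 : h <= 4 / 5 by rewrite -ui; case: pp.
have rp : 0 < radius i (spoke i s) by rewrite rs sqrtr_gt0; nra.
have rp1 : radius i (spoke i s) ^+ 2 <= 1 by rewrite rs sqr_sqrtr; nra.
have u1p : 0 < spoke i s 0 (i + 1) by rewrite u1 mulr_gt0.
have u1s : 2 * spoke i s 0 (i + 1) ^+ 2 <= 1.
  by rewrite u1 exprMn mulrCA c2 mulr1.
split=> //; last by rewrite ui; split=> //; nra.
move=> j; case: (ord3P i j) => -> //; first by lra.
  have h3 : 3^-1 <= h ^+ 2.
    by rewrite -q32 ler_sqr ?nnegrE ?(ltW q3) ?(ltW h0) // /h (poleE 1 i) mkvE mul1r; nra.
  have := pants_sum i pp; rewrite u2 sc -u1 ui => sm.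
  by nra.
have h3 : 3^-1 <= h ^+ 2.
  by rewrite -q32 ler_sqr ?nnegrE ?(ltW q3) ?(ltW h0) // /h (poleE 1 i) mkvE mul1r; nra.
have := pants_sum i pp; rewrite u2 sc -u1 ui => sm.
by nra.
Qed.

Let spoke_cut i s : 0 <= s <= 1 -> ~ cut 1 (spoke i s).
Proof.
move=> s01; have [pp _ u1 u2 [a b _ _]] := spokeP i s01.
have [_ sc] := @cos_piquarter R.
have b2 : 0 < spoke i s 0 (i + 2) by rewrite u2 sc -u1.
by move=> [j _ [_ /=]]; case: (ord3P i j) => ->; rewrite ?ord3E; lra.
Qed.

Let spoke_solid i s j : 0 <= s <= 1 -> s < 1 -> ~ solid S j (prod (spoke i s, cis 0)).
Proof.
move=> s01 s1; have [pp _ u1 u2 [a b b' /(_ s1) a']] := spokeP i s01.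
have [_ sc] := @cos_piquarter R.
have pc : PC (spoke i s, cis 0) by split=> //; exact: cis_circle.
have b2 : spoke i s 0 (i + 2) < 4 / 5 by rewrite u2 sc -u1.
by move/(solid_prod S _ pc); case: (ord3P i j) => ->; lra.
Qed.

Let spoke_coord i s : 0 <= s <= 1 ->
  coord i (prod (spoke i s, cis 0)) = coord i (prod (spoke i 1, cis 0)).
Proof.
move=> s01; have t01 : 0 <= (1 : R) <= 1 by rewrite ler01 lexx.
have E t : 0 <= t <= 1 ->
    base_angle S i (prod (spoke i t, cis 0)) =
      3 * circle_angle (cis 0) - (seifert_beta S i)%:~R * (pi / 4)
    /\ base_shift S g i (prod (spoke i t, cis 0)) = 1%g.
  move=> t01'; have [pp su u1 u2 _] := spokeP i t01'.
  have pc : PC (spoke i t, cis 0) by split=> //; exact: cis_circle.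
  rewrite /base_angle /base_shift.
  have ncu : ~ over S (cut 1) (prod (spoke i t, cis 0)).
    by move/(over_prod _ _ pc); exact: spoke_cut.
  case: asboolP => [_|[]]; last exact/(over_prod _ _ pc).
  case: asboolP => [/ncu//|_]; split=> //.
  rewrite /ref_angle pinvK //=; congr (_ - _ * _).
  rewrite /ang /rotv u1 u2; have [c2 sc] := @cos_piquarter R.
  have r0 := radius_gt0 pp su.
  rewrite (_ : arg _ = 0) ?addr0 // -arg1; congr arg; congr (_, _); rewrite sc.
    apply: (mulIf (lt0r_neq0 r0)); rewrite divfK ?gt_eqF //.
    by rewrite mul1r -[RHS]mulr1 -[X in _ = _ * X]c2; ring.
  by rewrite mulrAC subrr mul0r.
have [a1 b1] := E s s01; have [a2 b2] := E 1 t01.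
by apply/funext => x; rewrite /coord a1 b1 a2 b2.
Qed.

Let spoke_core i s : 0 <= s <= 1 ->
  core_coord S i (prod (spoke i s, cis 0)) = core_coord S i (prod (spoke i 1, cis 0)).
Proof.
move=> s01; have t01 : 0 <= (1 : R) <= 1 by rewrite ler01 lexx.
have [pp su u1 u2 _] := spokeP i s01; have [pp' su' u1' u2' _] := spokeP i t01.
by rewrite (core_coord_polar S 0 pp su u1 u2) (core_coord_polar S 0 pp' su' u1' u2').
Qed.

Let spokeE i s : defm i s hub = prod (spoke i s, cis 0).
Proof.
rewrite /hub defm_prod //; last by apply: pole_sector; lra.
by split; [apply: pole_pants; rewrite expr1n|exact: cis_circle].
Qed.

Let transport_track i :
  transport orbi_chart orbi_coord (fun s => defm i (clamp s) hub) 0 1 1%g.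
Proof.
exists (fun=> 1%g); last by rewrite invg1 mulg1.
move=> x /andP[x0 x1]; have [lt|ge] := ltP x 1.
  exists (inr true); rewrite /= spokeE; split; last by near=> z.
  have c01 := clamp_itv x; have cE : clamp x = x by apply: clamp_id; rewrite x0.
  apply: outer_intro; last exact: spoke_cut.
    by have [? _ _ _ _] := spokeP i c01; split=> //; exact: cis_circle.
  by move=> j; apply: spoke_solid => //; rewrite cE.
have x1' : x = 1 by apply/eqP; rewrite eq_le x1.
have t01 : 0 <= (1 : R) <= 1 by rewrite ler01 lexx.
have [b bP] := cut_free_exists (core_coord S i (prod (spoke i 1, cis 0))).
exists (inl (i, b)); rewrite x1' spokeE clamp_ge1 //; split.
  split=> //=; apply: solid_nbh; rewrite -spokeE; apply: defm1_solid.
  exact: hub_chart.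
near=> z => /andP[z0 z1]; rewrite spokeE /=.
by rewrite spoke_coord ?spoke_core ?clamp_itv.
Unshelve. all: by end_near. Qed.

Let wind i (t : R) : plane * R := ((lhub i).1, (lhub i).2 + t * (pi *+ 2)).

Let wind_cont i : continuous (wind i).
Proof.
apply: continuous_tuple; first exact: cst_cont.
move=> t; apply: cvgD; first exact: cvg_cst.
by apply: cvgM; [exact: cvg_id|exact: cvg_cst].
Qed.

Let wind_solid i t : solid S i (tmap i (wind i t)).
Proof.
exists (retract (wind i t).1, cis (wind i t).2) => //.
by split; [exact: retract_disk|exact: cis_circle].
Qed.

Let wind_core i t : core_coord S i (tmap i (wind i t)) = cis (wind i t).2.
Proof.
rewrite /core_coord defm_solid; last exact: wind_solid.
by rewrite /torus_map tinvK //; split; [exact: retract_disk|exact: cis_circle].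
Qed.

(** The inverse of [coord] at the unrolled core angle is a flat section. After one turn that angle
    has grown by two pi, and [coord_add] converts the growth into the power of the rotation. *)
Let transport_core i : transport orbi_chart orbi_coord
  (fun t => tmap i (wind i t)) 0 1 (zexp (rotation i) (e i)).
Proof.
exists (fun t => (coord i (tmap i (wind i t)) (wind i t).2)^-1%g).
  move=> x _; have [b bP] := cut_free_exists (core_coord S i (tmap i (wind i x))).
  exists (inl (i, b)); split; first by split=> //; exact/solid_nbh/wind_solid.
  have cW : continuous (fun t => cis (wind i t).2).
    exact: (continuous_compose (@cis_cont R) (continuous_compose (@snd_cont _ _) (@wind_cont i))).
  pose f z := branch b (cis (wind i z).2) - (wind i z).2.
  pose n z := xget 0 [set m : int | f z = m%:~R * (pi *+ 2)].
  have nb : \forall z \near x, cut_free b (cis (wind i z).2).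
    move: bP; rewrite wind_core; have c1 : {for x, continuous (fun z => (cis (wind i z).2).1)}.
      exact: (at_fst (@cW x)).
    by case: (b) => /= bP; [exact: (cvgr_gt _ c1)|exact: (cvgr_lt _ c1)].
  have nP z : cut_free b (cis (wind i z).2) -> f z = (n z)%:~R * (pi *+ 2).
    move=> /(cis_branch (cis_circle _)) /cis_eq[q qE].
    apply: (@xgetI _ 0 [set m : int | f z = m%:~R * (pi *+ 2)] q).
    by rewrite /= /f qE; ring.
  have bP' : cut_free b (cis (wind i x).2) by rewrite -wind_core.
  have cf : {for x, continuous f}.
    apply: at_sub; first exact: (at_comp (@cW x) (branch_cont bP')).
    exact: (at_snd (@wind_cont i x)).
  have nf : \forall z \near x, f z = (n z)%:~R * (pi *+ 2).
    by apply: filterS nb => z; exact: nP.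
  have nn := locally_constant_int cf nf.
  have E z : cut_free b (cis (wind i z).2) ->
      (orbi_coord (inl (i, b)) (tmap i (wind i z)) *
        (coord i (tmap i (wind i z)) (wind i z).2)^-1 = zexp (rotation i) (e i * n z))%g.
    move=> /nP fz /=; rewrite wind_core.
    have -> : branch b (cis (wind i z).2) = (wind i z).2 + (n z)%:~R * (pi *+ 2).
      by rewrite -fz /f; ring.
    by rewrite coord_add ?mulgK ?wind_core //; exact/solid_nbh/wind_solid.
  near=> z => _; rewrite (E z) ?(E x) //; last by near: z.
  by congr (zexp _ (_ * _)); near: z.
have w1 : tmap i (wind i 1) = tmap i (wind i 0).
  rewrite -(torus_map_shift S i 1 (wind i 0)).
  by congr (tmap i _); rewrite /wind /shift /= mul0r addr0.
have w0 : tmap i (wind i 0) = prod (spoke i 1, cis 0).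
  have -> : wind i 0 = lhub i by rewrite /wind mul0r addr0.
  by rewrite hub_lift spokeE.
have t01 : 0 <= (1 : R) <= 1 by rewrite ler01 lexx.
rewrite w1 (_ : (wind i 1).2 = (wind i 0).2 + 1%:~R * (pi *+ 2)); last first.
  by rewrite /= mul1r mul0r addr0.
rewrite coord_add ?wind_core //; last exact/solid_nbh/wind_solid.
rewrite invgK mulr1 /coord.
have -> : base_shift S g i (tmap i (wind i 0)) = 1%g.
  rewrite w0 /base_shift; case: asboolP => // /(over_prod _ _ _) h.
  case: (@spoke_cut i _ t01); apply: h; have [? _ _ _ _] := spokeP i t01.
  by split=> //; exact: cis_circle.
rewrite mulg1; set m := (_ * _ : int).
by rewrite -zexpN -!zexpD; congr (zexp _ _); ring.
Unshelve. all: by end_near. Qed.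

Local Open Scope group_scope.

(** The corrections [nu] at the inner ends of the tracks cancel, and what remains is the one at the
    hub. The conjugation is thus the same for all [i], so that distinct centers stay distinct. *)
Lemma orbifold_hom (y0 : Y) : exists2 F : pi1 R y0 -> Gam, {morph F : x y / x * y} &
  forall base, exists v, forall i,
    F (gen S base i) = v * zexp (rotation i) (e i) * v^-1.
Proof.
have [F FM FP] := @flat_hom R Y _ Gam orbi_chart orbi_coord (@orbi_chart_open _ _ S)
  (@orbi_chart_cover _ _ S) (@orbi_cocycle _ _ S Gam g e rotation_cube e_beta) y0.
exists F => // base; have [nu nuP] := FP base; exists (nu hub) => i.
have F1 : F 1 = 1 by apply: (mulgI (F 1)); rewrite -FM !mulg1.
have FV (x : pi1 R y0) : F x^-1 = (F x)^-1.
  by apply: (mulgI (F x)); rewrite -FM !mulgV F1.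
have Ft : F (track S base i hub) = nu hub * (nu (defm i 1%R hub))^-1.
  rewrite /track (nuP _ _ _ _ _ ler01 (transport_track i)).
    by rewrite clamp_le0 // clamp_ge1 // defm0 ?mulg1 //; exact: hub_chart.
  apply: (defm_cont (p := fun=> hub)); [exact: cst_cont|exact: clamp_cont| |exact: clamp_itv].
  by move=> _; exact: hub_chart.
have Fc : F (core S base i (lhub i)) =
    nu (defm i 1%R hub) * zexp (rotation i) (e i) * (nu (defm i 1%R hub))^-1.
  have ct := @torus_map_cont _ _ S i.
  have -> : core S base i (lhub i) = hol base (fun t => tmap i (wind i t)) 0%R 1%R.
    rewrite (hol_comp base (0%R : R) (1%R : R) ct (@wind_cont i)) /core /wind /shift.
    by rewrite mul0r addr0 mul1r -surjective_pairing.
  rewrite (nuP _ _ _ _ (continuous_compose ct (@wind_cont i)) ler01 (transport_core i)).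
  have w0 : wind i 0%R = lhub i by rewrite /wind mul0r addr0 -surjective_pairing.
  have w1 : wind i 1%R = shift 1 (lhub i) by rewrite /wind /shift mul1r.
  by rewrite w0 w1 torus_map_shift hub_lift.
by rewrite /gen !FM FV Ft Fc invgM invgK !mulgA !mulgVK.
Qed.

End OrbifoldHolonomy.

(** * Unit quaternions *)

Section Quaternions.
Context {R : realType}.
Local Notation C := R[i].
Implicit Types (M N H : SU2 R).
Local Notation Re := complex.Re.
Local Notation Im := complex.Im.

Lemma det22 (A : 'M[C]_2) : \det A = A 0 0 * A 1 1 - A 0 1 * A 1 0.
Proof.
rewrite (expand_det_row A 0) !big_ord_recl big_ord0 addr0 /cofactor !det_mx11 !mxE /=.
rewrite expr0 expr1 mul1r mulN1r mulrN.
by congr (A _ _ * A _ _ - A _ _ * A _ _); apply: val_inj.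
Qed.

Lemma SU2_entries M : SU2val M 1 1 = (SU2val M 0 0)^* /\ SU2val M 1 0 = - (SU2val M 0 1)^*.
Proof.
have /andP[/unitarymxP uM /eqP dM] := SU2valP M.
move: dM; rewrite det22 => dM.
have := congr1 (fun A : 'M[C]_2 => A 0 0) uM; have := congr1 (fun A : 'M[C]_2 => A 1 0) uM.
rewrite !mxE !big_ord_recl !big_ord0 !mxE /= !addr0.
rewrite (_ : lift ord0 ord0 = 1) //; last by apply: val_inj.
move: (SU2val M 0 0) (SU2val M 0 1) (SU2val M 1 0) (SU2val M 1 1) dM => a b c d dM e1 e0.
split.
  transitivity ((a * a^* + b * b^*) * d); first by rewrite e0 mul1r.
  transitivity (a^* * (a * d - b * c) + b * (c * a^* + d * b^*)); first by ring.
  by rewrite dM e1 mulr0 addr0 mulr1.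
transitivity ((a * a^* + b * b^*) * c); first by rewrite e0 mul1r.
transitivity (- (b^* * (a * d - b * c)) + a * (c * a^* + d * b^*)); first by ring.
by rewrite dM e1 mulr0 addr0 mulr1.
Qed.

Definition q0 M : R := Re (SU2val M 0 0).
Definition q1 M : R := Im (SU2val M 0 0).
Definition q2 M : R := Re (SU2val M 0 1).
Definition q3 M : R := Im (SU2val M 0 1).

Lemma conjcE (z : C) : z^* = (Re z -i* Im z)%C.
Proof. by case: z. Qed.

Lemma quat_ext M N : q0 M = q0 N -> q1 M = q1 N -> q2 M = q2 N -> q3 M = q3 N -> M = N.
Proof.
rewrite /q0 /q1 /q2 /q3 => e0 e1 e2 e3.
have [m11 m10] := SU2_entries M; have [n11 n10] := SU2_entries N.
have a : SU2val M 0 0 = SU2val N 0 0 by apply/eqP; rewrite eq_complex e0 e1 !eqxx.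
have b : SU2val M 0 1 = SU2val N 0 1 by apply/eqP; rewrite eq_complex e2 e3 !eqxx.
apply: val_inj; apply/matrixP => i j; rewrite /=.
have o (k : 'I_2) : k = 0 \/ k = 1.
  by case: k => -[|[|]] // ?; [left|right]; apply: val_inj.
by case: (o i) => ->; case: (o j) => ->; rewrite ?m11 ?m10 ?n11 ?n10 ?a ?b.
Qed.

Lemma quat_norm M : q0 M ^+ 2 + q1 M ^+ 2 + q2 M ^+ 2 + q3 M ^+ 2 = 1.
Proof.
have /andP[_ /eqP dM] := SU2valP M; have [m11 m10] := SU2_entries M.
move: dM; rewrite det22 m11 m10 /q0 /q1 /q2 /q3 !conjcE.
case: (SU2val M 0 0) (SU2val M 0 1) => a b [c d] /=.
move=> /(congr1 (@Re R)) /=; lra.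
Qed.

Lemma quat_mul M N :
  [/\ q0 (M * N)%g = q0 M * q0 N - q1 M * q1 N - q2 M * q2 N - q3 M * q3 N,
      q1 (M * N)%g = q0 M * q1 N + q1 M * q0 N + q2 M * q3 N - q3 M * q2 N,
      q2 (M * N)%g = q0 M * q2 N + q2 M * q0 N + q3 M * q1 N - q1 M * q3 N &
      q3 (M * N)%g = q0 M * q3 N + q3 M * q0 N + q1 M * q2 N - q2 M * q1 N].
Proof.
have [n11 n10] := SU2_entries N.
rewrite /q0 /q1 /q2 /q3 /= !mxE !big_ord_recl !big_ord0 /= !addr0.
rewrite (_ : lift ord0 ord0 = 1) //; last by apply: val_inj.
rewrite n11 n10 !conjcE.
case: (SU2val M 0 0) (SU2val M 0 1) (SU2val N 0 0) (SU2val N 0 1).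
move=> a b [c d] [a' b'] [c' d'] /=.
by split; ring.
Qed.

(** The vanishing of the cross product of the imaginary parts. *)
Definition parallel M N : Prop := [/\ q2 M * q3 N = q3 M * q2 N,
  q3 M * q1 N = q1 M * q3 N & q1 M * q2 N = q2 M * q1 N].

Lemma comm_parallel M N : (M * N = N * M)%g <-> parallel M N.
Proof.
have [a0 a1 a2 a3] := quat_mul M N; have [b0 b1 b2 b3] := quat_mul N M.
split=> [e|[h1 h2 h3]].
  by split; [move: a1 b1|move: a2 b2|move: a3 b3]; rewrite e => -> ; lra.
by apply: quat_ext; [rewrite a0 b0|rewrite a1 b1|rewrite a2 b2|rewrite a3 b3]; lra.
Qed.

Lemma quat1 : [/\ q0 (1%g : SU2 R) = 1, q1 (1%g : SU2 R) = 0,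
  q2 (1%g : SU2 R) = 0 & q3 (1%g : SU2 R) = 0].
Proof. by rewrite /q0 /q1 /q2 /q3 /= !mxE. Qed.

Definition scalar_quat M := [&& q1 M == 0, q2 M == 0 & q3 M == 0].

Lemma scalar_comm M N : scalar_quat M -> (M * N = N * M)%g.
Proof.
move=> /and3P[/eqP m1 /eqP m2 /eqP m3]; apply/comm_parallel.
by rewrite /parallel m1 m2 m3; split; ring.
Qed.

Lemma scalar_sqr M : scalar_quat M -> (M * M = 1)%g.
Proof.
move=> /and3P[/eqP m1 /eqP m2 /eqP m3]; have n := quat_norm M.
have [a0 a1 a2 a3] := quat_mul M M; have [b0 b1 b2 b3] := quat1.
rewrite m1 m2 m3 in n a0 a1 a2 a3.
by apply: quat_ext; [rewrite a0 b0|rewrite a1 b1|rewrite a2 b2|rewrite a3 b3]; lra.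
Qed.

Lemma quat_axis M : ~~ scalar_quat M -> exists h1 h2 h3 : R,
  h1 ^+ 2 + h2 ^+ 2 + h3 ^+ 2 = 1 /\ exists2 s, s != 0 &
  [/\ q1 M = s * h1, q2 M = s * h2 & q3 M = s * h3].
Proof.
move=> ns; pose n := q1 M ^+ 2 + q2 M ^+ 2 + q3 M ^+ 2.
have n0 : 0 < n.
  rewrite lt0r; apply/andP; split; last by rewrite !addr_ge0 // sqr_ge0.
  apply: contra ns => /eqP n0; move: (sqr_ge0 (q1 M)) (sqr_ge0 (q2 M)) (sqr_ge0 (q3 M)).
  move=> p1 p2 p3; rewrite /n in n0.
  by apply/and3P; split; rewrite -sqrf_eq0; apply/eqP; lra.
have s0 : 0 < Num.sqrt n by rewrite sqrtr_gt0.
have s2 : Num.sqrt n ^+ 2 = n by rewrite sqr_sqrtr // ltW.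
exists (q1 M / Num.sqrt n), (q2 M / Num.sqrt n), (q3 M / Num.sqrt n); split.
  by rewrite !expr_div_n s2 -!mulrDl divff // gt_eqF.
exists (Num.sqrt n); first by rewrite gt_eqF.
by split; rewrite mulrC divfK // gt_eqF.
Qed.

Definition along (h1 h2 h3 : R) M : Prop :=
  exists s, [/\ q1 M = s * h1, q2 M = s * h2 & q3 M = s * h3].

Lemma parallel_along h1 h2 h3 M H s : h1 ^+ 2 + h2 ^+ 2 + h3 ^+ 2 = 1 -> s != 0 ->
  [/\ q1 H = s * h1, q2 H = s * h2 & q3 H = s * h3] -> parallel M H ->
  along h1 h2 h3 M.
Proof.
move=> hn s0 [e1 e2 e3] []; rewrite e1 e2 e3 => p1 p2 p3.
have r1 : q2 M * h3 = q3 M * h2 by apply: (mulfI s0); lra.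
have r2 : q3 M * h1 = q1 M * h3 by apply: (mulfI s0); lra.
have r3 : q1 M * h2 = q2 M * h1 by apply: (mulfI s0); lra.
exists (q1 M * h1 + q2 M * h2 + q3 M * h3); split.
- rewrite -[LHS]mulr1 -[X in _ * X]hn.
  transitivity (q1 M * h1 * h1 + q1 M * h2 * h2 + q1 M * h3 * h3); first by ring.
  by rewrite r3 -r2; ring.
- rewrite -[LHS]mulr1 -[X in _ * X]hn.
  transitivity (q2 M * h1 * h1 + q2 M * h2 * h2 + q2 M * h3 * h3); first by ring.
  by rewrite -r3 r1; ring.
- rewrite -[LHS]mulr1 -[X in _ * X]hn.
  transitivity (q3 M * h1 * h1 + q3 M * h2 * h2 + q3 M * h3 * h3); first by ring.
  by rewrite r2 -r1; ring.
Qed.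

Lemma along_parallel h1 h2 h3 M N :
  along h1 h2 h3 M -> along h1 h2 h3 N -> parallel M N.
Proof.
by move=> [s [m1 m2 m3]] [t [n1 n2 n3]]; rewrite /parallel m1 m2 m3 n1 n2 n3; split; ring.
Qed.

(** The centralizer of a noncentral unit quaternion is the circle of those along its axis, which is
    abelian. *)
Lemma comm_trans M N H : ~~ scalar_quat H ->
  (M * H = H * M)%g -> (N * H = H * N)%g -> (M * N = N * M)%g.
Proof.
move=> /quat_axis[h1 [h2 [h3 [hn [s s0 hs]]]]] /comm_parallel mh /comm_parallel nh.
apply/comm_parallel; apply: (@along_parallel h1 h2 h3).
  exact: (parallel_along hn s0 hs mh).
exact: (parallel_along hn s0 hs nh).
Qed.

(** The real part x of a unit quaternion with cube 1 satisfies 4 x^3 - 3 x = 1, which factors as (x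
    - 1) (2 x + 1)^2 = 0. *)
Lemma cube_root M : (M * M * M = 1)%g -> M = 1%g \/ q0 M = - 2^-1.
Proof.
move=> M3; have n := quat_norm M; have [b0 b1 b2 b3] := quat1.
have [a0 a1 a2 a3] := quat_mul M M; have [c0 _ _ _] := quat_mul (M * M)%g M.
move: c0; rewrite M3 b0 a0 a1 a2 a3 => c0.
have : (q0 M - 1) * (2 * q0 M + 1) ^+ 2 = 0.
  have v : q1 M ^+ 2 + q2 M ^+ 2 + q3 M ^+ 2 = 1 - q0 M ^+ 2 by lra.
  have : 1 = q0 M ^+ 3 - 3 * q0 M * (q1 M ^+ 2 + q2 M ^+ 2 + q3 M ^+ 2).
    by rewrite [LHS]c0; ring.
  by rewrite v => h; lra.
move/eqP; rewrite mulf_eq0 sqrf_eq0 => /orP[/eqP h|/eqP h]; last by right; lra.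
left; have m0 : q0 M = 1 by lra.
have p1 := sqr_ge0 (q1 M); have p2 := sqr_ge0 (q2 M); have p3 := sqr_ge0 (q3 M).
rewrite m0 in n.
by apply: quat_ext; rewrite ?b0 ?b1 ?b2 ?b3 //; apply/eqP; rewrite -sqrf_eq0; apply/eqP; lra.
Qed.

(* A unit quaternion of order 3 has real part -1/2; if so do M, N and M * N, then
   the real part of M * N forces M = N. *)
Lemma cube_comm M N : (M * M * M = 1)%g -> (N * N * N = 1)%g ->
  (M * N * (M * N) * (M * N) = 1)%g -> (M * N = N * M)%g.
Proof.
move=> /cube_root[->|m0]; first by rewrite mulg1 mul1g.
move=> /cube_root[->|n0]; first by rewrite mulg1 mul1g.
move=> /cube_root[e|e0].
  have -> : N = (M^-1)%g by apply: (mulgI M); rewrite mulgV.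
  by rewrite mulgV mulVg.
have [a0 _ _ _] := quat_mul M N; have nM := quat_norm M; have nN := quat_norm N.
have d : (q1 M - q1 N) ^+ 2 + (q2 M - q2 N) ^+ 2 + (q3 M - q3 N) ^+ 2 = 0.
  by rewrite a0 m0 n0 in e0; rewrite m0 in nM; rewrite n0 in nN; lra.
have p1 := sqr_ge0 (q1 M - q1 N); have p2 := sqr_ge0 (q2 M - q2 N).
have p3 := sqr_ge0 (q3 M - q3 N).
have z (x y : R) : (x - y) ^+ 2 = 0 -> x = y.
  by move/eqP; rewrite sqrf_eq0 subr_eq0 => /eqP.
suff -> : M = N by [].
by apply: quat_ext; [rewrite m0 n0|apply: z; lra|apply: z; lra|apply: z; lra].
Qed.

(** The quaternions along a unit axis form a circle, on which this eigenvalue is a faithful complex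
    character. *)
Definition eigen (h1 h2 h3 : R) M : C :=
  (q0 M +i* (q1 M * h1 + q2 M * h2 + q3 M * h3))%C.

Lemma eigenE h1 h2 h3 M s : h1 ^+ 2 + h2 ^+ 2 + h3 ^+ 2 = 1 ->
  [/\ q1 M = s * h1, q2 M = s * h2 & q3 M = s * h3] ->
  eigen h1 h2 h3 M = (q0 M +i* s)%C.
Proof.
move=> hn [m1 m2 m3]; rewrite /eigen m1 m2 m3; congr (_ +i* _)%C.
by rewrite -[RHS]mulr1 -[X in _ = _ * X]hn; ring.
Qed.

Lemma eigen_inj h1 h2 h3 M N : h1 ^+ 2 + h2 ^+ 2 + h3 ^+ 2 = 1 ->
  along h1 h2 h3 M -> along h1 h2 h3 N ->
  eigen h1 h2 h3 M = eigen h1 h2 h3 N -> M = N.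
Proof.
move=> hn [s ms] [t nt]; rewrite (eigenE hn ms) (eigenE hn nt) => -[e0 es].
case: ms => m1 m2 m3; case: nt => n1 n2 n3.
by apply: quat_ext => //; [rewrite m1 n1|rewrite m2 n2|rewrite m3 n3]; rewrite es.
Qed.

Lemma eigen_mul h1 h2 h3 M N : h1 ^+ 2 + h2 ^+ 2 + h3 ^+ 2 = 1 ->
  along h1 h2 h3 M -> along h1 h2 h3 N ->
  eigen h1 h2 h3 (M * N)%g = eigen h1 h2 h3 M * eigen h1 h2 h3 N.
Proof.
move=> hn [s ms] [t nt]; have [a0 a1 a2 a3] := quat_mul M N.
rewrite (eigenE hn ms) (eigenE hn nt).
case: ms => m1 m2 m3; case: nt => n1 n2 n3.
rewrite (@eigenE _ _ _ _ (q0 M * t + s * q0 N)) //; last first.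
  by rewrite a1 a2 a3 m1 m2 m3 n1 n2 n3; split; ring.
apply/eqP; rewrite eq_complex /=; apply/andP; split=> //; apply/eqP.
rewrite a0 m1 m2 m3 n1 n2 n3.
transitivity (q0 M * q0 N - s * t * (h1 ^+ 2 + h2 ^+ 2 + h3 ^+ 2)); first by ring.
by rewrite hn mulr1.
Qed.

Lemma eigen_neq0 h1 h2 h3 M : h1 ^+ 2 + h2 ^+ 2 + h3 ^+ 2 = 1 -> along h1 h2 h3 M ->
  eigen h1 h2 h3 M != 0.
Proof.
move=> hn [s ms]; rewrite (eigenE hn ms); case: ms => m1 m2 m3; have n := quat_norm M.
apply/eqP => /eqP; rewrite eq_complex /= => /andP[/eqP y0 /eqP y1].
by move: n; rewrite m1 m2 m3 y0 y1; lra.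
Qed.

End Quaternions.

(** * Finite abelian subgroups of SU(2) *)

Section FiniteCyclic.
Context {R : realType}.

(** Multiplication by an element x permutes [rs]; comparing the products of all elements shows that
    x is a root of unity of order dividing the size of [rs]. A field with that many roots of unity
    among [rs] has a primitive one there. *)
Lemma finite_mul_cyclic (F : fieldType) (rs : seq F) : uniq rs -> (0 < size rs)%N ->
  0 \notin rs -> {in rs &, forall x y, x * y \in rs} ->
  exists2 z, z \in rs & forall y, y \in rs -> exists n : nat, y = z ^+ n.
Proof.
move=> urs rs0 z0 rsM.
have nz x : x \in rs -> x != 0 by apply: contraTneq => ->.
have unity x : x \in rs -> (size rs).-unity_root x.
  move=> xrs; have pm : perm_eq [seq x * y | y <- rs] rs.
    apply: uniq_perm => //; first by rewrite map_inj_uniq //; apply: mulfI; exact: nz.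
    have sub : {subset [seq x * y | y <- rs] <= rs}.
      by move=> _ /mapP[y yrs ->]; exact: rsM.
    apply: (uniq_min_size _ sub _).2; last by rewrite size_map.
    by rewrite map_inj_uniq //; apply: mulfI; exact: nz.
  apply/unity_rootP.
  have P0 : \prod_(y <- rs) y != 0 by rewrite prodf_seq_neq0; apply/allP => y /nz ->.
  apply: (mulIf P0); rewrite mul1r -[RHS](perm_big _ pm) /= big_map.
  by rewrite big_split /= big_const_seq count_predT iter_mulr_1.
have all_u : all (size rs).-unity_root rs by apply/allP.
have /hasP[z zrs pz] := has_prim_root rs0 all_u urs (leqnn _).
exists z => // y /unity /unity_rootP y1.
by have [i ->] := prim_rootP pz y1; exists i.
Qed.

(** Commuting unit quaternions share an axis, so [eigen] embeds the image in the multiplicative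
    group of the complex numbers. *)
Lemma SU2_abelian_cyclic (G : groupType) (rho : {multiplicative G -> SU2 R}) :
  (forall x y, (rho x * rho y = rho y * rho x)%g) -> finite_set (range rho) ->
  cyclic_image rho.
Proof.
move=> comm fin.
have [h1 [h2 [h3 [hn al]]]] : exists h1 h2 h3 : R, h1 ^+ 2 + h2 ^+ 2 + h3 ^+ 2 = 1
    /\ forall x, along h1 h2 h3 (rho x).
  have [[x nx]|sc] := pselect (exists x, ~~ scalar_quat (rho x)).
    have [h1 [h2 [h3 [hn [s s0 hs]]]]] := quat_axis nx.
    exists h1, h2, h3; split=> // y; apply: (parallel_along hn s0 hs).
    by apply/comm_parallel; exact: comm.
  (* All images are central here, so any axis will do. *)
  exists 1, 0, 0; split; first by ring.
  move=> x; have : scalar_quat (rho x) by apply: contrapT => /negP nx; apply: sc; exists x.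
  by move=> /and3P[/eqP e1 /eqP e2 /eqP e3]; exists 0; rewrite e1 e2 e3; split; ring.
pose chi x := eigen h1 h2 h3 (rho x).
have chiM x y : chi (x * y)%g = chi x * chi y by rewrite /chi gmulfM eigen_mul.
have finT : finite_set (range chi).
  have -> : range chi = eigen h1 h2 h3 @` range rho.
    apply/seteqP; split=> [_ [x _ <-]|_ [_ [x _ <-] <-]]; last by exists x.
    by exists (rho x) => //; exists x.
  exact: finite_image.
pose rs : seq R[i] := enum_fset (fset_set (range chi)).
have rsE x : x \in rs = (x \in range chi) by rewrite -in_fset_set.
have chirs x : chi x \in rs by rewrite rsE inE; exists x.
have [z zrs zP] : exists2 z, z \in rs & forall y, y \in rs -> exists n : nat, y = z ^+ n.
  apply: finite_mul_cyclic.
  - exact: fset_uniq.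
  - by have := chirs 1%g; case: (rs).
  - rewrite rsE; apply/negP; rewrite inE => -[x _ e].
    by have := @eigen_neq0 R h1 h2 h3 (rho x) hn (al x); rewrite -/(chi x) e eqxx.
  - move=> x y; rewrite !rsE !inE => -[a _ <-] [b _ <-].
    by exists (a * b)%g.
move: zrs; rewrite rsE inE => -[g _ gz].
exists g => x; have [n xn] := zP _ (chirs x); exists n; left.
have pow m : chi (g ^+ m)%g = z ^+ m.
  elim: m => [|m IH]; last by rewrite expgS chiM IH gz exprS.
  have c1 : chi 1%g * chi 1%g = chi 1%g by rewrite -chiM mulg1.
  by apply: (mulfI (eigen_neq0 hn (al 1%g))); rewrite -/(chi _) mulr1.
have rhoX m : (rho (g ^+ m) = rho g ^+ m)%g.
  elim: m => [|m IH]; last by rewrite !expgS gmulfM IH.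
  by apply: (mulgI (rho 1%g)); rewrite -gmulfM !mulg1.
rewrite -rhoX; apply: (eigen_inj hn (al x) (al _)).
by rewrite -/(chi x) -/(chi _) xn pow.
Qed.

End FiniteCyclic.

(** * Path connectedness and inverses modulo 3 *)

Section Basing.
Context {R : realType} {Y : topologicalType}.
Variable S : seifert_S2 R (fun=> 3%N) Y.
Local Notation eps := (10^-1 : R).

Lemma path_hub y : inhabited (path R y (hub S)).
Proof.
have e0 : 0 < eps by lra.
have [i iy] := chart_total S y e0.
have track_path z : chart S eps i z -> inhabited (path R z (defm S i 1 z)).
  move=> iz; have c : continuous (fun s : R => defm S i (clamp s) z).
    by apply: (defm_cont (p := fun=> z)); [exact: cst_cont|exact: clamp_cont| |exact: clamp_itv].
  constructor; apply: (Path c) => t h; first by rewrite clamp_le0 // defm0.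
  by rewrite clamp_ge1.
have [p] := track_path y iy; have [q] := track_path _ (hub_chart S i).
have [[z w] [/= dz cw] e] := defm1_solid iy; have [s wE] := circle_cis cw.
have tE : torus_map S i (z, s) = defm S i 1 y.
  by rewrite /torus_map /= retract_id // -wE.
have r := seg (@torus_map_cont _ _ S i) (z, s) (lhub S i).
rewrite tE hub_lift in r.
by constructor; exact: (pconcat p (pconcat r (prev q))).
Qed.

Lemma base_exists (y0 : Y) : inhabited (forall y, path R y0 y).
Proof.
have h y : inhabited (path R y0 y).
  by have [p] := path_hub y0; have [q] := path_hub y; constructor; exact: (pconcat p (prev q)).
constructor=> y; have /cid[p _] : exists p : path R y0 y, True by have [p] := h y; exists p.
exact: p.
Qed.

(** The determinant condition read modulo 3. *)
Lemma beta_inverse i : exists q, - seifert_gamma S i * seifert_beta S i = 1 + 3 * q.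
Proof. by exists (- seifert_delta S i); have := seifert_det S i; lia. Qed.

End Basing.

(** * Parity of the first homology group *)

Section DerivedSubgroup.
Context {G : groupType}.
Local Open Scope group_scope.
Implicit Types (x y : G) (H : set G).

Lemma derived_subgroup (K : set G) : is_subgroup (derived K).
Proof.
split=> [H [] //|x y hx hy H sH hH|x hx H sH hH]; have [_ HM HV] := sH.
  by apply: HM; [exact: hx|exact: hy].
by apply: HV; exact: hx.
Qed.

Lemma derived_conj x y : derived setT x -> derived setT (x ^ y).
Proof.
have [_ DM _] := derived_subgroup [set: G] => Dx.
rewrite (_ : x ^ y = x * [~ x, y]); last by rewrite commgEl mulVKg.
by apply: DM => // H _; exact.
Qed.

Definition coset x : set G := [set x * c | c in derived setT].

Lemma cosetP x y : coset x = coset y <-> derived setT (x^-1 * y).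
Proof.
have [D1 DM DV] := derived_subgroup [set: G]; split=> [e|Dxy].
  have : coset x y by rewrite e; exists 1; rewrite ?mulg1.
  by case=> c Dc <-; rewrite mulKg.
apply/seteqP; split=> _ [c Dc <-].
  exists ((x^-1 * y)^-1 * c); first by apply: DM => //; exact: DV.
  by rewrite invgM invgK !mulgA mulgV mul1g.
by exists (x^-1 * y * c); [exact: DM|rewrite !mulgA mulgV mul1g].
Qed.

Lemma cosetM x x' y y' : coset x = coset x' -> coset y = coset y' ->
  coset (x * y) = coset (x' * y').
Proof.
have [_ DM _] := derived_subgroup [set: G].
move=> /cosetP ex /cosetP ey; apply/cosetP.
rewrite (_ : _ * _ = (x^-1 * x') ^ y * (y^-1 * y')).
  exact: (DM _ _ (derived_conj _ ex) ey).
by rewrite conjgE invgM !mulgA mulgK.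
Qed.

Lemma cosetC x y : coset (x * y) = coset (y * x).
Proof.
apply/cosetP => H _ hH; have := hH y x I I.
by rewrite commgEl conjgE invgM !mulgA.
Qed.

Lemma cosetV x y : coset x = coset y -> coset x^-1 = coset y^-1.
Proof.
move=> /cosetP h; apply/cosetP; rewrite invgK.
have [_ _ DV] := derived_subgroup [set: G]; have := derived_conj y^-1 (DV _ h).
by rewrite conjgE invgM !invgK !mulgA mulgV mul1g.
Qed.

Lemma cosetACA x y z t : coset (x * y * (z * t)) = coset (x * z * (y * t)).
Proof.
rewrite !mulgA -!(mulgA x); apply: cosetM => //.
by apply: cosetM => //; exact: cosetC.
Qed.

(** The class of [x] in the quotient of H_1 by its doubles, when it is 0 or the class of [h]; the
    boolean tells which. *)
Definition even_class (h : G) (b : bool) x : Prop :=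
  exists y, coset x = coset ((if b then h else 1) * (y * y)).

Lemma even_classM h b c x y : even_class h b x -> even_class h c y ->
  even_class h (b (+) c) (x * y).
Proof.
move=> [u xu] [v yv].
have [w ew] : exists w, coset ((if b then h else 1) * (if c then h else 1)) =
    coset ((if b (+) c then h else 1) * (w * w)).
  case: b {xu}; case: c {yv} => /=; last by [exists 1; rewrite !mulg1].
  - by exists h; rewrite mul1g.
  - by exists 1; rewrite !mulg1.
  - by exists 1; rewrite !mulg1 mul1g.
exists (w * (u * v)); rewrite (cosetM xu yv) cosetACA.
rewrite (cosetM ew (cosetACA u u v v)) -mulgA.
by apply: cosetM => //; exact: cosetACA.
Qed.

Lemma int_parity (n : int) : exists m : int, n = (m + m + (odd `|n|)%:Z)%R.
Proof.
case: n => k; [have := odd_double_half k|have := odd_double_half k.+1].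
  by exists (k./2 : int); rewrite /=; lia.
by exists (- (k.+1./2 : int) - (odd k.+1)%:Z)%R; rewrite /=; lia.
Qed.

(** From [x ^+ 3 = h] one has x = h x^(-2), so [x] is [h] modulo squares. *)
Lemma zexp_even_class h x n : x ^+ 3 = h -> even_class h (odd `|n|) (zexp x n).
Proof.
move=> x3; have [m nE] := int_parity n.
exists (if odd `|n| then zexp x m * x^-1 else zexp x m).
have -> : zexp x n = zexp x m * zexp x m * zexp x (odd `|n|)%:Z.
  by rewrite {1}nE !zexpD.
case: (odd _) => /=; last by rewrite mulg1 mul1g.
rewrite [LHS]cosetC expg1.
rewrite (_ : coset (h * _) = coset (h * (x^-1 * x^-1) * (zexp x m * zexp x m))).
  by rewrite -x3 !expgS expg0 mulg1 -!mulgA mulVKg !mulgA mulgK.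
rewrite -[in RHS]mulgA; apply: cosetM => //.
rewrite [RHS]cosetC; exact: cosetACA.
Qed.

(* Modulo squares and commutators every [g i] is [h], so that the relation makes [h] a square. *)
Lemma divisible_class h (g : 'I_3 -> G) (n : 'I_3 -> int) :
  (forall H, is_subgroup H -> (forall i, H (g i)) -> forall x, H x) ->
  (forall i, g i ^+ 3 = h) ->
  zexp (g 0%R) (n 0%R) * zexp (g 1%R) (n 1%R) * zexp (g 2%R) (n 2%R) = 1 ->
  odd `|n 0%R| (+) odd `|n 1%R| (+) odd `|n 2%R| ->
  forall x, exists y, coset x = coset (y * y).
Proof.
move=> gen g3 rel odd_n.
have par i := zexp_even_class (n i) (g3 i).
have := even_classM (even_classM (par 0%R) (par 1%R)) (par 2%R).
rewrite rel odd_n => -[y hy].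
have hE : coset h = coset (y^-1 * y^-1).
  have := cosetM hy (erefl (coset (y^-1 * y^-1))).
  by rewrite mul1g => ->; rewrite -!mulgA mulVKg mulgV mulg1.
have sq b x : even_class h b x -> exists y, coset x = coset (y * y).
  case: b => -[z xz]; last by exists z; rewrite xz mul1g.
  exists (y^-1 * z); rewrite xz (cosetM hE (erefl (coset (z * z)))).
  exact: cosetACA.
apply: gen => [|i]; last first.
  by have /sq := zexp_even_class 1%R (g3 i).
split; first by exists 1; rewrite mulg1.
  move=> x z [u xu] [v zv]; exists (u * v); rewrite (cosetM xu zv); exact: cosetACA.
by move=> x [u xu]; exists u^-1; rewrite (cosetV xu) invgM.
Qed.

End DerivedSubgroup.

(** * Odd order from divisibility by 2 *)

Section Involution.

Lemma even_card_involution (T : choiceType) (A : {fset T}) (f : T -> T) :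
  {in A, forall x, f x \in A} -> {in A, forall x, f (f x) = x} ->
  {in A, forall x, f x != x} -> ~~ odd #|`A|.
Proof.
have [n] := ubnP #|`A|; elim: n A => // n IH A leA fA ffA nfA.
have [->|[x xA]] := fset_0Vmem A; first by rewrite cardfs0.
have fxA : f x \in (A `\ x)%fset by rewrite !inE nfA //= fA.
rewrite (cardfsD1 x) xA (cardfsD1 (f x)) fxA /= negbK.
apply: IH => [|y|y|y]; rewrite ?inE.
- move: leA; rewrite (cardfsD1 x) xA (cardfsD1 (f x)) fxA; lia.
- case/and3P=> yfx yx yA; rewrite fA // andbT; apply/andP; split.
    by apply: contra yx => /eqP /(congr1 f); rewrite !ffA // => ->.
  by apply: contra yfx => /eqP <-; rewrite ffA.
- by case/and3P=> _ _; exact: ffA.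
- by case/and3P=> _ _; exact: nfA.
Qed.

(** Doubling is onto and the group is finite, so doubling is injective and there is no element of
    order 2. Inversion then pairs off all elements but the neutral one. *)
Lemma odd_abelianization (G : groupType) : finite_set (abelianization [set: G]) ->
  (forall x : G, exists y, coset x = coset (y * y)%g) ->
  odd #|` fset_set (abelianization [set: G])|%fset.
Proof.
move=> fin sq; set A := fset_set _.
have AE C : (C \in A) = `[< exists x, coset x = C >].
  rewrite in_fset_set //; apply/idP/asboolP.
    by rewrite inE => -[x _ <-]; exists x.
  by case=> x <-; rewrite inE; exists x.
have Ax (x : G) : coset x \in A by rewrite AE; apply/asboolP; exists x.
pose rep (C : set G) : G := xget 1%g [set x | coset x = C].
have repK C : C \in A -> coset (rep C) = C.
  by rewrite AE => /asboolP[x xC]; have := xgetPex 1%g (ex_intro (fun x => coset x = C) x xC).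
pose dbl C := coset (rep C * rep C)%g; pose opp C := coset (rep C)^-1%g.
have dblE x : dbl (coset x) = coset (x * x)%g by apply: cosetM; exact: repK.
have oppE x : opp (coset x) = coset x^-1%g by apply: cosetV; exact: repK.
have inj : {in A &, injective dbl}.
  (* The list of doubles contains all of [A] and has the same length, so it has no repetition. *)
  have u : uniq [seq dbl C | C <- enum_fset A].
    apply: (leq_size_uniq (fset_uniq A)); last by rewrite size_map.
    move=> C; rewrite [_ \in _](AE C) => /asboolP[x <-]; have [y ->] := sq x.
    by apply/mapP; exists (coset y); [exact: Ax|rewrite dblE].
  move=> C C' CA C'A e; apply/eqP/negP => /negP nCC'.
  have := uniqP (set0 : set G) u (index C (enum_fset A)) (index C' (enum_fset A)).
  rewrite !inE size_map !index_mem => /(_ CA C'A).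
  rewrite !(nth_map set0) ?index_mem // !nth_index // => /(_ e) ei.
  by move: nCC'; rewrite -(nth_index set0 CA) ei nth_index // eqxx.
have fix1 C : C \in A -> opp C = C -> C = coset (1 : G)%g.
  rewrite AE => /asboolP[x <-]; rewrite oppE => e; apply: inj => //; rewrite !dblE mulg1.
  by rewrite -(cosetM e (erefl (coset x))) mulVg.
rewrite /A (cardfsD1 (coset (1 : G)%g)) -/A Ax /=.
apply: (@even_card_involution _ _ opp) => C; rewrite !inE => /andP[C1 CA].
- have:= CA; rewrite AE => /asboolP[x xC]; rewrite -xC oppE Ax andbT.
  apply: contra C1 => /eqP /cosetV; rewrite invgK xC invg1 => ->.
  by [].
- by have := CA; rewrite AE => /asboolP[x <-]; rewrite !oppE invgK.
- by apply: contra C1 => /eqP h; apply/eqP; exact: fix1.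
Qed.

End Involution.

(** * Representations to SU(2) *)

Section CommutingPowers.
Context {G : groupType}.
Local Open Scope group_scope.
Implicit Types x y : G.

Lemma commute_zexp x y m : commute x y -> commute x (zexp y m).
Proof.
move=> xy; apply: (@zexp_subgroup _ [set z | commute x z]) => //.
by split=> [|z t|z]; [exact: commute1|exact: commuteM|exact: commuteV].
Qed.

Lemma zexpMl x y m : commute x y -> zexp (x * y) m = zexp x m * zexp y m.
Proof.
move=> xy; apply/esym; move: m.
apply: (zexp_unique (f := fun m => zexp x m * zexp y m)); first by rewrite mulg1.
move=> m; rewrite !zexpS !mulgA; congr (_ * _); rewrite -!mulgA; congr (_ * _).
exact: (commute_zexp m xy).
Qed.

Lemma zexpM x m n : zexp (zexp x m) n = zexp x (m * n)%R.
Proof.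
apply/esym; move: n; apply: (zexp_unique (f := fun n => zexp x (m * n)%R)).
  by rewrite mulr0.
by move=> n; rewrite mulrDr mulr1 zexpD.
Qed.

Lemma zexp1 m : zexp (1 : G) m = 1.
Proof. by have := zexpM 1 0%R m; rewrite mul0r. Qed.

Lemma zexp_odd x m : x * x = 1 -> zexp x m = if odd `|m| then x else 1.
Proof.
move=> xx; have [n mE] := int_parity m; rewrite {1}mE !zexpD.
suff -> : zexp x n * zexp x n = 1 by rewrite mul1g; case: (odd _).
by rewrite -zexpMl // xx zexp1.
Qed.

End CommutingPowers.

Lemma morph_unit_inv (G H : groupType) (f : G -> H) : {morph f : x y / (x * y)%g} ->
  f 1%g = 1%g /\ {morph f : x / (x^-1)%g}.
Proof.
by move=> fM; split=> [|x]; [exact: (zexp_morph fM 1%g 0)|exact: (zexp_morph fM x (Negz 0))].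
Qed.

Section CyclicImages.
Context {R : realType}.
Local Open Scope group_scope.

(* If the common cube is not central, the [A i] lie in the abelian centralizer of
   it. Otherwise it is a sign, which can be absorbed in the [A i] since the sum of
   the [b i] is even; the [A i ^ (- b i)] are then three elements of order dividing
   3 with product 1. *)
Lemma images_commute (A : 'I_3 -> SU2 R) (b e : 'I_3 -> int) :
  (forall i j, A i ^+ 3 = A j ^+ 3) ->
  zexp (A 0%R) (- b 0%R)%R * zexp (A 1%R) (- b 1%R)%R * zexp (A 2%R) (- b 2%R)%R = 1 ->
  (forall i, exists q, (e i * b i = 1 + 3 * q)%R) ->
  odd `|b 0%R| (+) odd `|b 1%R| (+) odd `|b 2%R| = false ->
  forall i j, commute (A i) (A j).
Proof.
move=> A3' rel eb par i j.
have [H A3] : exists H, forall k, A k ^+ 3 = H by exists (A 0%R ^+ 3) => k.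
have AH k : commute (A k) H by rewrite -(A3 k); exact/commuteX.
have [sH|nsH] := boolP (scalar_quat H); last exact: (comm_trans nsH (AH i) (AH j)).
have cH M : commute H M := scalar_comm M sH.
have HH : H * H = 1 := scalar_sqr sH.
pose B k := H * A k; pose C k := zexp (B k) (- b k)%R.
have B3 k : B k ^+ 3 = 1.
  rewrite /B expgMn; last exact: cH.
  by rewrite A3 !expgS expg0 mulg1 HH mulg1 HH.
have C3 k : C k ^+ 3 = 1.
  by rewrite -[LHS]/(zexp (C k) 3%R) zexpM mulrC zexpM3.
have CE k : C k = (if odd `|b k| then H else 1) * zexp (A k) (- b k)%R.
  by rewrite /C zexpMl; [rewrite zexp_odd // abszN|exact: cH].
have C012 : C 0%R * C 1%R * C 2%R = 1.
  have collect p q r (x y z : SU2 R) : commute x q -> commute x r -> commute y r ->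
      p * x * (q * y) * (r * z) = p * q * r * (x * y * z).
    move=> xq xr yr; transitivity (p * (x * q) * (y * r) * z); first by rewrite !mulgA.
    rewrite xq yr; transitivity (p * q * (x * r) * y * z); first by rewrite !mulgA.
    by rewrite xr !mulgA.
  have central (c : bool) M : commute M (if c then H else 1).
    by case: c; [apply/commute_sym/cH|exact: commute1].
  rewrite !CE collect ?rel ?mulg1; try exact: central.
  by move: par; case: (odd _); case: (odd _); case: (odd _); rewrite ?mulg1 ?mul1g.
have C3' k : C k * C k * C k = 1 by rewrite -[RHS](C3 k) !expgS expg0 mulg1 mulgA.
have c01 : commute (C 0%R) (C 1%R).
  apply: cube_comm; [exact: C3'|exact: C3'|].
  have -> : C 0%R * C 1%R = (C 2%R)^-1 by apply: (mulIg (C 2%R)); rewrite C012 mulVg.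
  by rewrite -!invgM mulgA C3' invg1.
have c2 : C 2%R = (C 0%R * C 1%R)^-1.
  by apply: (mulgI (C 0%R * C 1%R)); rewrite C012 mulgV.
have cC k l : commute (C k) (C l).
  have c02 : commute (C 0%R) (C 2%R) by rewrite c2; apply/commuteV/commuteM.
  have c12 : commute (C 1%R) (C 2%R).
    by rewrite c2; apply/commuteV/commuteM => //; exact: commute_sym.
  by case: (ord3P 0 k) => ->; case: (ord3P 0 l) => ->; rewrite ?add0r; try exact: commute_refl;
    try exact: commute_sym.
(* The exponent [- b k] can be undone on elements with cube 1, as [e k] inverts [b k] modulo 3;
   commutation passes back from the [C k] to the [B k]. *)
have BE k : B k = zexp (C k) (- e k)%R.
  by have [q eq] := eb k; rewrite zexpM mulrNN mulrC eq zexpD zexpM3 // mulg1.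
have AE k : A k = H * B k by rewrite /B mulgA HH mul1g.
rewrite (AE i) (AE j); apply: commuteM; first exact/commute_sym/cH.
apply/commute_sym/commuteM; first exact/commute_sym/cH.
by rewrite (BE i) (BE j); apply/commute_zexp/commute_sym/commute_zexp/cC.
Qed.

(** A representation with commuting values kills the derived subgroup, so it factors through the
    finite group H_1. *)
Lemma finite_range_abelian (G : groupType) (rho : {multiplicative G -> SU2 R}) :
  finite_set (abelianization [set: G]) -> (forall x y, commute (rho x) (rho y)) ->
  finite_set (range rho).
Proof.
move=> fin comm.
have [rho1 rhoV] := morph_unit_inv (gmulfM (s := rho)).
have kerD x : derived setT x -> rho x = 1.
  move=> Dx; apply: (Dx [set x | rho x = 1]) => [|a b _ _]; last first.
    by rewrite /= commgEl conjgE !gmulfM !rhoV comm mulKg mulVg.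
  split=> [|x' y /= hx hy|x' /= hx]; rewrite /=; first exact: rho1.
    by rewrite gmulfM hx hy mulg1.
  by rewrite rhoV hx invg1.
rewrite (_ : range rho = (fun C => rho (xget 1 C)) @` abelianization [set: G]).
  exact: finite_image.
have repE x : rho (xget 1 (coset x)) = rho x.
  have : coset x (xget 1 (coset x)).
    have [D1 _ _] := derived_subgroup [set: G].
    by apply: (@xgetPex _ 1 (coset x)); exists x; exists 1; rewrite ?mulg1.
  by case=> c Dc <-; rewrite gmulfM (kerD _ Dc) mulg1.
apply/seteqP; split=> [_ [x _ <-]|_ [_ [x _ <-] <-]].
  by exists (coset x); [exists x|rewrite repE].
by exists x => //; rewrite repE.
Qed.

End CyclicImages.

Section SeifertCyclic.
Context {R : realType} {Y : topologicalType}.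
Variable S : seifert_S2 R (fun=> 3%N) Y.
Variables (y0 : Y) (base : forall y, path R y0 y).
Hypothesis fin : rational_homology_sphere R y0.
Local Notation gen := (gen S base).
Local Open Scope group_scope.

Lemma beta_parity : ~~ odd #|` fset_set (homology1 R y0)|%fset ->
  odd `|seifert_beta S 0%R| (+) odd `|seifert_beta S 1%R| (+) odd `|seifert_beta S 2%R| = false.
Proof.
move=> ev; apply/negbTE/negP => par; move/negP: ev; apply.
apply: odd_abelianization => //.
apply: (divisible_class (h := gen 0%R ^+ 3) (n := fun i => (- seifert_beta S i)%R)
  (@gen_generate _ _ S _ base) _ (@gen_product _ _ S _ base)).
  by move=> i; exact: gen_cube.
by rewrite !abszN.
Qed.

Lemma seifert_SU2_cyclic : ~~ odd #|` fset_set (homology1 R y0)|%fset -> SU2_cyclic R y0.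
Proof.
move=> ev rho; have rhoM : {morph rho : x y / x * y} by move=> x y; exact: gmulfM.
have [rho1 rhoV] := morph_unit_inv rhoM.
have cg i j : commute (rho (gen i)) (rho (gen j)).
  apply: (images_commute (A := fun i => rho (gen i))
    (e := fun i => (- seifert_gamma S i)%R) _ _ (beta_inverse S) (beta_parity ev)).
    move=> k l; have e := gen_cube S base k l.
    by rewrite -[LHS]/(zexp _ 3%R) -[RHS]/(zexp _ 3%R) -!(zexp_morph rhoM) /= e.
  by rewrite -!(zexp_morph rhoM) -!rhoM gen_product rho1.
(* Preimages of centralizers are subgroups, so commutation extends from the generators to all
   elements, in one argument and then in the other. *)
have sub (P : set (SU2 R)) : is_subgroup [set x | forall y, P y -> commute y (rho x)].
  split=> [y _|x z hx hz y Py|x hx y Py] /=.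
  - by rewrite rho1; exact: commute1.
  - by rewrite gmulfM; apply: commuteM; [exact: hx|exact: hz].
  - by rewrite rhoV; apply: commuteV; exact: hx.
have cgx x i : commute (rho (gen i)) (rho x).
  apply: (gen_generate (sub [set rho (gen i) | i in setT]) _ x); last by exists i.
  by move=> j _ [k _ <-]; exact: cg.
have c x y : commute (rho x) (rho y).
  apply: (gen_generate (sub (range rho)) _ y); last by exists x.
  by move=> j _ [z _ <-]; apply/commute_sym/cgx.
by apply: SU2_abelian_cyclic => //; exact: finite_range_abelian.
Qed.

End SeifertCyclic.

(** * The affine representation *)

Section AffineGroup.
Context {C : fieldType}.

(* [x] stands for the similarity [z |-> x.1 z + x.2]. *)
Record affine := MkAffine { affval :> C * C; affvalP : affval.1 ^+ 3 == 1 }.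

HB.instance Definition _ := [isSub for affval].
HB.instance Definition _ := [Choice of affine by <:].

Implicit Types x y : affine.

Lemma affine_cube x : x.1 ^+ 3 = 1.
Proof. exact/eqP/affvalP. Qed.

Fact affine_one_subproof : (1 : C, 0 : C).1 ^+ 3 == 1.
Proof. by rewrite expr1n. Qed.

Fact affine_mul_subproof x y : (x.1 * y.1, x.2 + x.1 * y.2).1 ^+ 3 == 1.
Proof. by rewrite /= exprMn !affine_cube mulr1. Qed.

Fact affine_inv_subproof x : (x.1 ^+ 2, - (x.1 ^+ 2 * x.2)).1 ^+ 3 == 1.
Proof. by rewrite /= exprAC affine_cube expr1n. Qed.

Definition affine_one := MkAffine affine_one_subproof.
Definition affine_mul x y := MkAffine (affine_mul_subproof x y).
Definition affine_inv x := MkAffine (affine_inv_subproof x).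

Fact affine_mulA : associative affine_mul.
Proof. by move=> x y z; apply: val_inj; congr (_, _) => /=; ring. Qed.

Fact affine_mul1 : left_id affine_one affine_mul.
Proof. by move=> [[v t] h]; apply: val_inj; congr (_, _) => /=; ring. Qed.

Fact affine_mulr1 : right_id affine_one affine_mul.
Proof. by move=> [[v t] h]; apply: val_inj; congr (_, _) => /=; ring. Qed.

Fact affine_mulV : left_inverse affine_one affine_inv affine_mul.
Proof.
move=> x; apply: val_inj; congr (_, _); rewrite /= ?subrr ?addNr //.
by rewrite -exprSr affine_cube.
Qed.

Fact affine_mulrV : right_inverse affine_one affine_inv affine_mul.
Proof.
move=> x; apply: val_inj; congr (_, _); rewrite /= -?exprS ?affine_cube //.
by rewrite mulrN mulrA -exprS affine_cube mul1r subrr.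
Qed.

HB.instance Definition _ := isGroup.Build affine
  affine_mulA affine_mul1 affine_mulr1 affine_mulV affine_mulrV.

Lemma affine1E : ((1%g : affine).1 = 1) * ((1%g : affine).2 = 0).
Proof. by []. Qed.

Lemma affineME x y : ((x * y)%g.1 = x.1 * y.1) * ((x * y)%g.2 = x.2 + x.1 * y.2).
Proof. by []. Qed.

Lemma affineVE x : ((x^-1)%g.1 = x.1 ^+ 2) * ((x^-1)%g.2 = - (x.1 ^+ 2 * x.2)).
Proof. by []. Qed.

Lemma affine_ext x y : x.1 = y.1 -> x.2 = y.2 -> x = y.
Proof. by move=> e1 e2; apply: val_inj; rewrite /= [LHS]surjective_pairing e1 e2 -surjective_pairing. Qed.

Lemma affine_translation_conj x y : y.1 = 1 ->
  (x * y * x^-1)%g.1 = 1 /\ (x * y * x^-1)%g.2 = x.1 * y.2.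
Proof.
rewrite !affineME !affineVE => ->; rewrite mulr1 -exprS affine_cube; split=> //.
transitivity (x.1 * y.2 + (1 - x.1 ^+ 3) * x.2); first by ring.
by rewrite affine_cube subrr mul0r addr0.
Qed.

Variable w : C.
Hypothesis wE : w ^+ 2 + w + 1 = 0.

Lemma w_cube : w ^+ 3 = 1.
Proof.
apply/eqP; rewrite -subr_eq0; apply/eqP.
by transitivity ((w - 1) * (w ^+ 2 + w + 1)); [ring|rewrite wE mulr0].
Qed.

Lemma cube_rootE (v : C) : v ^+ 3 = 1 -> exists n : nat, v = w ^+ n.
Proof.
move=> v3; have : (v - 1) * ((v - w) * (v - w ^+ 2)) = 0.
  transitivity (v ^+ 3 - w ^+ 3 - (w ^+ 2 + w + 1) * (v ^+ 2 - w * v)); first by ring.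
  by rewrite v3 w_cube wE subrr mul0r subrr.
move/eqP; rewrite !mulf_eq0 !subr_eq0 => /or3P[] /eqP ->; [exists 0%N|exists 1%N|exists 2%N];
  by rewrite ?expr0 ?expr1.
Qed.

Lemma affine_rotation_cube x : x.1 = w -> (x ^+ 3 = 1)%g.
Proof.
move=> xw; apply: affine_ext; rewrite !expgS expg0 mulg1 !affineME affine1E xw.
  by rewrite -!expr2 -exprS w_cube.
transitivity ((w ^+ 2 + w + 1) * x.2); first by ring.
by rewrite wE mul0r.
Qed.

Fact corner_subproof (k : 'I_3) : (w ^+ (2 * k), (k == 2%R)%:R : C).1 ^+ 3 == 1.
Proof. by rewrite /= exprAC w_cube expr1n. Qed.

(* Chosen so that the [rotation corner i] are rotations of order 3 with distinct
   centers. *)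
Definition corner (k : 'I_3) : affine := MkAffine (corner_subproof k).

Lemma rotation_cornerE i : (rotation corner i).1 = w.
Proof.
rewrite /rotation affineME affineVE /=.
rewrite -exprM -exprD -(expr_mod _ w_cube).
by case: (ord3P 0 i) => ->; exact: expr1.
Qed.

Lemma rotation_corner_neq :
  (rotation corner 0 * (rotation corner 1%R)^-1)%g.1 = 1 /\
  (rotation corner 0 * (rotation corner 1%R)^-1)%g.2 = w.
Proof.
have r0 := rotation_cornerE 0; have r1 := rotation_cornerE 1.
have t0 : (rotation corner 0).2 = - w ^+ 2.
  rewrite /rotation affineME affineVE /= mulr0 addr0 mulr1 -exprM -(expr_mod _ w_cube).
  by [].
have t1 : (rotation corner 1).2 = 1.
  rewrite /rotation affineME affineVE /= mulr0 oppr0 add0r -exprM -(expr_mod _ w_cube) mulr1.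
  by [].
move: (rotation corner 0) (rotation corner 1) r0 r1 t0 t1 => x y r0 r1 t0 t1.
rewrite !affineME !affineVE r0 r1 t0 t1 -exprS w_cube; split=> //.
have w3 := w_cube; transitivity (- w ^+ 2 - w ^+ 3); first by ring.
rewrite w_cube; apply/eqP; rewrite -subr_eq0; apply/eqP.
by transitivity (- (w ^+ 2 + w + 1)); [ring|rewrite wE oppr0].
Qed.

End AffineGroup.
Arguments affine C : clear implicits.

(** * The linear part as a representation to SU(2) *)

Section LinearPart.
Context {R : realType}.
Local Notation C := R[i].
Implicit Types x y : affine C.

(** A cube root of unity has modulus 1 and its square is its inverse, so the two diagonal entries
    are conjugate with product 1. *)
Fact diag_subproof (x : affine C) :
  is_SU2 (diag_mx (\row_(j < 2) if j == 0 then x.1 else x.1 ^+ 2)).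
Proof.
have n1 : x.1 * x.1^* = 1.
  rewrite -normCK; apply/eqP; rewrite sqrp_eq1 // -(@pexpr_eq1 _ _ 3) //.
  by rewrite -normrX affine_cube normr1.
apply/andP; split.
  apply/unitarymxP/matrixP => i j; rewrite !mxE !big_ord_recl big_ord0 !mxE addr0.
  have n2 : x.1 ^+ 2 * (x.1 ^+ 2)^* = 1 by rewrite rmorphXn -exprMn n1 expr1n.
  by case: i => -[|[|]] // i2; case: j => -[|[|]] // j2;
    rewrite -!val_eqE /= ?mulr0n ?mulr1n ?conjC0 ?mulr0 ?mul0r ?addr0 ?add0r.
rewrite det_diag !big_ord_recl big_ord0 !mxE /= mulr1 -exprS affine_cube.
by [].
Qed.

Definition diag (x : affine C) : SU2 R := MkSU2 (diag_subproof x).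

Lemma diagM : {morph diag : x y / (x * y)%g}.
Proof.
move=> x y; apply: val_inj; rewrite /= mulmx_diag; congr diag_mx.
by apply/rowP => j; rewrite !mxE; case: ifP => // _; rewrite exprMn.
Qed.

Lemma diag_eq x y : x.1 = y.1 -> diag x = diag y.
Proof. by move=> e; apply: val_inj; rewrite /= e. Qed.

(** Commuting with the single matrix [X] already forces [x.1] to equal its square. The scalar -1,
    also trivial under the adjoint map, is excluded because [x.1] has cube 1. *)
Lemma diag_ker x : (forall X, su2 X -> Ad (diag x) X = X) <-> x.1 = 1.
Proof.
split=> [h|x1]; last first.
  move=> X _; rewrite /Ad (_ : SU2val (diag x) = 1%:M) ?mul1mx ?invmx1 ?mulmx1 //.
  by apply/matrixP => i j; rewrite /= !mxE x1 expr1n if_same.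
pose X : 'M[C]_2 := \matrix_(i, j) (if i == j then 0 else if i == 0 then 1 else -1).
have sX : su2 X.
  split; last by rewrite /mxtrace !big_ord_recl big_ord0 !mxE !addr0.
  apply/matrixP => i j; rewrite !mxE.
  by case: i => -[|[|]] // i2; case: j => -[|[|]] // j2;
    rewrite -!val_eqE /= ?rmorphN ?rmorph0 ?rmorph1 ?oppr0 ?opprK.
have /(congr1 (fun A : 'M[C]_2 => (A *m SU2val (diag x)) 0 1)) := h X sX.
rewrite /Ad mulmxKV ?SU2_unit // !mxE !big_ord_recl !big_ord0 !mxE /=.
rewrite mulr0n !mulr1n !mulr0 mulr1 !addr0 add0r mul1r => e.
by have := affine_cube x; rewrite exprS -e -expr2 -e.
Qed.

Lemma cube_root_of_unity : exists w : C, w ^+ 2 + w + 1 = 0.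
Proof.
exists (- 2^-1 +i* (Num.sqrt 3 / 2))%C.
have s3 : Num.sqrt 3 ^+ 2 = 3 :> R by rewrite sqr_sqrtr.
by apply/eqP; rewrite eq_complex /=; apply/andP; split; apply/eqP; lra.
Qed.

End LinearPart.

(** * Infinite first homology of the kernel *)

Section NotCyclicallyFinite.
Context {R : realType} {Y : topologicalType}.
Variable S : seifert_S2 R (fun=> 3%N) Y.
Variable y0 : Y.

(** On the kernel [F] takes values in the translations, which commute, so it kills the derived
    subgroup. The powers of an element mapped to a nonzero translation then lie in pairwise distinct
    cosets. *)
Lemma seifert_not_cyclically_finite : ~ cyclically_finite R y0.
Proof.
have [w wE] := @cube_root_of_unity R; have [base] := base_exists S y0.
pose e i := - seifert_gamma S i.
have rc i := affine_rotation_cube wE (rotation_cornerE wE i).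
have [F FM FP] := orbifold_hom rc (beta_inverse S) y0.
have {FP}[v FP] := FP base.
have [F1 FV] := morph_unit_inv FM.
(* The exponent [beta] undoes [e i] modulo 3, so that [u i] goes to a conjugate of the rotation
   itself. *)
pose u i := zexp (gen S base i) (seifert_beta S i).
have Fu i : F (u i) = (v * rotation (corner wE) i * v^-1)%g.
  rewrite (zexp_morph FM) FP zexp_conj zexpM; have [q ->] := beta_inverse S i.
  by rewrite zexpD zexpM3 // mulg1.
have Fu1 : (F (u 0)).1 = w.
  rewrite Fu; move: (rotation _ 0) (rotation_cornerE wE 0) => r rE.
  rewrite !affineME affineVE rE mulrAC -exprS affine_cube mul1r.
  by [].
(* A quotient of two rotations by the same angle is a translation, here by [w] up to the conjugation
   by [v]; it is nonzero because a cube root of unity is. *)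
pose z := (u 0 * (u 1%R)^-1)%g.
have [z1 z2] : (F z).1 = 1 /\ (F z).2 != 0.
  have [r1 r2] := rotation_corner_neq wE.
  have [c1 c2] := affine_translation_conj v r1.
  have -> : F z = (v * (rotation (corner wE) 0 * (rotation (corner wE) 1%R)^-1) * v^-1)%g.
    rewrite FM FV !Fu; move: (rotation _ 0) (rotation _ 1) => r s.
    by rewrite !invgM invgK !mulgA mulgVK.
  split=> //; rewrite c2 r2; apply/eqP => vw0.
  have : (v.1 * w) ^+ 3 = 1 by rewrite exprMn affine_cube w_cube // mulr1.
  by rewrite vw0 expr0n => /eqP; rewrite eq_sym oner_eq0.
pose rho0 x := diag (F x).
have rho0M : {morph rho0 : x y / (x * y)%g} by move=> x y; rewrite /rho0 FM diagM.
pose rho : {multiplicative pi1 R y0 -> SU2 R} := HB.pack rho0 (isMultiplicative.Build _ _ rho0 rho0M).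
have cyc : cyclic_image rho.
  (* The linear part of [F (u 0)] is [w], whose powers are all the cube roots of unity. *)
  exists (u 0) => x; have [n xn] := cube_rootE wE (affine_cube (F x)).
  exists n; left; transitivity (rho0 (u 0 ^+ n)%g); last exact: (zexp_morph rho0M (u 0) n).
  apply: diag_eq; rewrite xn -Fu1; elim: n {xn} => [|n IH]; first by rewrite F1.
  by rewrite exprS expgS FM affineME -IH.
move=> /(_ rho cyc) fin.
have kerP x : ker_ad rho x <-> (F x).1 = 1 by exact: diag_ker.
have [K1 KM KV] : is_subgroup (ker_ad rho).
  split=> [|x y /kerP hx /kerP hy|x /kerP hx]; apply/kerP; first by rewrite F1.
    by rewrite FM affineME hx hy mulr1.
  by rewrite FV affineVE hx expr1n.
have derF x : derived (ker_ad rho) x -> F x = 1%g.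
  move=> Dx; apply: (Dx [set x | F x = 1%g]).
    split=> [//|a b /= ha hb|a /= ha]; first by rewrite FM ha hb mulg1.
    by rewrite FV ha invg1.
  move=> a b /kerP ha /kerP hb; rewrite /= commgEl conjgE !FM !FV.
  apply: affine_ext; rewrite !affineME !affineVE ha hb ?expr1n ?mulr1 // affine1E.
  by ring.
have Kz n : ker_ad rho (z ^+ n)%g.
  by elim: n => [|n IH] //; rewrite expgS; apply: KM => //; apply/kerP.
have tz n : (F (z ^+ n)%g).2 = (F z).2 *+ n.
  elim: n => [|n IH]; first by rewrite F1.
  by rewrite expgS FM affineME z1 mul1r IH mulrS.
pose c (n : nat) := [set (z ^+ n * d)%g | d in derived (ker_ad rho)].
have c_inj : injective c.
  move=> m n cmn.
  have : c n (z ^+ m)%g.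
    rewrite -cmn; exists 1%g; last by rewrite mulg1.
    by have [] := derived_subgroup (ker_ad rho).
  case=> d /derF Fd dE.
  have mn : (F z).2 *+ n = (F z).2 *+ m by rewrite -!tz -dE FM Fd mulg1.
  move: mn; rewrite -(mulr_natr _ n) -(mulr_natr _ m) => /(mulfI z2) /eqP.
  by rewrite eqr_nat => /eqP.
apply: infinite_nat; apply: (@sub_finite_set _ _ (c @^-1` abelianization (ker_ad rho))).
  by move=> n _; exists (z ^+ n)%g.
by apply: finite_preimage => // m n _ _; exact: c_inj.
Qed.

End NotCyclicallyFinite.

Theorem proposition6p1 (R : realType) (Y : topologicalType) (y0 : Y)
    (Yfib : seifert_S2 R (fun=> 3%N) Y)
    (Yqhs : rational_homology_sphere R y0)
    (Yeven : ~~ odd #|` fset_set (homology1 R y0)|%fset) :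
  SU2_cyclic R y0 /\ ~ cyclically_finite R y0.
Proof.
have [base] := base_exists Yfib y0; split.
  exact: (seifert_SU2_cyclic Yfib base Yqhs Yeven).
exact: (@seifert_not_cyclically_finite R Y Yfib y0).
Qed.
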